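(* Let $\Omega$ be an open subset of $\mathbb{R}^2$ with $(0,0)\in\Omega$, and let $X:\Omega\to\mathbb{R}^2$ be a real analytic vector field that has a non-degenerate center at $(0,0)$. Then there exists a real analytic function $V$, defined in a neighborhood of $0\in\mathbb{R}$, with $V(0)=V'(0)=0$ and $V''(0)>0$, such that $X$ is analytically conjugate, on a neighborhood of $(0,0)$, to the vector field $$Y=y\frac{\partial}{\partial x}-V'(x)\frac{\partial}{\partial y}.$$
   Context: A planar vector field $X=(P,Q)$ is also written $X=P\frac{\partial}{\partial x}+Q\frac{\partial}{\partial y}$; it corresponds to the system $\dot x=P(x,y)$, $\dot y=Q(x,y)$. A singular point of $X$ is a point $p$ with $X(p)=(0,0)$; it is non-degenerate if the Jacobian determinant $\det DX(p)=P_x(p)Q_y(p)-P_y(p)Q_x(p)$ is non-zero. A singular point $p$ is a center of $X$ if there is an open neighborhood $U$ of $p$ such that each solution of the system with initial condition in $U\setminus\{p\}$ defines a periodic orbit surrounding $p$. Vector fields $X$ and $Y$ (analytic near $(0,0)$, with a singular point there) are analytically conjugate on a neighborhood of $(0,0)$ if there are open neighborhoods $U$, $W$ of $(0,0)$, contained in the domains of $X$ and $Y$ respectively, and a real analytic diffeomorphism $h:U\to W$ (bijective and real analytic, with real analytic inverse) with $h(0,0)=(0,0)$ such that $D_qh\,X(q)=Y(h(q))$ for every $q\in U$. *)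

(* Defs.v *)
From HB Require Import structures.
From mathcomp Require Import all_boot all_order all_algebra.
From mathcomp Require Import all_classical all_reals all_analysis.

Set Implicit Arguments.
Unset Strict Implicit.
Unset Printing Implicit Defensive.

Import Order.TTheory GRing.Theory Num.Theory.
Import numFieldNormedType.Exports.

Local Open Scope ring_scope.
Local Open Scope classical_set_scope.

Definition analytic1_at (R : realType) (f : R -> R) (a : R) : Prop :=
  exists (c : R^nat) (r : R), 0 < r /\
    forall x : R, `|x - a| < r -> pseries c (x - a) @ \oo --> f x.

Definition analytic1_on (R : realType) (A : set R) (f : R -> R) : Prop :=
  forall a : R, A a -> analytic1_at f a.

(* Partial sums over the squares [0, n[ x [0, n[; for an absolutely convergent
   double series the order of summation is immaterial. *)
Definition dseries (R : realType) (a : nat -> nat -> R) : R^nat :=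
  fun n => \sum_(i < n) \sum_(j < n) a i j.

Definition monomial_term (R : realType) (c : nat -> nat -> R) (v : R * R)
    (i j : nat) : R :=
  c i j * v.1 ^+ i * v.2 ^+ j.

Definition analytic2_at (R : realType) (f : R * R -> R) (p : R * R) : Prop :=
  exists (c : nat -> nat -> R) (r : R), 0 < r /\
    forall v : R * R, `|v.1| < r -> `|v.2| < r ->
      cvgn (dseries (fun i j => `|monomial_term c v i j|)) /\
      dseries (monomial_term c v) @ \oo --> f (p + v).

Definition analytic2_on (R : realType) (A : set (R * R)) (F : R * R -> R * R) :
    Prop :=
  forall p : R * R, A p ->
    analytic2_at (fun q => (F q).1) p /\ analytic2_at (fun q => (F q).2) p.

Definition det_jacobian (R : realType) (X : R * R -> R * R) (p : R * R) : R :=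
  let P := fun q : R * R => (X q).1 in
  let Q := fun q : R * R => (X q).2 in
  'D_(1, 0) P p * 'D_(0, 1) Q p - 'D_(0, 1) P p * 'D_(1, 0) Q p.

Definition singular_point (R : realType) (X : R * R -> R * R) (p : R * R) :
    Prop :=
  X p = (0, 0).

Definition nondegenerate_at (R : realType) (X : R * R -> R * R) (p : R * R) :
    Prop :=
  det_jacobian X p != 0.

Definition is_solution (R : realType) (Omega : set (R * R))
    (X : R * R -> R * R) (I : set R) (g : R -> R * R) : Prop :=
  forall t : R, I t -> Omega (g t) /\ is_derive t (1 : R) g (X (g t)).

Definition is_periodic_solution (R : realType) (Omega : set (R * R))
    (X : R * R -> R * R) (g : R -> R * R) : Prop :=
  [/\ is_solution Omega X setT g,
      exists T : R, 0 < T /\ forall t : R, g (t + T) = g t &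
      exists t : R, g t <> g 0].

(* [connected_component A p] is empty when [~ A p], hence the first conjunct. *)
Definition surrounds (R : realType) (O : set (R * R)) (p : R * R) : Prop :=
  ~ O p /\ bounded_set (connected_component (~` O) p).

(* A solution on an open interval "defines a periodic orbit" when it is the
   restriction of a periodic solution; for a solution that is maximal in time
   this says that it is itself a periodic solution. *)
Definition is_center (R : realType) (Omega : set (R * R)) (X : R * R -> R * R)
    (p : R * R) : Prop :=
  singular_point X p /\
  exists U : set (R * R), [/\ open U, U p, U `<=` Omega &
    forall (q : R * R) (I : set R) (g : R -> R * R),
      U q -> q <> p ->
      open I -> is_interval I -> I 0 ->
      is_solution Omega X I g -> g 0 = q ->
      exists d : R -> R * R,
        [/\ is_periodic_solution Omega X d,
            forall t : R, I t -> d t = g t &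
            surrounds (range d) p]].

Definition analytic_diffeo (R : realType) (U W : set (R * R))
    (h : R * R -> R * R) : Prop :=
  [/\ set_bij U W h, analytic2_on U h &
      exists k : R * R -> R * R,
        (forall q : R * R, U q -> k (h q) = q) /\ analytic2_on W k].

Definition analytically_conjugate (R : realType) (DX : set (R * R))
    (X : R * R -> R * R) (DY : set (R * R)) (Y : R * R -> R * R) : Prop :=
  exists (U W : set (R * R)) (h : R * R -> R * R),
    [/\ [/\ open U, U (0, 0) & U `<=` DX],
        [/\ open W, W (0, 0) & W `<=` DY],
        analytic_diffeo U W h,
        h (0, 0) = (0, 0) &
        forall q : R * R, U q -> 'd h q (X q) = Y (h q)].

(* Main.v *)
(* Let D = x d/dy - y d/dx and rho = x^2 + y^2. The eigenvalues of DX(0) are not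
   real: a real one would give an analytic invariant curve carrying solutions
   that tend to the origin. A contraction then yields analytic T, H and K, with
   K(0) = 0 and DK(0) invertible, such that
     D K = (1 + T rho) / beta * X(K) - H rho * E,
   where E is the linear map to which K is close. If H did not vanish, the
   equation would fail at the point of a periodic orbit that is closest to the
   origin in the coordinates (x, y), so H = 0. Precomposing K with rotations of
   angle psi (x, y) replaces 1 + T rho by a positive function of x alone:
     D K = gam x * X(K).
   In the coordinates (x, y), X is thus (- y, x) / gam x, and the map (G x, - y)
   with G' = gam, G 0 = 0 sends it to (y, - x / gam x), which is Y for
   V = g^2 / 2 with g the inverse of G. *)

(* After scaling, the eigenvalues are al + i and al - i; the trace is not known to vanish, and its
   contribution goes into H. The equation for K is solvable for any such linear part, center or not.
   In z = x + i y the field D is diagonal: it multiplies z^a conj(z)^b by i (a - b). Only the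
   monomials z (z conj z)^m make the imaginary part of i (a - b) - (al + i) vanish; their complex
   coefficients form two real series in rho, which are absorbed by T (imaginary part, a change of
   time) and H (real part). On all other monomials that imaginary part is a non-zero integer, so
   there are no small divisors and a plain contraction converges. The center is used to show that
   the eigenvalues are not real and to produce zeros of H that accumulate at 0, which suffices
   because H is analytic. A function with prescribed angular derivative exists only if that
   derivative has mean zero on every circle. The means of the x^(2m) determine one even function of
   x with the means of T rho, and the factors 4^m / C(2m, m) that they introduce cost no more than a
   smaller radius. *)
Require Import Defs.
From HB Require Import structures.
From mathcomp Require Import all_boot all_order all_algebra.
From mathcomp Require Import all_classical all_reals all_analysis.
From mathcomp Require Import polyXY complex.
From mathcomp Require Import ring lra.

Import Order.TTheory GRing.Theory Num.Theory.
Import numFieldNormedType.Exports.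

Local Open Scope ring_scope.
Local Open Scope classical_set_scope.

Set Implicit Arguments.
Unset Strict Implicit.
Unset Printing Implicit Defensive.

(** * Weighted l1-norms on polynomials *)

Section Seminorm.
Variable R : realType.

(** These are the properties that [pnorm] inherits from the coefficient ring, so that the
    construction iterates to polynomials in two variables. *)
Record seminorm (A : comNzRingType) (N : A -> R) : Prop := Seminorm {
  seminorm0 : N 0 = 0;
  seminormN : forall x, N (- x) = N x;
  seminormD : forall x y, N (x + y) <= N x + N y;
  seminormM : forall x y, N (x * y) <= N x * N y }.

Lemma seminorm_ge0 (A : comNzRingType) (N : A -> R) :
  seminorm N -> forall x, 0 <= N x.
Proof.
move=> sN x; have := seminormD sN x (- x).
rewrite subrr (seminorm0 sN) (seminormN sN); lra.
Qed.

Lemma seminormB (A : comNzRingType) (N : A -> R) :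
  seminorm N -> forall x y, N (x - y) <= N x + N y.
Proof. by move=> sN x y; rewrite -(seminormN sN y) seminormD. Qed.

Lemma seminormMle (A : comNzRingType) (N : A -> R) (x y : A) (a b : R) :
  seminorm N -> N x <= a -> N y <= b -> N (x * y) <= a * b.
Proof.
move=> sN xa yb; apply: (le_trans (seminormM sN _ _)).
by apply: ler_pM => //; exact: seminorm_ge0.
Qed.

Lemma seminorm_sum (A : comNzRingType) (N : A -> R) (I : Type) (s : seq I)
    (P : pred I) (F : I -> A) :
  seminorm N -> N (\sum_(i <- s | P i) F i) <= \sum_(i <- s | P i) N (F i).
Proof.
move=> sN; elim/big_ind2 : _ => //; first by rewrite (seminorm0 sN).
by move=> x a y b xa yb; rewrite (le_trans (seminormD sN _ _))// lerD.
Qed.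

Lemma seminorm_normr : @seminorm R Num.norm.
Proof.
split; [exact: normr0|exact: normrN|exact: ler_normD|].
by move=> x y; rewrite normrM.
Qed.

End Seminorm.

Section PolyNorm.
Variables (R : realType) (A : comNzRingType) (N : A -> R).
Hypothesis sN : seminorm N.
Implicit Types (p q : {poly A}) (r s t : R).

Definition pnorm r p : R := \sum_(i < size p) N p`_i * r ^+ i.

Lemma pnorm_widen n r p :
  (size p <= n)%N -> pnorm r p = \sum_(i < n) N p`_i * r ^+ i.
Proof.
move=> pn; rewrite /pnorm -!(big_mkord xpredT (fun i => N p`_i * r ^+ i)).
rewrite [RHS](big_cat_nat (leq0n (size p)) pn) /= [X in _ = _ + X]big_nat_cond.
rewrite [X in _ = _ + X]big1 ?addr0// => i /andP[/andP[pi _] _].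
by rewrite nth_default// (seminorm0 sN) mul0r.
Qed.

Lemma pnorm0 r : pnorm r 0 = 0.
Proof. by rewrite /pnorm size_poly0 big_ord0. Qed.

Lemma pnorm_cons r p c : pnorm r (p * 'X + c%:P) = r * pnorm r p + N c.
Proof.
have sz : (size (p * 'X + c%:P)%R <= (size p).+1)%N.
  rewrite (leq_trans (size_polyD _ _))// geq_max.
  rewrite (leq_trans (size_polyMleq _ _)) ?size_polyX ?addn2//=.
  by rewrite (leq_trans (size_polyC_leq1 _)).
rewrite (pnorm_widen r sz) big_ord_recl /= addrC.
rewrite coefD coefMX coefC /= add0r expr0 mulr1; congr (_ + _).
rewrite /pnorm big_distrr /=; apply: eq_bigr => i _.
by rewrite coefD coefMX coefC /= addr0 exprS; ring.
Qed.

Lemma pnormC r c : pnorm r c%:P = N c.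
Proof. by have := pnorm_cons r 0 c; rewrite mul0r add0r pnorm0 mulr0 add0r. Qed.

Lemma pnormX r : N 1 <= 1 -> 0 <= r -> pnorm r 'X <= r.
Proof.
move=> N1 r0; have := pnorm_cons r 1 0; rewrite mul1r addr0 => ->.
by rewrite pnormC (seminorm0 sN) addr0 ler_piMr.
Qed.

Lemma pnormMX r p : pnorm r (p * 'X) = r * pnorm r p.
Proof. by have := pnorm_cons r p 0; rewrite addr0 (seminorm0 sN) addr0. Qed.

Lemma pnormD r : 0 <= r -> forall p q, pnorm r (p + q) <= pnorm r p + pnorm r q.
Proof.
move=> r0 p q; set n := maxn (size p) (size q).
rewrite (@pnorm_widen n) ?(leq_trans (size_polyD _ _))//.
rewrite (@pnorm_widen n r p) ?leq_maxl// (@pnorm_widen n r q) ?leq_maxr//.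
rewrite -big_split /=; apply: ler_sum => i _; rewrite coefD -mulrDl.
by rewrite ler_wpM2r ?exprn_ge0// seminormD.
Qed.

Lemma pnormN r p : pnorm r (- p) = pnorm r p.
Proof.
rewrite /pnorm size_polyN; apply: eq_bigr => i _.
by rewrite coefN (seminormN sN).
Qed.

Lemma pnorm_ge0 r p : 0 <= r -> 0 <= pnorm r p.
Proof.
move=> r0; apply: sumr_ge0 => i _; apply: mulr_ge0; last exact: exprn_ge0.
exact: seminorm_ge0.
Qed.

Lemma pnormCM r c p : 0 <= r -> pnorm r (c%:P * p) <= N c * pnorm r p.
Proof.
move=> r0; rewrite mul_polyC (@pnorm_widen (size p)) ?size_scale_leq//.
rewrite /pnorm big_distrr /=; apply: ler_sum => i _.
by rewrite coefZ mulrA ler_wpM2r ?exprn_ge0// (seminormM sN).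
Qed.

Lemma pnormM r : 0 <= r -> forall p q, pnorm r (p * q) <= pnorm r p * pnorm r q.
Proof.
move=> r0 p q; elim/poly_ind : p => [|p c IH].
  by rewrite mul0r !pnorm0 mul0r.
rewrite pnorm_cons mulrDl (le_trans (pnormD r0 _ _))// mulrDl lerD//.
  by rewrite mulrAC pnormMX -mulrA ler_wpM2l.
exact: pnormCM.
Qed.

Lemma seminorm_pnorm r : 0 <= r -> seminorm (pnorm r).
Proof.
by move=> r0; split; [exact: pnorm0|exact: pnormN|exact: pnormD|exact: pnormM].
Qed.

Lemma le_pnorm s t p : 0 <= s <= t -> pnorm s p <= pnorm t p.
Proof.
move=> /andP[s0 st]; apply: ler_sum => i _; rewrite ler_wpM2l//.
  exact: seminorm_ge0.
by apply: lerXn2r; rewrite // nnegrE; lra.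
Qed.

Lemma coef_le_pnorm r p i : 0 <= r -> N p`_i * r ^+ i <= pnorm r p.
Proof.
move=> r0; have [pi|ip] := leqP (size p) i.
  by rewrite nth_default// (seminorm0 sN) mul0r pnorm_ge0.
rewrite /pnorm (bigD1 (Ordinal ip)) //= lerDl; apply: sumr_ge0 => j _.
by rewrite mulr_ge0 ?exprn_ge0// seminorm_ge0.
Qed.

Lemma horner_le_pnorm s p a : N a <= s -> N p.[a] <= pnorm s p.
Proof.
move=> aS; have s0 : 0 <= s by rewrite (le_trans _ aS)// seminorm_ge0.
elim/poly_ind : p => [|p c IH]; first by rewrite horner0 (seminorm0 sN) pnorm0.
rewrite hornerMXaddC pnorm_cons (le_trans (seminormD sN _ _))// lerD2r mulrC.
exact: seminormMle.
Qed.

(** An algebraic Cauchy estimate: the loss of radius from t to s pays for the derivative. The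
    induction follows Horner's scheme, so the values may lie in any seminormed ring, which covers
    substitution of polynomials as well as evaluation. *)
Lemma horner_lip s t p a b : N a <= s -> N b <= s -> s < t ->
  N (p.[a] - p.[b]) <= N (a - b) * (pnorm t p / (t - s)).
Proof.
move=> aS bS st; have s0 : 0 <= s by rewrite (le_trans _ aS)// seminorm_ge0.
have ts : 0 < t - s by rewrite subr_gt0.
elim/poly_ind : p => [|p c IH].
  by rewrite !horner0 subrr (seminorm0 sN) pnorm0 mul0r mulr0.
rewrite !hornerMXaddC pnorm_cons.
have -> : p.[a] * a + c - (p.[b] * b + c) = (p.[a] - p.[b]) * a + p.[b] * (a - b).
  by ring.
rewrite (le_trans (seminormD sN _ _))//.
have h1 := seminormMle sN IH aS.
have h2 := seminormMle sN (horner_le_pnorm p bS) (lexx (N (a - b))).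
have h3 : pnorm s p <= pnorm t p by rewrite le_pnorm// s0 ltW.
apply: (le_trans (lerD h1 h2)).
have ab0 := seminorm_ge0 sN (a - b).
have c0 := seminorm_ge0 sN c.
apply: (@le_trans _ _ (N (a - b) * (t * pnorm t p / (t - s)))); last first.
  by rewrite ler_wpM2l// ler_wpM2r ?invr_ge0 ?(ltW ts)// lerDl.
(* Since t / (t - s) = s / (t - s) + 1, the constant reproduces itself under Horner's recursion. The
   estimates below use the same identity. *)
have -> : t * pnorm t p / (t - s) = s * (pnorm t p / (t - s)) + pnorm t p.
  by field; rewrite gt_eqF.
have := ler_wpM2r ab0 h3; lra.
Qed.

Lemma deriv_le_pnorm s t p a : N a <= s -> s < t ->
  N p^`().[a] <= pnorm t p / (t - s).
Proof.
move=> aS st; have s0 : 0 <= s by rewrite (le_trans _ aS)// seminorm_ge0.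
have ts : 0 < t - s by rewrite subr_gt0.
elim/poly_ind : p => [|p c IH].
  by rewrite deriv0 horner0 (seminorm0 sN) pnorm0 mul0r.
rewrite derivD derivC addr0 derivM derivX mulr1 hornerD hornerM hornerX pnorm_cons.
rewrite (le_trans (seminormD sN _ _))//.
have h1 := seminormMle sN IH aS.
have h2 := horner_le_pnorm p aS.
have h3 : pnorm s p <= pnorm t p by rewrite le_pnorm// s0 ltW.
apply: (le_trans (lerD h1 h2)).
have c0 := seminorm_ge0 sN c.
apply: (@le_trans _ _ (t * pnorm t p / (t - s))); last first.
  by rewrite ler_wpM2r ?invr_ge0 ?(ltW ts)// lerDl.
have -> : t * pnorm t p / (t - s) = s * (pnorm t p / (t - s)) + pnorm t p.
  by field; rewrite gt_eqF.
lra.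
Qed.

Lemma horner_taylor s t p a h : N a <= s -> N (a + h) <= s -> s < t ->
  N (p.[a + h] - p.[a] - p^`().[a] * h) <= N h ^+ 2 * (pnorm t p / (t - s) ^+ 2).
Proof.
move=> aS ahS st; have s0 : 0 <= s by rewrite (le_trans _ aS)// seminorm_ge0.
have ts : 0 < t - s by rewrite subr_gt0.
have h0 := seminorm_ge0 sN h.
elim/poly_ind : p => [|p c IH].
  by rewrite deriv0 !horner0 subrr mul0r subr0 (seminorm0 sN) pnorm0 mul0r mulr0.
rewrite !hornerMXaddC pnorm_cons.
rewrite derivD derivC addr0 derivM derivX mulr1 hornerD hornerM hornerX.
set X := N _; have -> : X =
   N ((p.[a + h] - p.[a] - p^`().[a] * h) * a + (p.[a + h] - p.[a]) * h).
  by congr N; ring.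
rewrite (le_trans (seminormD sN _ _))//.
have h1 := seminormMle sN IH aS.
have h2 := horner_lip p ahS aS st; rewrite addrAC subrr add0r in h2.
have h3 := seminormMle sN h2 (lexx (N h)).
apply: (le_trans (lerD h1 h3)).
have c0 := seminorm_ge0 sN c.
apply: (@le_trans _ _ (N h ^+ 2 * (t * pnorm t p / (t - s) ^+ 2))); last first.
  apply: ler_wpM2l; first exact: exprn_ge0.
  by rewrite ler_wpM2r ?invr_ge0 ?exprn_ge0 ?(ltW ts)// lerDl.
have -> : t * pnorm t p / (t - s) ^+ 2 =
    s * (pnorm t p / (t - s) ^+ 2) + pnorm t p / (t - s).
  by field; rewrite gt_eqF.
by lra.
Qed.

Lemma pnorm_scale0 r (th : R) p : 0 <= r -> 0 <= th <= 1 -> p`_0 = 0 ->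
  pnorm (th * r) p <= th * pnorm r p.
Proof.
move=> r0 /andP[th0 th1] p0; rewrite /pnorm big_distrr /=.
apply: ler_sum => -[[|i] /= ip] _; first by rewrite p0 (seminorm0 sN) !mul0r mulr0.
rewrite exprMn !mulrA ler_wpM2r ?exprn_ge0// mulrC ler_wpM2r ?seminorm_ge0//.
by rewrite exprS ler_piMr// exprn_ile1.
Qed.

End PolyNorm.

Lemma pnorm_map (R : realType) (A B : comNzRingType) (N : A -> R) (M : B -> R)
    (f : {additive A -> B}) (r : R) (p : {poly A}) :
  seminorm N -> seminorm M -> 0 <= r -> (forall x, M (f x) <= N x) ->
  pnorm M r (map_poly f p) <= pnorm N r p.
Proof.
move=> sN sM r0 fN; rewrite (pnorm_widen sM _ (size_poly _ _)).
by apply: ler_sum => i _; rewrite coef_map /= ler_wpM2r ?exprn_ge0.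
Qed.

Definition nrm (R : realType) (K : comNzRingType) (N : K -> R) (r : R)
  (p : {poly {poly K}}) : R := pnorm (pnorm N r) r p.

Definition derY (K : comNzRingType) (p : {poly {poly K}}) : {poly {poly K}} :=
  map_poly (@deriv K) p.

Section DerY.
Variable K : comNzRingType.
Implicit Types p q : {poly {poly K}}.

Lemma derYD p q : derY (p + q) = derY p + derY q.
Proof. by rewrite /derY raddfD. Qed.

Lemma derYC (c : {poly K}) : derY c%:P = (deriv c)%:P.
Proof. by rewrite /derY map_polyC. Qed.

Lemma derYM p q : derY (p * q) = derY p * q + p * derY q.
Proof.
apply/polyP => i; rewrite coef_map coefD !coefM /= raddf_sum -big_split /=.
by apply: eq_bigr => j _; rewrite !coef_map /= derivM.
Qed.

Lemma derYX : derY ('X : {poly {poly K}}) = 0.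
Proof.
apply/polyP => i; rewrite coef_map coefX coef0 /=.
by case: (i == 1)%N; [rewrite -polyC1 derivC|rewrite deriv0].
Qed.

Lemma derY_cons p c : derY (p * 'X + c%:P) = derY p * 'X + (deriv c)%:P.
Proof. by rewrite derYD derYM derYX mulr0 addr0 derYC. Qed.

Lemma derX_cons p (c : {poly K}) : deriv (p * 'X + c%:P) = deriv p * 'X + p.
Proof. by rewrite derivD derivC addr0 derivM derivX mulr1. Qed.

End DerY.

Section Ev2Def.
Variables (K A : comNzRingType) (iota : {rmorphism K -> A}) (a b : A).

(** The target ring is arbitrary so that one set of estimates serves evaluation at real or complex
    points, substitution of polynomials, and passage from real to complex coefficients. *)
Definition ev2 : {poly {poly K}} -> A :=
  horner_eval a \o map_poly (horner_eval b \o map_poly iota).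

HB.instance Definition _ := GRing.RMorphism.copy ev2
  (horner_eval a \o map_poly (horner_eval b \o map_poly iota)).

Lemma ev2_cons p c : ev2 (p * 'X + c%:P) = ev2 p * a + (map_poly iota c).[b].
Proof.
rewrite rmorphD rmorphM /=; congr (_ * _ + _).
  by rewrite /ev2 /= map_polyX /horner_eval hornerX.
by rewrite /ev2 /= map_polyC /horner_eval /= hornerC.
Qed.

Lemma ev2C c : ev2 c%:P%:P = iota c.
Proof.
by have := ev2_cons 0 c%:P; rewrite mul0r add0r rmorph0 mul0r add0r map_polyC hornerC.
Qed.

Lemma ev2X : ev2 'X = a.
Proof.
by rewrite /ev2 /= map_polyX /horner_eval hornerX.
Qed.

Lemma ev2Y : ev2 'X%:P = b.
Proof.
have := ev2_cons 0 'X; rewrite mul0r add0r rmorph0 mul0r add0r => ->.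
by rewrite map_polyX hornerX.
Qed.

Lemma ev2D p q : ev2 (p + q) = ev2 p + ev2 q. Proof. exact: rmorphD. Qed.
Lemma ev2B p q : ev2 (p - q) = ev2 p - ev2 q. Proof. exact: rmorphB. Qed.
Lemma ev2M p q : ev2 (p * q) = ev2 p * ev2 q. Proof. exact: rmorphM. Qed.
Lemma ev20 : ev2 0 = 0. Proof. exact: rmorph0. Qed.

End Ev2Def.

Lemma ev2_eq (K A : comNzRingType) (i j : {rmorphism K -> A}) (a b : A) p :
  i =1 j -> ev2 i a b p = ev2 j a b p.
Proof.
move=> ij; elim/poly_ind : p => [|p c IH]; first by rewrite !rmorph0.
by rewrite !ev2_cons IH (eq_map_poly ij).
Qed.

Lemma ev2_morph (K A B : comNzRingType) (i : {rmorphism K -> A})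
    (f : {rmorphism A -> B}) (a b : A) p :
  f (ev2 i a b p) = ev2 (f \o i) (f a) (f b) p.
Proof.
elim/poly_ind : p => [|p c IH]; first by rewrite !rmorph0.
by rewrite !ev2_cons rmorphD rmorphM IH -horner_map map_poly_comp.
Qed.

Section Norm2.
Variables (R : realType) (K : comNzRingType) (N : K -> R).
Hypothesis sN : seminorm N.
Implicit Types p q : {poly {poly K}}.

Lemma seminorm_nrm r : 0 <= r -> seminorm (nrm N r).
Proof. by move=> r0; do 2 apply: seminorm_pnorm => //. Qed.

Lemma nrm_ge0 r p : 0 <= r -> 0 <= nrm N r p.
Proof. by move=> r0; exact: (seminorm_ge0 (seminorm_nrm r0)). Qed.

Lemma nrm_cons r p c : 0 <= r ->
  nrm N r (p * 'X + c%:P) = r * nrm N r p + pnorm N r c.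
Proof. by move=> r0; rewrite /nrm pnorm_cons//; exact: seminorm_pnorm. Qed.

Lemma nrmCC r c : 0 <= r -> nrm N r c%:P%:P = N c.
Proof. by move=> r0; rewrite /nrm !pnormC//; exact: seminorm_pnorm. Qed.

Lemma nrmX r : N 1 <= 1 -> 0 <= r -> nrm N r 'X <= r.
Proof.
move=> N1 r0; apply: pnormX => //; first exact: seminorm_pnorm.
by rewrite -polyC1 pnormC.
Qed.

Lemma nrmY r : N 1 <= 1 -> 0 <= r -> nrm N r 'X%:P <= r.
Proof.
move=> N1 r0; rewrite /nrm pnormC; first exact: pnormX.
exact: seminorm_pnorm.
Qed.

Lemma le_nrm s t p : 0 <= s <= t -> nrm N s p <= nrm N t p.
Proof.
move=> st; have /andP[s0 ts] := st; have t0 := le_trans s0 ts.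
elim/poly_ind : p => [|p c IH].
  by rewrite /nrm !pnorm0.
rewrite !nrm_cons// lerD ?le_pnorm// ler_pM//.
exact: nrm_ge0.
Qed.

Lemma coef_le_nrm r p i j : 0 <= r -> N p`_i`_j * r ^+ (i + j) <= nrm N r p.
Proof.
move=> r0; rewrite addnC exprD mulrA.
apply: le_trans (coef_le_pnorm (seminorm_pnorm sN r0) p i r0).
by rewrite ler_wpM2r ?exprn_ge0// coef_le_pnorm.
Qed.

Lemma nrm_scale0 r (th : R) p : 0 <= r -> 0 <= th <= 1 -> p`_0`_0 = 0 ->
  nrm N (th * r) p <= th * nrm N r p.
Proof.
move=> r0 /andP[th0 th1]; elim/poly_ind : p => [|p c _].
  by rewrite /nrm !pnorm0 mulr0.
rewrite coefD coefMX coefC /= add0r => c0.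
have tr0 : 0 <= th * r by rewrite mulr_ge0.
rewrite !nrm_cons// mulrDr lerD ?pnorm_scale0 ?th0//.
by rewrite -mulrA ler_wpM2l// ler_wpM2l// le_nrm// tr0 /= ler_piMl.
Qed.

(** Order 2 gains th^2, while a zoom by th divides by th only once; hence zooming makes a
    nonlinearity as small as desired. *)
Lemma nrm_scale1 r (th : R) p : 0 <= r -> 0 <= th <= 1 ->
  p`_0`_0 = 0 -> p`_1`_0 = 0 -> p`_0`_1 = 0 ->
  nrm N (th * r) p <= th ^+ 2 * nrm N r p.
Proof.
move=> r0 /andP[th0 th1]; elim/poly_ind : p => [|p c _].
  by rewrite /nrm !pnorm0 mulr0.
rewrite !coefD !coefMX !coefC /= !add0r addr0 => c0 p0 c1.
have tr0 : 0 <= th * r by rewrite mulr_ge0.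
rewrite !nrm_cons// mulrDr lerD//.
  rewrite expr2 -mulrA -(mulrA th) ler_wpM2l// mulrCA ler_wpM2l//.
  by rewrite nrm_scale0 ?th0.
elim/poly_ind : c c0 c1 => [|c d _]; first by rewrite !pnorm0 mulr0.
rewrite !coefD !coefMX !coefC /= add0r addr0 => -> c0.
rewrite !pnorm_cons// (seminorm0 sN) !addr0.
rewrite expr2 -mulrA -(mulrA th) ler_wpM2l// mulrCA ler_wpM2l//.
by rewrite pnorm_scale0 ?th0.
Qed.

Section Target.
Variables (A : comNzRingType) (M : A -> R) (iota : {rmorphism K -> A}).
Hypotheses (sM : seminorm M) (iotaM : forall x, M (iota x) <= N x).

Let inner_le s b c : M b <= s -> M (map_poly iota c).[b] <= pnorm N s c.
Proof.
move=> bs; have s0 : 0 <= s by rewrite (le_trans _ bs)// seminorm_ge0.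
by rewrite (le_trans (horner_le_pnorm sM _ bs))// pnorm_map.
Qed.

Lemma ev2_le s a b p : M a <= s -> M b <= s ->
  M (ev2 iota a b p) <= nrm N s p.
Proof.
move=> aS bS; have s0 : 0 <= s by rewrite (le_trans _ aS)// seminorm_ge0.
elim/poly_ind : p => [|p c IH].
  by rewrite rmorph0 (seminorm0 sM) /nrm pnorm0.
rewrite ev2_cons nrm_cons// (le_trans (seminormD sM _ _))// lerD ?inner_le//.
by rewrite mulrC seminormMle.
Qed.

Lemma ev2_lip s t a b a' b' p :
  M a <= s -> M b <= s -> M a' <= s -> M b' <= s -> s < t ->
  M (ev2 iota a b p - ev2 iota a' b' p) <=
  (M (a - a') + M (b - b')) * (nrm N t p / (t - s)).
Proof.
move=> aS bS aS' bS' st.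
have s0 : 0 <= s by rewrite (le_trans _ aS)// seminorm_ge0.
have ts : 0 < t - s by rewrite subr_gt0.
have t0 : 0 <= t by rewrite (le_trans s0) ?ltW.
have da := seminorm_ge0 sM (a - a'); have db := seminorm_ge0 sM (b - b').
elim/poly_ind : p => [|p c IH].
  by rewrite !rmorph0 subrr (seminorm0 sM) /nrm pnorm0 mul0r mulr0.
rewrite !ev2_cons nrm_cons//.
set u := ev2 _ a b p in IH *; set v := ev2 _ a' b' p in IH *.
set x := (map_poly _ _).[b]; set y := (map_poly _ _).[b'].
have -> : u * a + x - (v * a' + y) = (u - v) * a + v * (a - a') + (x - y) by ring.
have h1 := seminormMle sM IH aS.
have h2 := seminormMle sM (ev2_le p aS' bS') (lexx (M (a - a'))).
have h3 : M (x - y) <= M (b - b') * (pnorm N t c / (t - s)).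
  rewrite (le_trans (horner_lip sM _ bS bS' st))// ler_wpM2l//.
  by rewrite ler_wpM2r ?invr_ge0 ?(ltW ts)// pnorm_map.
have h4 : nrm N s p <= nrm N t p by rewrite le_nrm// s0 ltW.
have c0 : 0 <= pnorm N t c by rewrite pnorm_ge0.
rewrite (le_trans (seminormD sM _ _))//.
rewrite (le_trans (lerD (seminormD sM _ _) (lexx _)))//.
apply: (le_trans (lerD (lerD h1 h2) h3)).
have -> : (t * nrm N t p + pnorm N t c) / (t - s) =
    s * (nrm N t p / (t - s)) + nrm N t p + pnorm N t c / (t - s).
  by field; rewrite gt_eqF.
have c1 : 0 <= pnorm N t c / (t - s) by rewrite mulr_ge0// invr_ge0 ltW.
have p0 := nrm_ge0 p t0.
have := ler_wpM2l da h4; have := mulr_ge0 da c1; have := mulr_ge0 db p0.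
lra.
Qed.

Lemma ev2_derX_le s t a b p : M a <= s -> M b <= s -> s < t ->
  M (ev2 iota a b (deriv p)) <= nrm N t p / (t - s).
Proof.
move=> aS bS st.
have s0 : 0 <= s by rewrite (le_trans _ aS)// seminorm_ge0.
have ts : 0 < t - s by rewrite subr_gt0.
have t0 : 0 <= t by rewrite (le_trans s0) ?ltW.
elim/poly_ind : p => [|p c IH].
  by rewrite deriv0 rmorph0 (seminorm0 sM) /nrm pnorm0 mul0r.
rewrite derX_cons nrm_cons// rmorphD rmorphM /= ev2X.
have h1 := seminormMle sM IH aS.
have h2 := ev2_le p aS bS.
have h4 : nrm N s p <= nrm N t p by rewrite le_nrm// s0 ltW.
rewrite (le_trans (seminormD sM _ _))// (le_trans (lerD h1 h2))//.
have -> : (t * nrm N t p + pnorm N t c) / (t - s) =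
    s * (nrm N t p / (t - s)) + nrm N t p + pnorm N t c / (t - s).
  by field; rewrite gt_eqF.
have c1 : 0 <= pnorm N t c / (t - s).
  by rewrite mulr_ge0 ?pnorm_ge0// invr_ge0 ltW.
lra.
Qed.

Lemma ev2_derY_le s t a b p : M a <= s -> M b <= s -> s < t ->
  M (ev2 iota a b (derY p)) <= nrm N t p / (t - s).
Proof.
move=> aS bS st.
have s0 : 0 <= s by rewrite (le_trans _ aS)// seminorm_ge0.
have ts : 0 < t - s by rewrite subr_gt0.
have t0 : 0 <= t by rewrite (le_trans s0) ?ltW.
elim/poly_ind : p => [|p c IH].
  by rewrite /derY raddf0 rmorph0 (seminorm0 sM) /nrm pnorm0 mul0r.
rewrite derY_cons nrm_cons// ev2_cons.
have h1 := seminormMle sM IH aS.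
have h2 : M (map_poly iota (deriv c)).[b] <= pnorm N t c / (t - s).
  rewrite -deriv_map (le_trans (deriv_le_pnorm sM _ bS st))//.
  by rewrite ler_wpM2r ?invr_ge0 ?(ltW ts)// pnorm_map.
rewrite (le_trans (seminormD sM _ _))// (le_trans (lerD h1 h2))//.
rewrite mulrDl lerD2r mulrC mulrA ler_wpM2r ?invr_ge0 ?(ltW ts)//.
by rewrite ler_wpM2r ?nrm_ge0// ltW.
Qed.

(** The bound depends on p through its norm only. It is therefore uniform along a Cauchy sequence
    and yields differentiability of the limit in [plim_diff]. *)
Lemma ev2_taylor s t a b h k p :
  M a <= s -> M b <= s -> M (a + h) <= s -> M (b + k) <= s -> s < t ->
  M (ev2 iota (a + h) (b + k) p - ev2 iota a b p - ev2 iota a b (deriv p) * h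
     - ev2 iota a b (derY p) * k) <=
  (M h + M k) ^+ 2 * (nrm N t p / (t - s) ^+ 2).
Proof.
move=> aS bS ahS bkS st.
have s0 : 0 <= s by rewrite (le_trans _ aS)// seminorm_ge0.
have ts : 0 < t - s by rewrite subr_gt0.
have t0 : 0 <= t by rewrite (le_trans s0) ?ltW.
have h0 := seminorm_ge0 sM h; have k0 := seminorm_ge0 sM k.
elim/poly_ind : p => [|p c IH].
  rewrite /derY deriv0 !raddf0 ?rmorph0 !mul0r !subr0 ?addr0 (seminorm0 sM) /nrm pnorm0.
  by rewrite mul0r mulr0.
rewrite derY_cons derX_cons !ev2_cons nrm_cons// rmorphD rmorphM /= ev2X.
have lip := ev2_lip p ahS bkS aS bS st.
rewrite [a + h - a]addrAC subrr add0r [b + k - b]addrAC subrr add0r in lip.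
have tay := horner_taylor sM (map_poly iota c) bS bkS st.
rewrite deriv_map in tay.
set u := ev2 _ (a + h) (b + k) p in lip IH *.
set v := ev2 _ a b p in lip IH *.
set ux := ev2 _ a b (deriv p) in IH *; set uy := ev2 _ a b (derY p) in IH *.
set x := (map_poly iota c).[b + k] in tay *.
set y := (map_poly iota c).[b] in tay *.
set z := (map_poly iota (deriv c)).[b] in tay *.
set W := (X in M X <= _).
have -> : W = (u - v - ux * h - uy * k) * a + (u - v) * h + (x - y - z * k).
  by rewrite /W; ring.
have h1 := seminormMle sM IH aS.
have h2 := seminormMle sM lip (lexx (M h)).
rewrite (le_trans (seminormD sM _ _))//.
rewrite (le_trans (lerD (seminormD sM _ _) (lexx _)))//.
apply: (le_trans (lerD (lerD h1 h2) tay)).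
have cc : pnorm M t (map_poly iota c) <= pnorm N t c by rewrite pnorm_map.
have i2 : 0 <= (t - s) ^- 2 by rewrite invr_ge0 exprn_ge0// ltW.
have i1 : 0 <= (t - s)^-1 by rewrite invr_ge0 ltW.
have h3 : M k ^+ 2 * (pnorm M t (map_poly iota c) / (t - s) ^+ 2) <=
    (M h + M k) ^+ 2 * (pnorm N t c / (t - s) ^+ 2).
  rewrite ler_pM ?mulr_ge0 ?exprn_ge0 ?pnorm_ge0//; last by rewrite ler_wpM2r.
  by apply: lerXn2r; rewrite ?nnegrE ?addr_ge0// lerDr.
apply: (le_trans (lerD (lexx _) h3)).
have -> : (t * nrm N t p + pnorm N t c) / (t - s) ^+ 2 =
    s * (nrm N t p / (t - s) ^+ 2) + nrm N t p / (t - s) + pnorm N t c / (t - s) ^+ 2.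
  by field; rewrite gt_eqF.
have p0 : 0 <= nrm N t p / (t - s) by rewrite mulr_ge0 ?nrm_ge0.
have q0 : 0 <= (M h + M k) * M k * (nrm N t p / (t - s)).
  by rewrite mulr_ge0// mulr_ge0// addr_ge0.
lra.
Qed.

End Target.
End Norm2.

(** * Cauchy sequences for a seminorm, and a diagonal contraction *)

Section CauchySeq.
Variable R : realType.

Definition cauchyN (A : zmodType) (N : A -> R) (u : nat -> A) : Prop :=
  forall e : R, 0 < e -> exists n0, forall n m, (n0 <= n)%N -> (n0 <= m)%N ->
    N (u n - u m) <= e.

Lemma cvgnP (u : R^nat) (l : R) : u @ \oo --> l <->
  forall e : R, 0 < e -> exists n0, forall n, (n0 <= n)%N -> `|u n - l| <= e.
Proof.
split=> [/cvgrPdist_le ul e e0|ul].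
  have [n0 _ n0P] := ul _ e0; exists n0 => n nn0; rewrite distrC.
  exact: n0P.
apply/cvgrPdist_le => e e0; have [n0 n0P] := ul _ e0.
by exists n0 => // n /= /n0P; rewrite distrC.
Qed.

Lemma cvgn_shift (u : R^nat) (l : R) :
  u @ \oo --> l -> (fun n => u n.+1) @ \oo --> l.
Proof.
move=> /cvgnP ul; apply/cvgnP => e /ul[n0 n0P]; exists n0 => n nn0.
by apply: n0P; rewrite leqW.
Qed.

Lemma cvgn_squeeze0 (u w : R^nat) (l : R) : (forall n, `|u n - l| <= w n) ->
  w @ \oo --> (0 : R) -> u @ \oo --> l.
Proof.
move=> uw /cvgnP w0; apply/cvgnP => e /w0[n0 n0P]; exists n0 => n /n0P.
rewrite subr0 => /(le_trans (ler_norm _)); exact: le_trans.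
Qed.

Lemma cvgn_norm_le (u : R^nat) (l B : R) : u @ \oo --> l ->
  (forall n, `|u n| <= B) -> `|l| <= B.
Proof.
move=> ul uB; apply: (@cvgr_to_le _ \oo _ _ (fun n => `|u n|)).
  exact: cvg_norm ul.
exact: nearW.
Qed.

Lemma cvgn_uniq (u : R^nat) (l l' : R) : u @ \oo --> l -> u @ \oo --> l' -> l = l'.
Proof. by apply: cvg_unique; exact: norm_hausdorff. Qed.

Lemma cvgn_sum (n : nat) (u : 'I_n -> R^nat) (l : 'I_n -> R) :
  (forall i, u i @ \oo --> l i) ->
  (fun k => \sum_(i < n) u i k) @ \oo --> \sum_(i < n) l i.
Proof.
elim: n u l => [|n IH] u l ul.
  rewrite big_ord0; under eq_fun do rewrite big_ord0; exact: cvg_cst.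
rewrite big_ord_recr; under eq_fun do rewrite big_ord_recr.
by apply: cvgD => //=; exact: IH.
Qed.

Lemma cauchyN_cvg (u : R^nat) : cauchyN Num.norm u -> exists l : R, u @ \oo --> l.
Proof.
move=> cu; suff : cvg (u @ \oo) by move=> /cvg_ex.
apply/cauchy_cvgP/cauchy_ballP => e e0; rewrite !near_map2.
have [n0 n0P] := cu _ (divr_gt0 e0 (ltr0n R 2)).
exists ([set n | (n0 <= n)%N], [set n | (n0 <= n)%N]) => /=.
  by split; exists n0.
move=> [n m] /= [nn0 mn0]; rewrite /ball /=.
by rewrite (le_lt_trans (n0P _ _ nn0 mn0))// ltr_pdivrMr// ltr_pMr// ltr1n.
Qed.

Section Seminormed.
Variables (A : comNzRingType) (N : A -> R).
Hypothesis sN : seminorm N.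

Lemma cauchyN_bounded u : cauchyN N u -> exists2 B : R, 0 < B & forall n, N (u n) <= B.
Proof.
move=> /(_ 1 ltr01)[n0 n0P].
exists (1 + \sum_(i < n0.+1) N (u i)) => [|n].
  by rewrite ltr_wpDr// sumr_ge0// => i _; exact: seminorm_ge0.
have le_sum m : (m < n0.+1)%N -> N (u m) <= \sum_(i < n0.+1) N (u i).
  move=> mn; rewrite (bigD1 (Ordinal mn)) //= lerDl sumr_ge0// => i _.
  exact: seminorm_ge0.
have [nn0|/ltnW n0n] := leqP n n0.
  by rewrite (le_trans (le_sum _ _))// lerDr.
rewrite -(subrK (u n0) (u n)) (le_trans (seminormD sN _ _))//.
by rewrite lerD// ?n0P// le_sum.
Qed.

Lemma cauchyN_le (B : zmodType) (M : B -> R) (u : nat -> A) (v : nat -> B) (c : R) :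
  0 <= c -> (forall n m, M (v n - v m) <= c * N (u n - u m)) ->
  cauchyN N u -> cauchyN M v.
Proof.
move=> c0 vu cu e e0.
have c1 : 0 < c + 1 by rewrite ltr_wpDl.
have [n0 n0P] := cu _ (divr_gt0 e0 c1).
exists n0 => n m nn0 mn0; rewrite (le_trans (vu _ _))//.
have := n0P _ _ nn0 mn0; rewrite ler_pdivlMr// => h.
rewrite (le_trans _ h)// mulrC ler_wpM2l ?lerDl//; exact: seminorm_ge0.
Qed.

Lemma cauchyN_cst x : cauchyN N (fun=> x).
Proof.
by move=> e e0; exists 0%N => n m _ _; rewrite subrr (seminorm0 sN) ltW.
Qed.

Lemma cauchyND u v : cauchyN N u -> cauchyN N v -> cauchyN N (fun n => u n + v n).
Proof.
move=> cu cv e e0; have e2 : 0 < e / 2 by rewrite divr_gt0.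
have [n0 n0P] := cu _ e2; have [n1 n1P] := cv _ e2.
exists (maxn n0 n1) => n m; rewrite !geq_max => /andP[a b] /andP[c d].
rewrite opprD addrACA (le_trans (seminormD sN _ _))// [e]splitr lerD//.
  exact: n0P.
exact: n1P.
Qed.

Lemma cauchyNN u : cauchyN N u -> cauchyN N (fun n => - u n).
Proof.
move=> cu e /cu[n0 n0P]; exists n0 => n m nn0 mn0.
by rewrite -opprD (seminormN sN) n0P.
Qed.

Lemma cauchyNM u v : cauchyN N u -> cauchyN N v -> cauchyN N (fun n => u n * v n).
Proof.
move=> cu cv; have [B B0 uB] := cauchyN_bounded cu.
have [C C0 vC] := cauchyN_bounded cv => e e0.
have e2 : 0 < e / 2 / (B + C) by rewrite !divr_gt0// addr_gt0.
have [n0 n0P] := cu _ e2; have [n1 n1P] := cv _ e2.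
exists (maxn n0 n1) => n m; rewrite !geq_max => /andP[a b] /andP[c d].
have -> : u n * v n - u m * v m = (u n - u m) * v n + u m * (v n - v m) by ring.
rewrite (le_trans (seminormD sN _ _))//.
have h1 := seminormMle sN (n0P _ _ a c) (vC n).
have h2 := seminormMle sN (uB m) (n1P _ _ b d).
rewrite (le_trans (lerD h1 h2))//.
rewrite [B * _]mulrC -mulrDr (addrC C) mulfVK ?gt_eqF ?addr_gt0//.
by rewrite ler_pdivrMr// ler_peMr ?(ltW e0)// ler1n.
Qed.

End Seminormed.

(** The outer polynomial and the arguments vary at the same time: a change of p is measured at
    radius s, a change of the arguments by the Lipschitz bound, which uses the gap between s and
    t. *)
Lemma cauchyN_ev2 (K A : comNzRingType) (N : K -> R) (M : A -> R)
    (iota : {rmorphism K -> A}) (s t : R) (p : nat -> {poly {poly K}})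
    (a b : nat -> A) :
  seminorm N -> seminorm M -> (forall x, M (iota x) <= N x) -> s < t ->
  (forall n, M (a n) <= s) -> (forall n, M (b n) <= s) ->
  cauchyN (nrm N t) p -> cauchyN M a -> cauchyN M b ->
  cauchyN M (fun n => ev2 iota (a n) (b n) (p n)).
Proof.
move=> sN sM iM st aS bS cp ca cb.
have s0 : 0 <= s by rewrite (le_trans _ (aS 0%N))// seminorm_ge0.
have t0 : 0 <= t by rewrite (le_trans s0) ?ltW.
have ts : 0 < t - s by rewrite subr_gt0.
have [B B0 pB] := cauchyN_bounded (seminorm_nrm sN t0) cp => e e0.
have e1 : 0 < e / 2 by rewrite divr_gt0.
have e2 : 0 < e / 4 * ((t - s) / B) by rewrite mulr_gt0 ?divr_gt0.
have [n0 n0P] := cp _ e1; have [n1 n1P] := ca _ e2; have [n2 n2P] := cb _ e2.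
exists (maxn n0 (maxn n1 n2)) => n m.
rewrite !geq_max => /and3P[x0 x1 x2] /and3P[y0 y1 y2].
set u := ev2 _ _ _ _; set v := ev2 _ _ _ _.
rewrite -(subrK (ev2 iota (a m) (b m) (p n)) u) -addrA.
rewrite (le_trans (seminormD sM _ _))// [leRHS]splitr lerD//; last first.
  rewrite /v -ev2B (le_trans (ev2_le sN sM iM _ (aS m) (bS m)))//.
  apply: le_trans (n0P _ _ x0 y0); apply: le_nrm => //; rewrite s0 ltW//.
rewrite (le_trans (ev2_lip sN sM iM _ (aS n) (bS n) (aS m) (bS m) st))//.
have h : M (a n - a m) + M (b n - b m) <= e / 2 * ((t - s) / B).
  by have := lerD (n1P _ _ x1 y1) (n2P _ _ x2 y2); lra.
apply: (@le_trans _ _ (e / 2 * ((t - s) / B) * (B / (t - s)))).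
  apply: ler_pM => //; first by rewrite addr_ge0 ?seminorm_ge0.
    by rewrite mulr_ge0 ?nrm_ge0// invr_ge0 ltW.
  by rewrite ler_wpM2r// invr_ge0 ltW.
by rewrite le_eqVlt; apply/orP; left; apply/eqP; field; rewrite !gt_eqF.
Qed.

End CauchySeq.

(* The maps Phi n share a contraction rate and form a Cauchy sequence; a
   diagonal iteration avoids any completeness assumption. *)
Section Contraction.
Variables (R : realType) (A : zmodType) (N : A -> R) (S : A -> Prop).
Variables (Phi : nat -> A -> A) (B : R) (u0 : A).
Hypotheses (S0 : S u0) (SPhi : forall n u, S u -> S (Phi n u)).
Hypothesis NB : forall u v, S u -> S v -> N (u - v) <= B.
Hypothesis ND : forall u v, N (u + v) <= N u + N v.
Hypothesis contr : forall n u v, S u -> S v ->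
  N (Phi n u - Phi n v) <= N (u - v) / 2.
Hypothesis unif : forall e : R, 0 < e -> exists n0, forall n m u,
  (n0 <= n)%N -> (n0 <= m)%N -> S u -> N (Phi n u - Phi m u) <= e.

Fixpoint iterates n := if n is k.+1 then Phi k (iterates k) else u0.

Lemma iterates_in n : S (iterates n).
Proof. by elim: n => //= n; exact: SPhi. Qed.

Lemma cauchyN_iterates : cauchyN N iterates.
Proof.
move=> e e0; have e4 : 0 < e / 4 by rewrite divr_gt0.
have [n0 n0P] := unif e4.
(* Going back j indices in both sequences halves the distance j times. Each exchange of Phi n for
   Phi m costs e / 4, and these costs, halved in turn, sum to at most e / 2. *)
have step j n m : (n0 + j <= n)%N -> (n0 + j <= m)%N ->
    N (iterates n - iterates m) <= B / 2 ^+ j + e / 2.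
  elim: j n m => [|j IH] n m.
    move=> _ _; rewrite expr0 divr1 (le_trans (NB (iterates_in n) (iterates_in m)))//.
    by rewrite lerDl divr_ge0// ltW.
  case: n => [|n]; first by rewrite addnS.
  case: m => [|m]; first by rewrite addnS.
  rewrite !addnS !ltnS => nn mm /=.
  set u := iterates n; set v := iterates m.
  rewrite -(subrK (Phi n v) (Phi n u)) -addrA (le_trans (ND _ _))//.
  have h1 := contr n (iterates_in n) (iterates_in m).
  have h2 : N (Phi n v - Phi m v) <= e / 4.
    apply: n0P; rewrite ?(leq_trans (leq_addr j n0))//.
    exact: iterates_in.
  have h3 := IH _ _ nn mm; rewrite -/u -/v in h1 h3.
  have -> : B / 2 ^+ j.+1 = B / 2 ^+ j / 2 by rewrite exprS invfM mulrCA mulrC.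
  lra.
have B0 : 0 <= B + e.
  have := step 0%N n0 n0; rewrite addn0 leqnn => /(_ isT isT) _.
  have := NB S0 S0; rewrite subrr => h.
  have := ND 0 0; rewrite addr0 => h'.
  have : 0 <= N 0 by lra.
  lra.
have [j jP] : exists j, B / 2 ^+ j <= e / 2.
  have [j jB] : exists j : nat, B / (e / 2) < j%:R.
    by exists (Num.truncn (B / (e / 2))).+1; rewrite truncnS_gt.
  exists j; rewrite ler_pdivrMr ?exprn_gt0// mulrC -ler_pdivrMr ?divr_gt0//.
  rewrite (le_trans (ltW jB))// -natrX ler_nat ltnW// ltn_expl//.
exists (n0 + j)%N => n m nn mm; apply: (le_trans (step j n m nn mm)); lra.
Qed.

End Contraction.

Lemma seminormXle (R : realType) (A : comNzRingType) (N : A -> R) (x : A) (a : R) n :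
  seminorm N -> N 1 <= 1 -> N x <= a -> N (x ^+ n) <= a ^+ n.
Proof.
move=> sN N1 xa; elim: n => [|n IH]; first by rewrite !expr0.
by rewrite !exprS seminormMle.
Qed.

(** * Analytic germs as limits of polynomials *)

Section Plim.
Variable R : realType.
Implicit Types (p : {poly {poly R}}) (f : R * R -> R) (r x y : R).

Definition ev x y p : R := ev2 (@idfun R) x y p.

(* A germ at 0 is handled through a sequence of polynomials which is Cauchy for
   the coefficient norm of radius r, so that nonlinear functional equations
   are solved by contractions on polynomials (in [nrm], the outer variable is
   the first coordinate). *)
Definition plim r (p : nat -> {poly {poly R}}) f : Prop :=
  cauchyN (nrm Num.norm r) p /\
  forall x y, `|x| <= r -> `|y| <= r -> (fun n => ev x y (p n)) @ \oo --> f (x, y).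

Lemma ev_le r x y p : `|x| <= r -> `|y| <= r -> `|ev x y p| <= nrm Num.norm r p.
Proof. by apply: ev2_le => //; exact: seminorm_normr. Qed.

Lemma plim_exists r (p : nat -> {poly {poly R}}) : cauchyN (nrm Num.norm r) p ->
  plim r p (fun v => limn (fun n => ev v.1 v.2 (p n))).
Proof.
move=> cp; split=> // x y xr yr.
have r0 : 0 <= r by rewrite (le_trans _ xr).
have [l ul] : exists l : R, (fun n => ev x y (p n)) @ \oo --> l.
  apply: cauchyN_cvg; apply: cauchyN_le ler01 _ cp.
    exact/seminorm_nrm/r0/seminorm_normr.
  by move=> n m; rewrite mul1r /ev -ev2B; exact: ev_le.
by rewrite (cvg_lim _ ul).
Qed.

Lemma sum_square_widen (V : zmodType) (F : nat -> nat -> V) m n : (m <= n)%N ->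
  \sum_(i < m) \sum_(j < m) F i j =
  \sum_(i < n) \sum_(j < n) (if (i < m)%N && (j < m)%N then F i j else 0).
Proof.
move=> mn; rewrite (big_ord_widen n (fun i => \sum_(j < m) F i j) mn) big_mkcond.
apply: eq_bigr => i _; case: ifP => im /=; last by rewrite big1.
by rewrite (big_ord_widen n (F i) mn) big_mkcond.
Qed.

Lemma ler_sum_square (F G : nat -> nat -> R) n : (forall i j, F i j <= G i j) ->
  dseries F n <= dseries G n.
Proof. by move=> FG; apply: ler_sum => i _; exact: ler_sum. Qed.

Lemma dseries_nd (F : nat -> nat -> R) : (forall i j, 0 <= F i j) ->
  {homo dseries F : n m / (n <= m)%N >-> n <= m}.
Proof.
move=> F0 m n mn; rewrite /dseries (sum_square_widen F mn).
by apply: ler_sum => i _; apply: ler_sum => j _; case: ifP.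
Qed.

Definition mono (c : R) (i j : nat) : {poly {poly R}} :=
  c%:P%:P * 'X ^+ i * 'X%:P ^+ j.

Definition square_poly (c : nat -> nat -> R) n : {poly {poly R}} :=
  \sum_(i < n) \sum_(j < n) mono (c i j) i j.

Lemma ev_square_poly c x y n :
  ev x y (square_poly c n) = dseries (monomial_term c (x, y)) n.
Proof.
rewrite /ev /square_poly raddf_sum; apply: eq_bigr => i _.
rewrite raddf_sum; apply: eq_bigr => j _.
rewrite /= !ev2M ev2C !rmorphXn /= .
by rewrite ev2X ev2Y.
Qed.

Lemma nrm_mono r c i j : 0 <= r -> nrm Num.norm r (mono c i j) <= `|c| * r ^+ i * r ^+ j.
Proof.
move=> r0; have sN := seminorm_nrm (@seminorm_normr R) r0.
have n1 : `|1 : R| <= 1 by rewrite normr1.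
have N1 : nrm Num.norm r 1 <= 1.
  by rewrite -[1]/(1%:P) -[1%:P]/(1%:P%:P) nrmCC//; exact: seminorm_normr.
apply: seminormMle => //; last first.
  by apply: seminormXle => //; apply: nrmY => //; exact: seminorm_normr.
apply: seminormMle => //; first by rewrite nrmCC//; exact: seminorm_normr.
by apply: seminormXle => //; apply: nrmX => //; exact: seminorm_normr.
Qed.

(** The terms of the series at the corner (r, r) have the absolute values that the coefficient norm
    of radius r adds up. *)
Lemma cauchyN_square_poly c r : 0 <= r ->
  cvgn (dseries (fun i j => `|monomial_term c (r, r) i j|)) ->
  cauchyN (nrm Num.norm r) (square_poly c).
Proof.
move=> r0; set F : nat -> nat -> R := fun i j => _ => cF e e0.
have sN := seminorm_nrm (@seminorm_normr R) r0.
have le1 m n : (m <= n)%N ->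
    nrm Num.norm r (square_poly c n - square_poly c m) <= dseries F n - dseries F m.
  move=> mn; rewrite /dseries /square_poly.
  rewrite (sum_square_widen F mn).
  rewrite (sum_square_widen (fun i j => mono (c i j) i j) mn).
  rewrite -!sumrB (le_trans (seminorm_sum _ _ _ sN))//; apply: ler_sum => i _.
  rewrite -!sumrB (le_trans (seminorm_sum _ _ _ sN))//; apply: ler_sum => j _.
  case: ifP => _; first by rewrite !subrr (seminorm0 sN).
  rewrite !subr0 (le_trans (nrm_mono _ _ _ r0))// /F /monomial_term /=.
  by rewrite !normrM !normrX (ger0_norm r0).
have e2 : 0 < e / 2 by rewrite divr_gt0.
have [n0 n0P] := (cvgnP _ _).1 cF _ e2; exists n0 => n m nn mm.
wlog nm : n m nn mm / (m <= n)%N.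
  move=> H; have [|/ltnW] := leqP m n; first exact: H.
  by move=> /(H _ _ mm nn); rewrite -(seminormN sN) opprB.
rewrite (le_trans (le1 _ _ nm))//.
have := n0P _ nn; have := n0P _ mm; rewrite !ler_norml => /andP[a _] /andP[_ b].
lra.
Qed.

Lemma analytic2_plim f (a : R * R) : analytic2_at f a ->
  exists r (p : nat -> {poly {poly R}}), 0 < r /\ plim r p (fun v => f (a + v)).
Proof.
move=> [c [r0 [r00 H]]]; have r1 : 0 < r0 / 2 by rewrite divr_gt0.
have lt_r x : `|x| <= r0 / 2 -> `|x| < r0.
  by move=> /le_lt_trans; apply; rewrite ltr_pdivrMr// ltr_pMr// ltr1n.
(* The corner (r0 / 2, r0 / 2) lies in the open square where the series converges absolutely. *)
exists (r0 / 2), (square_poly c); split=> //; split.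
  apply: cauchyN_square_poly; first exact: ltW.
  by apply: (H (_, _) _ _).1; rewrite /= lt_r// ger0_norm// ltW.
move=> x y xr yr; under eq_fun do rewrite ev_square_poly.
by apply: (H (x, y) _ _).2; rewrite /= lt_r.
Qed.

Lemma partial_pnorm_le (A : comNzRingType) (N : A -> R) r (p : {poly A}) n :
  seminorm N -> 0 <= r -> \sum_(i < n) N p`_i * r ^+ i <= pnorm N r p.
Proof.
move=> sN r0; rewrite (pnorm_widen sN r (leq_maxr n (size p))).
rewrite (big_ord_widen (maxn n (size p)) (fun i => N p`_i * r ^+ i) (leq_maxl _ _)).
rewrite big_mkcond; apply: ler_sum => i _; case: ifP => // _.
by rewrite mulr_ge0 ?exprn_ge0// seminorm_ge0.
Qed.

Lemma dseries_coef_le r x y p n : `|x| <= r -> `|y| <= r ->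
  dseries (fun i j => `|monomial_term (fun i j => p`_i`_j) (x, y) i j|) n
  <= nrm Num.norm r p.
Proof.
move=> xr yr; have r0 : 0 <= r by rewrite (le_trans _ xr).
have sN := @seminorm_normr R.
apply: le_trans (partial_pnorm_le p n (seminorm_pnorm sN r0) r0).
apply: ler_sum => i _; apply: le_trans (_ : (\sum_(j < n) `|p`_i`_j| * r ^+ j) * r ^+ i <= _).
  rewrite big_distrl /=; apply: ler_sum => j _.
  rewrite /monomial_term /= !normrM !normrX mulrAC.
  apply: ler_pM; rewrite ?mulr_ge0 ?exprn_ge0//.
    by rewrite ler_wpM2l// lerXn2r// nnegrE.
  by rewrite lerXn2r// nnegrE.
by rewrite ler_wpM2r ?exprn_ge0// partial_pnorm_le.
Qed.

Lemma dseries_le_abs F n : `|dseries F n| <= dseries (fun i j => `|F i j|) n :> R.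
Proof.
rewrite /dseries (le_trans (ler_norm_sum _ _ _))//; apply: ler_sum => i _.
exact: ler_norm_sum.
Qed.

Lemma ev_dseries p : exists n0, forall n x y, (n0 <= n)%N ->
  ev x y p = dseries (monomial_term (fun i j => p`_i`_j) (x, y)) n.
Proof.
exists (maxn (size p) (\max_(i < size p) size (p`_i)%R)) => n x y.
rewrite geq_max => /andP[pn /bigmax_leqP mn].
rewrite /ev /ev2 /= /horner_eval (@horner_coef_wide _ n); last first.
  by rewrite (leq_trans (size_poly _ _)).
apply: eq_bigr => i _.
  rewrite coef_map_id0; last by rewrite /= map_poly0 horner0.
  rewrite /= map_poly_id// (@horner_coef_wide _ n).
  by rewrite big_distrl /=; apply: eq_bigr => j _; rewrite /monomial_term /= mulrAC.
have [ip|pi] := ltnP i (size p); first exact: (mn (Ordinal ip)).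
by rewrite nth_default// size_poly0.
Qed.

Lemma dseriesB F G n : dseries F n - dseries G n = dseries (fun i j => F i j - G i j) n :> R.
Proof. by rewrite /dseries -sumrB; apply: eq_bigr => i _; rewrite -sumrB. Qed.

(** Each coefficient is controlled by the norm, so the coefficients converge. The double series of
    the limits and f are both compared with one polynomial [p n0], the Cauchy bound being preserved
    in the limit. *)
Lemma plim_analytic2 r (p : nat -> {poly {poly R}}) f (a : R * R) : 0 < r ->
  plim r p (fun v => f (a + v)) -> analytic2_at f a.
Proof.
move=> r0 [cp pf]; have sN := seminorm_nrm (@seminorm_normr R) (ltW r0).
have cij i j : exists l : R, (fun n => (p n)`_i`_j) @ \oo --> l.
  apply: cauchyN_cvg; apply: (cauchyN_le sN (c := (r ^+ (i + j))^-1)) cp.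
    by rewrite invr_ge0 exprn_ge0// ltW.
  move=> n m; rewrite -!coefB mulrC ler_pdivlMr ?exprn_gt0//.
  by apply: coef_le_nrm; [exact: seminorm_normr|exact: ltW].
pose c i j := sval (cid (cij i j)).
have cP i j : (fun n => (p n)`_i`_j) @ \oo --> (c i j : R).
  exact: (svalP (cid (cij i j))).
exists c, r; split=> // -[x y] /= /ltW xr /ltW yr.
have mcvg i j : (fun n => monomial_term (fun i j => (p n)`_i`_j) (x, y) i j) @ \oo -->
    monomial_term c (x, y) i j.
  by rewrite /monomial_term /=; do 2 apply: cvgMl; exact: cP.
have [B B0 pB] := cauchyN_bounded sN cp.
split.
  apply: nondecreasing_is_cvgn; first by apply: dseries_nd => i j; exact: normr_ge0.
  exists B => _ [n _ <-].
  apply: (@cvgr_to_le _ \oo _ _ (fun k => dseries (fun i j =>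
      `|monomial_term (fun i j => (p k)`_i`_j) (x, y) i j|) n)).
    apply: cvgn_sum => i; apply: cvgn_sum => j; exact: cvg_norm.
  by apply: nearW => k; exact: le_trans (dseries_coef_le _ _ xr yr) (pB k).
apply/cvgnP => e e0; have e2 : 0 < e / 2 by rewrite divr_gt0.
have [n0 n0P] := cp _ e2; have [N0 N0P] := ev_dseries (p n0).
exists N0 => n nn.
have h1 : `|dseries (monomial_term c (x, y)) n - ev x y (p n0)| <= e / 2.
  rewrite (N0P n)//.
  (* The shift by n0 makes the Cauchy bound available for every k. *)
  apply: (@cvgr_to_le _ \oo _ _ (fun k => `|dseries (monomial_term (fun i j =>
      (p (k + n0)%N)`_i`_j) (x, y)) n - dseries (monomial_term (fun i j =>
      (p n0)`_i`_j) (x, y)) n|)).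
    apply: cvg_norm; apply: cvgB; last exact: cvg_cst.
    apply: cvgn_sum => i; apply: cvgn_sum => j.
    have := mcvg i j; rewrite -(cvg_shiftn n0); exact.
  apply: nearW => k; rewrite dseriesB (le_trans (dseries_le_abs _ _))//.
  apply: le_trans (n0P (k + n0)%N n0 (leq_addl _ _) (leqnn _)).
  apply: le_trans (dseries_coef_le _ n xr yr); apply: ler_sum_square => i j.
  by rewrite /monomial_term /= !coefB -!mulrBl.
have h2 : `|f (a + (x, y)) - ev x y (p n0)| <= e / 2.
  apply: (@cvgr_to_le _ \oo _ _ (fun k => `|ev x y (p (k + n0)%N) - ev x y (p n0)|)).
    apply: cvg_norm; apply: cvgB; last exact: cvg_cst.
    by have := pf x y xr yr; rewrite -(cvg_shiftn n0); exact.
  apply: nearW => k; rewrite /ev -ev2B (le_trans (ev_le _ xr yr))//.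
  by apply: n0P; rewrite ?leq_addl.
have := ler_distD (ev x y (p n0)) (dseries (monomial_term c (x, y)) n) (f (a + (x, y))).
rewrite (distrC (ev _ _ _) (f _)); lra.
Qed.

End Plim.

(** * Substitution, limits and derivatives of germs *)

Definition pcomp (K : comNzRingType) (a b : {poly {poly K}}) :
    {poly {poly K}} -> {poly {poly K}} :=
  ev2 (polyC \o polyC : {rmorphism K -> {poly {poly K}}}) a b.

Section PlimCalculus.
Variable R : realType.
Implicit Types (p q : nat -> {poly {poly R}}) (f g : R * R -> R) (r s t x y : R).
Notation N := (@Num.norm _ R).

Let sN := @seminorm_normr R.

Lemma ev_comp x y (a b P : {poly {poly R}}) :
  ev x y (pcomp a b P) = ev (ev x y a) (ev x y b) P.
Proof.
rewrite /ev /pcomp ev2_morph; apply: ev2_eq => c /=.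
exact: (ev2C (@idfun R)).
Qed.

Lemma evC x y c : ev x y c%:P%:P = c. Proof. exact: (ev2C (@idfun R)). Qed.
Lemma evX x y : ev x y 'X = x. Proof. exact: (ev2X (@idfun R)). Qed.
Lemma evY x y : ev x y 'X%:P = y. Proof. exact: (ev2Y (@idfun R)). Qed.
Lemma evD x y (a b : {poly {poly R}}) : ev x y (a + b) = ev x y a + ev x y b.
Proof. exact: ev2D. Qed.
Lemma evB x y (a b : {poly {poly R}}) : ev x y (a - b) = ev x y a - ev x y b.
Proof. exact: ev2B. Qed.
Lemma evM x y (a b : {poly {poly R}}) : ev x y (a * b) = ev x y a * ev x y b.
Proof. exact: ev2M. Qed.
Lemma evZ x y c (a : {poly {poly R}}) : ev x y (c%:P%:P * a) = c * ev x y a.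
Proof. by rewrite evM evC. Qed.

Lemma ev00 (P : {poly {poly R}}) : ev 0 0 P = P`_0`_0.
Proof.
rewrite /ev /ev2 /= /horner_eval horner_coef0 coef_map_id0 /=; last first.
  by rewrite map_poly0 horner0.
by rewrite map_poly_id// horner_coef0.
Qed.

Lemma ev_lip s t x y x' y' (P : {poly {poly R}}) :
  N x <= s -> N y <= s -> N x' <= s -> N y' <= s -> s < t ->
  N (ev x y P - ev x' y' P) <= (N (x - x') + N (y - y')) * (nrm N t P / (t - s)).
Proof. by move=> *; apply: ev2_lip. Qed.

Lemma lim_ev s t p f (a b : R^nat) x y : plim t p f -> s < t ->
  (forall n, N (a n) <= s) -> (forall n, N (b n) <= s) ->
  a @ \oo --> x -> b @ \oo --> y ->
  (fun n => ev (a n) (b n) (p n)) @ \oo --> f (x, y).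
Proof.
move=> [cp pf] st aS bS ax bY.
have xs : N x <= s by exact: cvgn_norm_le ax aS.
have ys : N y <= s by exact: cvgn_norm_le bY bS.
have s0 : 0 <= s by rewrite (le_trans _ xs).
have t0 : 0 <= t by rewrite (le_trans s0) ?ltW.
have [B B0 pB] := cauchyN_bounded (seminorm_nrm sN t0) cp.
have pfxy := pf x y (le_trans xs (ltW st)) (le_trans ys (ltW st)).
rewrite -[f (x, y)]add0r.
have -> : (fun n => ev (a n) (b n) (p n)) =
    (fun n => (ev (a n) (b n) (p n) - ev x y (p n)) + ev x y (p n)).
  by apply/funext => n; rewrite subrK.
apply: cvgD; last exact: pfxy.
apply: (@cvgn_squeeze0 _ _ (fun n => (N (a n - x) + N (b n - y)) * (B / (t - s)))).
  move=> n; rewrite subr0 (le_trans (ev_lip _ (aS n) (bS n) xs ys st))//.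
  by rewrite ler_wpM2l ?addr_ge0// ler_wpM2r// invr_ge0 subr_ge0 ltW.
rewrite -[X in _ --> X](mul0r (B / (t - s))); apply: cvgMl.
rewrite -[X in _ --> X]addr0; apply: cvgD.
  by rewrite -(@normr0 _ R) -(subrr x); apply: cvg_norm; apply: cvgB => //; exact: cvg_cst.
by rewrite -(@normr0 _ R) -(subrr y); apply: cvg_norm; apply: cvgB => //; exact: cvg_cst.
Qed.

Lemma plim_comp r s t p q1 q2 f g1 g2 : 0 <= r ->
  plim t p f -> plim r q1 g1 -> plim r q2 g2 -> s < t ->
  (forall n, nrm N r (q1 n) <= s) -> (forall n, nrm N r (q2 n) <= s) ->
  plim r (fun n => pcomp (q1 n) (q2 n) (p n)) (fun v => f (g1 v, g2 v)).
Proof.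
move=> r0 pf [c1 l1] [c2 l2] st s1 s2; split.
  apply: (cauchyN_ev2 sN (seminorm_nrm sN r0) _ st s1 s2 pf.1 c1 c2).
  by move=> x; rewrite /= nrmCC.
move=> x y xr yr; under eq_fun do rewrite ev_comp.
apply: (lim_ev pf st); [| |exact: l1|exact: l2] => n.
  exact: le_trans (ev_le _ xr yr) (s1 n).
exact: le_trans (ev_le _ xr yr) (s2 n).
Qed.

Lemma plim_cst r c : 0 <= r -> plim r (fun=> c%:P%:P) (fun=> c).
Proof.
move=> r0; split; first exact/cauchyN_cst/seminorm_nrm.
by move=> x y _ _; rewrite evC; exact: cvg_cst.
Qed.

Lemma plim_fst r : 0 <= r -> plim r (fun=> 'X) fst.
Proof.
move=> r0; split; first exact/cauchyN_cst/seminorm_nrm.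
by move=> x y _ _; rewrite evX; exact: cvg_cst.
Qed.

Lemma plim_snd r : 0 <= r -> plim r (fun=> 'X%:P) snd.
Proof.
move=> r0; split; first exact/cauchyN_cst/seminorm_nrm.
by move=> x y _ _; rewrite evY; exact: cvg_cst.
Qed.

Lemma plimD r p q f g : 0 <= r -> plim r p f -> plim r q g ->
  plim r (fun n => p n + q n) (fun v => f v + g v).
Proof.
move=> r0 [cp pf] [cq qg]; split; first exact: cauchyND (seminorm_nrm sN r0) _ _ _ _.
by move=> x y xr yr; under eq_fun do rewrite evD; apply: cvgD; [exact: pf|exact: qg].
Qed.

Lemma plimM r p q f g : 0 <= r -> plim r p f -> plim r q g ->
  plim r (fun n => p n * q n) (fun v => f v * g v).
Proof.
move=> r0 [cp pf] [cq qg]; split; first exact: cauchyNM (seminorm_nrm sN r0) _ _ _ _.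
by move=> x y xr yr; under eq_fun do rewrite evM; apply: cvgM; [exact: pf|exact: qg].
Qed.

Lemma plim_le r r' p f : 0 <= r' <= r -> plim r p f -> plim r' p f.
Proof.
move=> rr [cp pf]; have /andP[r'0 r'r] := rr; split; last first.
  by move=> x y xr yr; apply: pf; rewrite (le_trans _ r'r).
have sNr := seminorm_nrm sN (le_trans r'0 r'r).
by apply: (cauchyN_le sNr ler01 _ cp) => n m; rewrite mul1r le_nrm.
Qed.

Lemma plim_lip s t p f (B : R) x y x' y' : plim t p f ->
  (forall n, nrm N t (p n) <= B) ->
  N x <= s -> N y <= s -> N x' <= s -> N y' <= s -> s < t ->
  N (f (x, y) - f (x', y')) <= (N (x - x') + N (y - y')) * (B / (t - s)).
Proof.
move=> [_ pf] pB xs ys xs' ys' st.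
apply: (@cvgn_norm_le _ (fun n => ev x y (p n) - ev x' y' (p n))).
  by apply: cvgB; apply: pf; rewrite (le_trans _ (ltW st)).
move=> n; rewrite (le_trans (ev_lip _ xs ys xs' ys' st))//.
by rewrite ler_wpM2l ?addr_ge0// ler_wpM2r// invr_ge0 subr_ge0 ltW.
Qed.

Lemma diff_of_quadratic f x y (a b C d : R) : 0 < d -> 0 <= C ->
  (forall h k, N h <= d -> N k <= d ->
    N (f (x + h, y + k) - f (x, y) - a * h - b * k) <= C * (N h + N k) ^+ 2) ->
  differentiable f (x, y) /\ forall h k, 'd f (x, y) (h, k) = a * h + b * k.
Proof.
move=> d0 C0 fq; pose A (v : R * R) := a * v.1 + b * v.2.
have linA : linear A by move=> c u v; rewrite /A /= !mulrDr /GRing.scale /=; ring.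
pose L : {linear (R * R)%type -> R} := HB.pack A (GRing.isLinear.Build _ _ _ _ A linA).
have cL : continuous L.
  move=> v; apply: (@cvgD _ _ _ _ _ (fun v => a * v.1) (fun v => b * v.2)).
    by apply: cvgMr; exact: cvg_fst.
  by apply: cvgMr; exact: cvg_snd.
have fL : f \o shift (x, y) = cst (f (x, y)) + L +o_ (0 : R * R) id.
  apply/eqaddoP => e e0.
  (* In the maximum norm (N h + N k)^2 is at most 4 |(h, k)|^2; adding 1 keeps the divisor positive
     when C = 0. *)
  have c1 : 0 < C * 4 + 1 by rewrite ltr_wpDl// mulr_ge0.
  have key (v : R * R) : `|v| <= d -> `|v| <= e / (C * 4 + 1) ->
      `|f (v + (x, y)) - (f (x, y) + L v)| <= e * `|v|.
    case: v => h k vd ve.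
    have hv : N h <= `|(h, k)| by rewrite prod_normE /= le_max lexx.
    have kv : N k <= `|(h, k)| by rewrite prod_normE /= le_max lexx orbT.
    have := fq h k (le_trans hv vd) (le_trans kv vd).
    rewrite /L /= /A /= !opprD !addrA [x + h]addrC [y + k]addrC => /le_trans; apply.
    have v0 := normr_ge0 (h, k).
    apply: (@le_trans _ _ (C * 4 * `|(h, k)| * `|(h, k)|)).
      rewrite -mulrA -mulrA ler_wpM2l//.
      have -> : 4 * (`|(h, k)| * `|(h, k)|) = (`|(h, k)| + `|(h, k)|) ^+ 2 :> R by ring.
      by rewrite lerXn2r ?nnegrE ?addr_ge0// lerD.
    rewrite ler_wpM2r//; move: ve; rewrite ler_pdivlMr//; nra.
  near=> v; apply: key; near: v.
    exact: (@nbhs0_le _ (R * R)%type _ d0).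
  exact: (@nbhs0_le _ (R * R)%type _ (divr_gt0 e0 c1)).
have dE := diff_unique cL fL.
split; first by apply/diff_locallyP; rewrite dE.
by move=> h k; rewrite dE.
Unshelve. all: by end_near. Qed.

Lemma plim_diff t p f x y : plim t p f -> N x < t -> N y < t ->
  exists fx fy : R, [/\ (fun n => ev x y (deriv (p n))) @ \oo --> fx,
    (fun n => ev x y (derY (p n))) @ \oo --> fy, differentiable f (x, y) &
    forall h k, 'd f (x, y) (h, k) = fx * h + fy * k].
Proof.
move=> [cp pf] xt yt.
have [s [xs ys st]] : exists s, [/\ N x < s, N y < s & s < t].
  exists ((Num.max (N x) (N y) + t) / 2).
  have h : Num.max (N x) (N y) < t by rewrite gt_max xt.
  have := le_max (N x) (N x) (N y); have := le_max (N y) (N x) (N y).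
  rewrite !lexx orbT /= => h1 h2; split; lra.
have s0 : 0 <= s by rewrite (le_trans _ (ltW xs)).
have t0 : 0 <= t by rewrite (le_trans s0) ?ltW.
have ts : 0 < t - s by rewrite subr_gt0.
have sNt := seminorm_nrm sN t0.
have [B B0 pB] := cauchyN_bounded sNt cp.
have iN (c : R) : N (@idfun R c) <= N c by [].
have [fx fxP] : exists l : R, (fun n => ev x y (deriv (p n))) @ \oo --> l.
  apply: cauchyN_cvg; apply: (cauchyN_le sNt (c := (t - s)^-1)) cp.
    by rewrite invr_ge0 ltW.
  move=> n m; rewrite -evB -derivB mulrC.
  exact: (ev2_derX_le sN sN iN _ (ltW xs) (ltW ys) st).
have [fy fyP] : exists l : R, (fun n => ev x y (derY (p n))) @ \oo --> l.
  apply: cauchyN_cvg; apply: (cauchyN_le sNt (c := (t - s)^-1)) cp.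
    by rewrite invr_ge0 ltW.
  move=> n m; rewrite -evB /derY -raddfB mulrC.
  exact: (ev2_derY_le sN sN iN _ (ltW xs) (ltW ys) st).
exists fx, fy.
pose d := Num.min (s - N x) (s - N y).
have d0 : 0 < d by rewrite lt_min !subr_gt0 xs.
have [| |df dE] := @diff_of_quadratic f x y fx fy (B / (t - s) ^+ 2) d d0.
- by rewrite mulr_ge0 ?(ltW B0)// invr_ge0 exprn_ge0// ltW.
- move=> h k; rewrite !le_min => /andP[h1 h2] /andP[k1 k2].
  have xh : N (x + h) <= s by rewrite (le_trans (ler_normD _ _))//; lra.
  have yk : N (y + k) <= s by rewrite (le_trans (ler_normD _ _))//; lra.
  apply: (@cvgn_norm_le _ (fun n => ev (x + h) (y + k) (p n) - ev x y (p n)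
      - ev x y (deriv (p n)) * h - ev x y (derY (p n)) * k)).
    apply: cvgB; last exact: cvgMl.
    apply: cvgB; last exact: cvgMl.
    apply: cvgB; apply: pf; rewrite ?(le_trans xh (ltW st))//.
    + by rewrite (le_trans yk (ltW st)).
    + exact: ltW.
    + exact: ltW.
  move=> n; apply: le_trans (ev2_taylor sN sN iN _ (ltW xs) (ltW ys) xh yk st) _.
  rewrite mulrC ler_wpM2r ?exprn_ge0 ?addr_ge0//.
  by rewrite ler_wpM2r// invr_ge0 exprn_ge0// ltW.
by split.
Qed.

End PlimCalculus.

Section Germs.
Variable R : realType.
Implicit Types (f g : R * R -> R) (a : R * R).
Notation N := (@Num.norm _ R).

Let sN := @seminorm_normr R.

Lemma analytic2_eq f g a (d : R) : 0 < d -> analytic2_at f a ->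
  (forall v, N v.1 < d -> N v.2 < d -> f (a + v) = g (a + v)) ->
  analytic2_at g a.
Proof.
move=> d0 [c [r [r0 H]]] fg; exists c, (Num.min r d); rewrite lt_min r0 d0.
split=> // v; rewrite !lt_min => /andP[v1r v1d] /andP[v2r v2d].
by rewrite -fg//; exact: H.
Qed.

Lemma analytic2_cst c a : analytic2_at (fun=> c : R) a.
Proof. by apply: (plim_analytic2 ltr01); exact: plim_cst. Qed.

Lemma analytic2D f g a : analytic2_at f a -> analytic2_at g a ->
  analytic2_at (fun v => f v + g v) a.
Proof.
move=> /analytic2_plim[r [p [r0 pf]]] /analytic2_plim[s [q [s0 qg]]].
have m0 : 0 < Num.min r s by rewrite lt_min r0.
apply: (plim_analytic2 m0).
apply: plimD; [exact: ltW|apply: plim_le pf|apply: plim_le qg].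
  by rewrite (ltW m0) ge_min lexx.
by rewrite (ltW m0) ge_min lexx orbT.
Qed.

Lemma analytic2M f g a : analytic2_at f a -> analytic2_at g a ->
  analytic2_at (fun v => f v * g v) a.
Proof.
move=> /analytic2_plim[r [p [r0 pf]]] /analytic2_plim[s [q [s0 qg]]].
have m0 : 0 < Num.min r s by rewrite lt_min r0.
apply: (plim_analytic2 m0).
apply: plimM; [exact: ltW|apply: plim_le pf|apply: plim_le qg].
  by rewrite (ltW m0) ge_min lexx.
by rewrite (ltW m0) ge_min lexx orbT.
Qed.

Lemma analytic2_fst a : analytic2_at fst a.
Proof.
apply: (plim_analytic2 ltr01).
by apply: plimD => //; [exact: plim_cst|exact: plim_fst].
Qed.

Lemma analytic2_snd a : analytic2_at snd a.
Proof.
apply: (plim_analytic2 ltr01).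
by apply: plimD => //; [exact: plim_cst|exact: plim_snd].
Qed.

Lemma analytic2N f a : analytic2_at f a -> analytic2_at (fun v => - f v) a.
Proof.
move=> fa; have := analytic2M (analytic2_cst (-1) a) fa.
by move/(analytic2_eq (g := fun v => - f v) ltr01); apply => v _ _; rewrite mulN1r.
Qed.

Lemma analytic2B f g a : analytic2_at f a -> analytic2_at g a ->
  analytic2_at (fun v => f v - g v) a.
Proof. by move=> fa ga; apply: analytic2D => //; exact: analytic2N. Qed.

Lemma plim_center r p f : 0 <= r -> plim r p f ->
  plim r (fun n => p n - (ev 0 0 (p n))%:P%:P) (fun v => f v - f (0, 0)).
Proof.
move=> r0 [cp pf].
have sNr := seminorm_nrm sN r0.
have z : N 0 <= r by rewrite normr0.
split.
  apply: cauchyND => //; apply: cauchyNN => //.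
  apply: (cauchyN_le sNr ler01 _ cp) => n m; rewrite mul1r -!polyCB nrmCC// -evB.
  exact: ev_le.
move=> x y xr yr; under eq_fun do rewrite evB evC.
by apply: cvgB; exact: pf.
Qed.

Lemma ev_center (P : {poly {poly R}}) : (P - (ev 0 0 P)%:P%:P)`_0`_0 = 0.
Proof. by rewrite -ev00 evB evC subrr. Qed.

(** Without its constant term, the germ shrinks in proportion to the radius: the ratio th = s / (s +
    B) satisfies th <= 1 and th B <= s. This is how inner functions meet the size condition of
    [plim_comp]. *)
Lemma analytic2_small g a (s : R) : 0 < s -> analytic2_at g a ->
  exists r0 : R, 0 < r0 /\ forall r : R, 0 < r <= r0 ->
  exists q, plim r q (fun v => g (a + v) - g a) /\ forall n, nrm N r (q n) <= s.
Proof.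
move=> s0 /analytic2_plim[t [p [t0 pg]]].
have pc := plim_center (ltW t0) pg; rewrite /= addr0 in pc.
set q := (fun n => _) in pc.
have [B B0 qB] := cauchyN_bounded (seminorm_nrm sN (ltW t0)) pc.1.
have sB : 0 < s + B by rewrite addr_gt0.
exists (s / (s + B) * t); split; first by rewrite mulr_gt0// divr_gt0.
move=> r /andP[r0 rt].
have th1 : s / (s + B) <= 1 by rewrite ler_pdivrMr// mul1r lerDl ltW.
have th0 : 0 <= s / (s + B) by rewrite divr_ge0// ltW.
have rt' : r <= t by rewrite (le_trans rt)// ler_piMl// ltW.
exists q; split; first by apply: plim_le pc; rewrite (ltW r0).
move=> n; apply: (@le_trans _ _ (nrm N (s / (s + B) * t) (q n))).
  by apply: le_nrm => //; rewrite (ltW r0).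
apply: (le_trans (nrm_scale0 sN (ltW t0) _ (ev_center _))); first by rewrite th0.
rewrite mulrAC ler_pdivrMr// ler_wpM2l ?(ltW s0)//.
by rewrite (le_trans (qB n))// lerDr ltW.
Qed.

Lemma analytic2_comp f g1 g2 a : analytic2_at f (g1 a, g2 a) ->
  analytic2_at g1 a -> analytic2_at g2 a ->
  analytic2_at (fun v => f (g1 v, g2 v)) a.
Proof.
move=> /analytic2_plim[t [p [t0 pf]]] g1a g2a.
have t20 : 0 < t / 2 by rewrite divr_gt0.
have t2t : t / 2 < t by rewrite ltr_pdivrMr// ltr_pMr// ltr1n.
have [r1 [r10 H1]] := analytic2_small t20 g1a.
have [r2 [r20 H2]] := analytic2_small t20 g2a.
have m0 : 0 < Num.min r1 r2 by rewrite lt_min r10.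
have [|q1 [q1g q1s]] := H1 (Num.min r1 r2); first by rewrite m0 ge_min lexx.
have [|q2 [q2g q2s]] := H2 (Num.min r1 r2); first by rewrite m0 ge_min lexx orbT.
have := plim_comp (ltW m0) pf q1g q2g t2t q1s q2s.
set h := (fun v => f _).
have -> : h = (fun v => (fun v => f (g1 v, g2 v)) (a + v)).
  apply/funext => v; rewrite /h; congr f.
  by congr pair => /=; rewrite addrC subrK.
exact: (plim_analytic2 m0).
Qed.

Lemma analytic2_near f a : analytic2_at f a ->
  exists d : R, 0 < d /\ forall v : R * R, N v.1 < d -> N v.2 < d -> analytic2_at f (a + v).
Proof.
move=> /analytic2_plim[t [p [t0 pf]]]; exists (t / 4).
split; first by rewrite divr_gt0.
move=> v v1 v2; have t40 : 0 < t / 4 by rewrite divr_gt0.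
have t20 : t / 2 < t by rewrite ltr_pdivrMr// ltr_pMr// ltr1n.
have N1 : N 1 <= 1 by rewrite normr1.
have sNr := seminorm_nrm sN (ltW t40).
have hc := plim_cst v.1 (ltW t40); have hx := plim_fst (ltW t40).
have hd := plim_cst v.2 (ltW t40); have hy := plim_snd (ltW t40).
have h1 := plimD (ltW t40) hc hx.
have h2 := plimD (ltW t40) hd hy.
have [k1 k2] : nrm N (t / 4) (v.1%:P%:P + 'X) <= t / 2 /\
    nrm N (t / 4) (v.2%:P%:P + 'X%:P) <= t / 2.
  split; rewrite (le_trans (seminormD sNr _ _))// nrmCC ?(ltW t40)//.
    have := nrmX sN N1 (ltW t40); lra.
  have := nrmY sN N1 (ltW t40); lra.
have := plim_comp (ltW t40) pf h1 h2 t20 (fun=> k1) (fun=> k2).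
move=> H; apply: (plim_analytic2 t40); move: H; congr (plim _ _ _).
apply/funext => w /=; congr f; rewrite -addrA; congr (_ + _).
Qed.

Lemma analytic2_differentiable f a : analytic2_at f a -> differentiable f a.
Proof.
move=> /analytic2_plim[t [p [t0 pf]]].
have z : N 0 < t by rewrite normr0.
have [fx [fy [_ _ df _]]] := plim_diff pf z z.
have -> : f = (fun v => f (a + v)) \o (fun v => v - a).
  by apply/funext => v /=; rewrite addrC subrK.
apply: differentiable_comp => //=; rewrite subrr.
exact: df.
Qed.

Lemma analytic2_continuous f a : analytic2_at f a -> {for a, continuous f}.
Proof. by move=> /analytic2_differentiable/differentiable_continuous. Qed.

(** The polynomials that approximate a germ of order 2 may have terms of order 0 and 1, which tend
    to 0. Subtracting them makes every single polynomial of order 2, as [nrm_scale1] and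
    [pcomp_dvdX2] require. *)
Lemma kill_linear r p f : 0 < r -> plim r p f -> f (0, 0) = 0 ->
  'd f (0, 0) (1, 0) = 0 -> 'd f (0, 0) (0, 1) = 0 ->
  exists q, [/\ plim r q f,
    forall n, (q n)`_0`_0 = 0,
    forall n, (q n)`_1`_0 = 0 & forall n, (q n)`_0`_1 = 0].
Proof.
move=> r0 pf f0 f1 f2; have z : N 0 < r by rewrite normr0.
have [fx [fy [px py df dE]]] := plim_diff pf z z.
move: f1 f2; rewrite !dE !mulr1 !mulr0 addr0 add0r => fx0 fy0.
pose cx n := ev 0 0 (deriv (p n)); pose cy n := ev 0 0 (derY (p n)).
have cxE n : cx n = (p n)`_1`_0.
  by rewrite /cx ev00 coef_deriv mulr1n.
have cyE n : cy n = (p n)`_0`_1.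
  by rewrite /cy ev00 /derY coef_map /= coef_deriv mulr1n.
have pc := plim_center (ltW r0) pf.
have sNr := seminorm_nrm sN (ltW r0).
exists (fun n => (p n - (ev 0 0 (p n))%:P%:P) - (cx n)%:P%:P * 'X - (cy n)%:P%:P * 'X%:P).
have ccx : plim r (fun n => (cx n)%:P%:P) (fun=> 0).
  split; last by move=> x y _ _; under eq_fun do rewrite evC; rewrite -fx0.
  apply: (cauchyN_le sNr (c := r^-1) _ _ pf.1); first by rewrite invr_ge0 ltW.
  move=> n m; rewrite -!polyCB nrmCC ?(ltW r0)// !cxE -!coefB mulrC.
  rewrite ler_pdivlMr//; have := coef_le_nrm sN (p n - p m) 1 0 (ltW r0).
  by rewrite expr1.
have ccy : plim r (fun n => (cy n)%:P%:P) (fun=> 0).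
  split; last by move=> x y _ _; under eq_fun do rewrite evC; rewrite -fy0.
  apply: (cauchyN_le sNr (c := r^-1) _ _ pf.1); first by rewrite invr_ge0 ltW.
  move=> n m; rewrite -!polyCB nrmCC ?(ltW r0)// !cyE -!coefB mulrC.
  rewrite ler_pdivlMr//; have := coef_le_nrm sN (p n - p m) 0 1 (ltW r0).
  by rewrite expr1.
have plimN q g : plim r q g -> plim r (fun n => - q n) (fun v => - g v).
  move=> [cq qg]; split; first exact: cauchyNN.
  move=> x y xr yr; under eq_fun do rewrite -[- q _]sub0r evB /ev ev20 sub0r.
  by apply: cvgN; exact: qg.
split.
- have h1 := plimM (ltW r0) ccx (plim_fst (ltW r0)).
  have h2 := plimM (ltW r0) ccy (plim_snd (ltW r0)).
  have := plimD (ltW r0) (plimD (ltW r0) pc (plimN _ _ h1)) (plimN _ _ h2).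
  by congr (plim _ _ _); apply/funext => v; rewrite f0 !mul0r !subr0.
- move=> n; rewrite ev00 !coefB coefMX -polyCM !coefC /= ?coefMX ?coefC ?coef0 /=.
  by rewrite subrr !subr0.
- move=> n; rewrite !coefB coefMX -polyCM !coefC /= ?coefMX ?coefC ?coef0 /=.
  by rewrite cxE !subr0 subrr.
- move=> n; rewrite !coefB coefMX -polyCM !coefC /= ?coefMX ?coefC ?coef0 /=.
  by rewrite cyE !subr0 subrr.
Qed.

(** The zoom acts on a germ of order 2 as multiplication by about e. The new radius 4 leaves room
    for arguments of norm up to 2 together with a Cauchy estimate. *)
Lemma plim_rescale f (d : R) : 0 < d -> analytic2_at f (0, 0) -> f (0, 0) = 0 ->
  'd f (0, 0) (1, 0) = 0 -> 'd f (0, 0) (0, 1) = 0 ->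
  exists e0 : R, 0 < e0 /\ forall e : R, 0 < e <= e0 -> exists p,
    [/\ plim 4 p (fun v => e^-1 * f (e * v.1, e * v.2)),
      forall n, nrm N 4 (p n) <= d & forall n, (p n)`_0`_0 = 0].
Proof.
move=> d0 /analytic2_plim[r [p [r0 pf]]] f0 f1 f2.
have fE : (fun v => f ((0, 0) + v)) = f by apply/funext => v; rewrite add0r.
rewrite fE in pf.
have [q [qf q0 q1 q2]] := kill_linear r0 pf f0 f1 f2.
have [B B0 qB] := cauchyN_bounded (seminorm_nrm sN (ltW r0)) qf.1.
(* The first bound gives 4 e < r, so that the substitution is defined. The norm obtained is at most
   16 e B / r^2, which the second bound makes at most d / 4. *)
pose e0 := Num.min (r / 8) (d * r ^+ 2 / (64 * B)).
have e00 : 0 < e0 by rewrite lt_min !divr_gt0// ?mulr_gt0 ?exprn_gt0.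
exists e0; split=> // e /andP[e0' ee0].
have er : 8 * e <= r.
  have : e <= r / 8 by rewrite (le_trans ee0)// ge_min lexx.
  by rewrite ler_pdivlMr// mulrC.
have ed : e * (64 * B) <= d * r ^+ 2.
  have : e <= d * r ^+ 2 / (64 * B) by rewrite (le_trans ee0)// ge_min lexx orbT.
  by rewrite ler_pdivlMr ?mulr_gt0.
have N1 : N 1 <= 1 by rewrite normr1.
have e1 := ltW e0'.
have sN4 : seminorm (nrm N 4) by apply: seminorm_nrm.
have four : 0 <= 4 :> R by [].
have lt4 : 4 * e < r by lra.
have hX := plimM four (plim_cst e four) (plim_fst four).
have hY := plimM four (plim_cst e four) (plim_snd four).
have bX (n : nat) : nrm N 4 (e%:P%:P * 'X) <= 4 * e.
  have h : nrm N 4 (e%:P%:P : {poly {poly R}}) <= e by rewrite nrmCC// ger0_norm.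
  by have := seminormMle sN4 h (nrmX sN N1 four); rewrite (mulrC e).
have bY (n : nat) : nrm N 4 (e%:P%:P * 'X%:P) <= 4 * e.
  have h : nrm N 4 (e%:P%:P : {poly {poly R}}) <= e by rewrite nrmCC// ger0_norm.
  by have := seminormMle sN4 h (nrmY sN N1 four); rewrite (mulrC e).
have h := plim_comp four qf hX hY lt4 bX bY.
exists (fun n => (e^-1)%:P%:P * pcomp (e%:P%:P * 'X) (e%:P%:P * 'X%:P) (q n)); split.
- exact: plimM (plim_cst _ four) h.
- move=> n; set P := pcomp _ _ _.
  have hP : nrm N 4 P <= nrm N (4 * e) (q n).
    by apply: (ev2_le sN sN4 _ (q n) (bX 0) (bY 0)) => x; rewrite /= nrmCC.
  have hs : nrm N (4 * e) (q n) <= (4 * e / r) ^+ 2 * B.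
    have -> : 4 * e = 4 * e / r * r by rewrite divfK// gt_eqF.
    rewrite (le_trans (nrm_scale1 sN (ltW r0) _ (q0 n) (q1 n) (q2 n)))//.
      by rewrite divr_ge0 ?mulr_ge0 ?(ltW r0)//= ler_pdivrMr// mul1r ltW.
    rewrite mulfVK ?gt_eqF// ler_wpM2l//.
    by rewrite exprn_ge0// divr_ge0 ?mulr_ge0 ?(ltW r0).
  have hi : nrm N 4 ((e^-1)%:P%:P : {poly {poly R}}) <= e^-1.
    by rewrite nrmCC// ger0_norm// invr_ge0.
  apply: (le_trans (seminormMle sN4 hi (le_trans hP hs))).
  rewrite ler_pdivrMl// expr_div_n mulrAC ler_pdivrMr ?exprn_gt0//.
  have := ler_wpM2l e1 ed; have := mulr_ge0 (mulr_ge0 e1 e1) (ltW B0).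
  clear bX bY; lra.
- move=> n; rewrite -ev00 evM evC ev_comp !evM !evC evX evY !mulr0 ev00.
  by rewrite q0 mulr0.
Qed.

End Germs.

(** * Fixed points on pairs of germs, and inverses near the identity *)

Section Inverse.
Variable R : realType.
Notation P := {poly {poly R}}.
Notation N := (@Num.norm _ R).

Let sN := @seminorm_normr R.

Lemma plim_analytic2_in r p (f : R * R -> R) v : plim r p f ->
  N v.1 < r -> N v.2 < r -> analytic2_at f v.
Proof.
move=> pf v1 v2; pose m := Num.max (N v.1) (N v.2).
have mr : m < r by rewrite gt_max v1.
have m1 : N v.1 <= m by rewrite le_max lexx.
have m2 : N v.2 <= m by rewrite le_max lexx orbT.
have d0 : 0 < (r - m) / 2 by rewrite divr_gt0// subr_gt0.
have d0' := ltW d0.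
have sr : m + (r - m) / 2 < r by lra.
have N1 : N 1 <= 1 by rewrite normr1.
have sNd := seminorm_nrm sN d0'.
have h1 := plimD d0' (plim_cst v.1 d0') (plim_fst d0').
have h2 := plimD d0' (plim_cst v.2 d0') (plim_snd d0').
have k1 : nrm N ((r - m) / 2) (v.1%:P%:P + 'X) <= m + (r - m) / 2.
  by rewrite (le_trans (seminormD sNd _ _))// nrmCC// lerD// nrmX.
have k2 : nrm N ((r - m) / 2) (v.2%:P%:P + 'X%:P) <= m + (r - m) / 2.
  by rewrite (le_trans (seminormD sNd _ _))// nrmCC// lerD// nrmY.
by have := plim_comp d0' pf h1 h2 sr (fun=> k1) (fun=> k2); exact: plim_analytic2.
Qed.

(** One contraction for three equations: L1 and L2 are a change of sign for inverse functions,
    integration for solutions, and a resolvent for invariant curves. The condition c B <= rho keeps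
    the ball of radius rho invariant. The Lipschitz constant is 2 c B / (t - s), one c for each
    component, hence at most 1/2 by the last condition. *)
Lemma fixpoint2 (r s t c B rho : R) (F1 F2 : nat -> P) (L1 L2 : P -> P -> P)
    (a0 b0 : P) :
  0 <= r -> s < t -> 0 <= c -> 0 <= rho ->
  cauchyN (nrm N t) F1 -> cauchyN (nrm N t) F2 ->
  (forall n, nrm N t (F1 n) + nrm N t (F2 n) <= B) ->
  (forall p q p' q', L1 p q - L1 p' q' = L1 (p - p') (q - q')) ->
  (forall p q p' q', L2 p q - L2 p' q' = L2 (p - p') (q - q')) ->
  (forall p q, nrm N r (L1 p q) <= c * (nrm N r p + nrm N r q)) ->
  (forall p q, nrm N r (L2 p q) <= c * (nrm N r p + nrm N r q)) ->
  nrm N r a0 + rho <= s -> nrm N r b0 + rho <= s ->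
  c * B <= rho -> 4 * (c * B) <= t - s ->
  exists a b : nat -> P, [/\ cauchyN (nrm N r) a, cauchyN (nrm N r) b,
    forall n, nrm N r (a n) <= s, forall n, nrm N r (b n) <= s &
    (a 0%N, b 0%N) = (a0, b0) /\
    forall n, let x := pcomp (a n) (b n) (F1 n) in
      let y := pcomp (a n) (b n) (F2 n) in
      a n.+1 = a0 + L1 x y /\ b n.+1 = b0 + L2 x y].
Proof.
move=> r0 st c0 rho0 cF1 cF2 FB L1B L2B L1N L2N as0 bs0 cB cBts.
have sM := seminorm_nrm sN r0; set M := nrm N r in sM L1N L2N as0 bs0 *.
have ts : 0 < t - s by rewrite subr_gt0.
have a00 : 0 <= M a0 by exact: seminorm_ge0.
have iM (x : R) : M ((polyC \o polyC) x) <= N x by rewrite /M /= nrmCC.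
pose nm (u : (P * P)%type) : R := M u.1 + M u.2.
pose S (u : (P * P)%type) := M (u.1 - a0) <= rho /\ M (u.2 - b0) <= rho.
pose Phi n (u : (P * P)%type) : (P * P)%type :=
  (a0 + L1 (pcomp u.1 u.2 (F1 n)) (pcomp u.1 u.2 (F2 n)),
   b0 + L2 (pcomp u.1 u.2 (F1 n)) (pcomp u.1 u.2 (F2 n))).
have Ss u : S u -> M u.1 <= s /\ M u.2 <= s.
  move=> [u1 u2]; split.
    rewrite -(subrK a0 u.1) (le_trans (seminormD sM _ _))//; lra.
  rewrite -(subrK b0 u.2) (le_trans (seminormD sM _ _))//; lra.
have tpos u : S u -> 0 <= s < t.
  by move=> /Ss[u1 _]; rewrite st andbT (le_trans _ u1)// seminorm_ge0.
have Fs u n : S u -> M (pcomp u.1 u.2 (F1 n)) + M (pcomp u.1 u.2 (F2 n)) <= B.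
  move=> Su; have [u1 u2] := Ss _ Su; have /andP[s0' _] := tpos _ Su.
  rewrite (le_trans _ (FB n))// lerD//.
    rewrite (le_trans (ev2_le sN sM iM _ u1 u2))// le_nrm// s0' ltW//.
  by rewrite (le_trans (ev2_le sN sM iM _ u1 u2))// le_nrm// s0' ltW.
have cancel1 (z x : P) : z + x - z = x by rewrite addrAC subrr add0r.
have cancel2 (z x y : P) : z + x - (z + y) = x - y.
  by rewrite opprD addrA [z + x - z]cancel1.
have SPhi n u : S u -> S (Phi n u).
  move=> Su; have cBn := le_trans (ler_wpM2l c0 (Fs _ n Su)) cB.
  split; rewrite /Phi /= cancel1.
    exact: le_trans (L1N _ _) cBn.
  exact: le_trans (L2N _ _) cBn.
have nmD u v : nm (u + v) <= nm u + nm v.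
  by rewrite /nm /= addrACA lerD// seminormD.
have contr n u v : S u -> S v -> nm (Phi n u - Phi n v) <= nm (u - v) / 2.
  move=> Su Sv; have [u1 u2] := Ss _ Su; have [v1 v2] := Ss _ Sv.
  have /andP[s0' _] := tpos _ Su; have t0 : 0 <= t by rewrite (le_trans s0')// ltW.
  rewrite /nm /Phi /= !cancel2 L1B L2B.
  apply: (le_trans (lerD (L1N _ _) (L2N _ _))).
  have e1 := ev2_lip sN sM iM (F1 n) u1 u2 v1 v2 st.
  have e2 := ev2_lip sN sM iM (F2 n) u1 u2 v1 v2 st.
  have := lerD e1 e2; rewrite -mulrDr -mulrDl.
  set X := M (_ - _) + M (_ - _); set Y := M _ + M _; rewrite -/X => h.
  have Y0 : 0 <= Y by rewrite addr_ge0 ?seminorm_ge0.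
  have h' : X <= Y * (B / (t - s)).
    by rewrite (le_trans h)// ler_wpM2l// ler_wpM2r// ?invr_ge0 ?(ltW ts)// addrC.
  have h2 : c * (B / (t - s)) <= 4^-1.
    by rewrite mulrA ler_pdivrMr//; lra.
  have := ler_wpM2l c0 h'; have := ler_wpM2l Y0 h2; rewrite /Y; lra.
have NB u v : S u -> S v -> nm (u - v) <= 4 * rho.
  move=> [u1 u2] [v1 v2]; rewrite /nm /=.
  have -> : u.1 - v.1 = (u.1 - a0) - (v.1 - a0) by ring.
  have -> : u.2 - v.2 = (u.2 - b0) - (v.2 - b0) by ring.
  have := lerD (seminormB sM (u.1 - a0) (v.1 - a0)) (seminormB sM (u.2 - b0) (v.2 - b0)).
  lra.
have unif (e : R) : 0 < e -> exists n0, forall n m u,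
    (n0 <= n)%N -> (n0 <= m)%N -> S u -> nm (Phi n u - Phi m u) <= e.
  move=> e0; have e1 : 0 < e / (4 * (c + 1)) by rewrite divr_gt0// mulr_gt0// ltr_wpDl.
  have [n0 n0P] := cF1 _ e1; have [n1 n1P] := cF2 _ e1.
  exists (maxn n0 n1) => n m u; rewrite !geq_max => /andP[x0 x1] /andP[y0 y1] Su.
  have [u1 u2] := Ss _ Su.
  have /andP[s0' _] := tpos _ Su; have t0 : 0 <= t by rewrite (le_trans s0')// ltW.
  rewrite /nm /Phi /= !cancel2 L1B L2B.
  apply: (le_trans (lerD (L1N _ _) (L2N _ _))).
  rewrite /pcomp -!ev2B.
  have st' : 0 <= s <= t by rewrite s0' ltW.
  have h1 := le_trans (ev2_le sN sM iM (F1 n - F1 m) u1 u2) (le_nrm sN _ st').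
  have h2 := le_trans (ev2_le sN sM iM (F2 n - F2 m) u1 u2) (le_nrm sN _ st').
  have := le_trans h1 (n0P _ _ x0 y0); have := le_trans h2 (n1P _ _ x1 y1).
  set X := M _; set Y := M _ => hX hY.
  have hc : 4 * (c + 1) * (e / (4 * (c + 1))) = e by field; lra.
  have cc : 0 <= c + 1 by lra.
  have := ler_wpM2l c0 hX; have := ler_wpM2l c0 hY; move: hc e1; lra.
have S0 : S (a0, b0) by split; rewrite /= subrr (seminorm0 sM).
pose u := iterates Phi (a0, b0).
have cu := cauchyN_iterates S0 SPhi NB nmD contr unif.
have uS n : S (u n) := iterates_in S0 SPhi n.
exists (fun n => (u n).1), (fun n => (u n).2); split.
- move=> e /cu[n0 n0P]; exists n0 => n m x y; apply: le_trans (n0P n m x y).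
  by rewrite /nm lerDl seminorm_ge0.
- move=> e /cu[n0 n0P]; exists n0 => n m x y; apply: le_trans (n0P n m x y).
  by rewrite /nm lerDr seminorm_ge0.
- by move=> n; exact: (Ss _ (uS n)).1.
- by move=> n; exact: (Ss _ (uS n)).2.
- by split.
Qed.

(** The inverse at (x, y) is the fixed point of u |-> (x, y) - f u. The identity has norm 1 and the
    correction norm at most 1/8, so the iterates stay below 3/2, well inside the radius 4 of f. *)
Lemma near_identity_inverse (k1 k2 : nat -> P) (f1 f2 : R * R -> R) :
  plim 4 k1 f1 -> plim 4 k2 f2 ->
  (forall n, nrm N 4 (k1 n) <= 16^-1) -> (forall n, nrm N 4 (k2 n) <= 16^-1) ->
  exists (a b : nat -> P) (l1 l2 : R * R -> R), [/\ plim 1 a l1, plim 1 b l2 &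
    forall v, N v.1 <= 1 -> N v.2 <= 1 -> [/\ N (l1 v) < 2, N (l2 v) < 2,
      l1 v + f1 (l1 v, l2 v) = v.1 & l2 v + f2 (l1 v, l2 v) = v.2]].
Proof.
move=> pf1 pf2 k1B k2B.
have N1 : N 1 <= 1 by rewrite normr1.
have [||||||||||||||| a [b [ca cb as_ bs [_ rec]]]] :=
  @fixpoint2 1 (3 / 2) 4 1 (8^-1) (8^-1) k1 k2 (fun p q => - p) (fun p q => - q) 'X 'X%:P.
- by [].
- lra.
- by [].
- lra.
- exact: pf1.1.
- exact: pf2.1.
- move=> n; have := k1B n; have := k2B n; lra.
- by move=> p q p' q'; rewrite opprB opprK addrC.
- by move=> p q p' q'; rewrite opprB opprK addrC.
- move=> p q; have sM := seminorm_nrm sN (@ler01 R).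
  by rewrite (seminormN sM) mul1r lerDl nrm_ge0.
- move=> p q; have sM := seminorm_nrm sN (@ler01 R).
  by rewrite (seminormN sM) mul1r lerDr nrm_ge0.
- have := nrmX sN N1 (@ler01 R); lra.
- have := nrmY sN N1 (@ler01 R); lra.
- by rewrite mul1r.
- lra.
have pl1 := plim_exists ca; have pl2 := plim_exists cb.
exists a, b, (fun v => limn (fun n => ev v.1 v.2 (a n))),
  (fun v => limn (fun n => ev v.1 v.2 (b n))); split=> //.
set l1 := (fun v => limn (fun n => ev v.1 v.2 (a n))) in pl1 *.
set l2 := (fun v => limn (fun n => ev v.1 v.2 (b n))) in pl2 *.
move=> [x y] /= x1 y1.
have ax := pl1.2 x y x1 y1; have bY := pl2.2 x y x1 y1.
have av n : N (ev x y (a n)) <= 3 / 2 by exact: le_trans (ev_le _ x1 y1) (as_ n).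
have bv n : N (ev x y (b n)) <= 3 / 2 by exact: le_trans (ev_le _ x1 y1) (bs n).
have lt4 : 3 / 2 < 4 :> R by lra.
have h1 := lim_ev pf1 lt4 av bv ax bY.
have h2 := lim_ev pf2 lt4 av bv ax bY.
have la := cvgn_norm_le ax av; have lb := cvgn_norm_le bY bv.
have e1 : l1 (x, y) = x - f1 (l1 (x, y), l2 (x, y)).
  apply: cvgn_uniq (cvgn_shift ax) _.
  have -> : (fun n => ev x y (a n.+1)) =
      (fun n => x - ev (ev x y (a n)) (ev x y (b n)) (k1 n)).
    by apply/funext => n; rewrite (rec n).1 evB evX ev_comp.
  by apply: cvgB => //; exact: cvg_cst.
have e2 : l2 (x, y) = y - f2 (l1 (x, y), l2 (x, y)).
  apply: cvgn_uniq (cvgn_shift bY) _.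
  have -> : (fun n => ev x y (b n.+1)) =
      (fun n => y - ev (ev x y (a n)) (ev x y (b n)) (k2 n)).
    by apply/funext => n; rewrite (rec n).2 evB evY ev_comp.
  by apply: cvgB => //; exact: cvg_cst.
move: e1 e2 la lb; rewrite /= -/(l1 (x, y)) -/(l2 (x, y)) => e1 e2 la lb.
by split; [lra|lra|rewrite {1}e1 subrK|rewrite {1}e2 subrK].
Qed.

End Inverse.

(** * Gradients, inverse functions, flows *)

Section Gradient.
Variable R : realType.
Implicit Types (f g : R * R -> R) (p : R * R).
Notation N := (@Num.norm _ R).

(** A relation rather than a pair of partial derivatives: the gradient of a compound function is
    assembled by the rules below and put in the desired form by [grad_eq]. *)
Definition grad f p (a b : R) : Prop :=
  differentiable f p /\ forall h k, 'd f p (h, k) = a * h + b * k.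

Lemma grad_exact f p (a b : R) :
  (forall h k, f (p.1 + h, p.2 + k) - f p = a * h + b * k) -> grad f p a b.
Proof.
case: p => x y /= fE; apply: (@diff_of_quadratic _ _ _ _ _ _ 0 1) => // h k _ _.
by rewrite fE mul0r -addrA -opprD subrr normr0.
Qed.

Lemma grad_fst p : grad fst p 1 0.
Proof. by apply: grad_exact => h k /=; ring. Qed.

Lemma grad_snd p : grad snd p 0 1.
Proof. by apply: grad_exact => h k /=; ring. Qed.

Lemma grad_cst c p : grad (fun=> c) p 0 0.
Proof. by apply: grad_exact => h k /=; ring. Qed.

Lemma gradD f g p a b c d : grad f p a b -> grad g p c d ->
  grad (fun v => f v + g v) p (a + c) (b + d).
Proof.
move=> [df fE] [dg gE]; split; first exact: differentiableD.
move=> h k; have -> : (fun v => f v + g v) = (f + g)%R by [].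
apply: (etrans (congr1 (fun F => F (h, k)) (diffD df dg))).
apply: (etrans (f_equal2 +%R (fE h k) (gE h k))); ring.
Qed.

Lemma gradM f g p a b c d : grad f p a b -> grad g p c d ->
  grad (fun v => f v * g v) p (f p * c + a * g p) (f p * d + b * g p).
Proof.
move=> [df fE] [dg gE]; split; first exact: differentiableM.
move=> h k; have -> : (fun v => f v * g v) = (f * g)%R by [].
apply: (etrans (congr1 (fun F => F (h, k)) (diffM df dg))).
apply: (etrans (f_equal2 (fun u v => f p * u + g p * v) (gE h k) (fE h k))); ring.
Qed.

Lemma grad_comp f g1 g2 p a b a1 b1 a2 b2 :
  grad f (g1 p, g2 p) a b -> grad g1 p a1 b1 -> grad g2 p a2 b2 ->
  grad (fun v => f (g1 v, g2 v)) p (a * a1 + b * a2) (a * b1 + b * b2).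
Proof.
move=> [df fE] [d1 E1] [d2 E2].
have dp := differentiable_pair d1 d2.
split; first exact: (differentiable_comp dp df).
move=> h k.
have e1 := congr1 (fun F => F (h, k)) (diff_comp dp df).
have e2 := congr1 (fun F => F (h, k)) (diff_pair d1 d2).
have e3 := etrans e2 (f_equal2 pair (E1 h k) (E2 h k)).
apply: (etrans e1); apply: (etrans (congr1 ('d f (g1 p, g2 p)) e3)).
apply: (etrans (fE _ _)); ring.
Qed.

Lemma grad_eq f p a b c d : grad f p a b -> a = c -> b = d -> grad f p c d.
Proof. by move=> + <- <-. Qed.

Lemma grad_uniq f p a b c d : grad f p a b -> grad f p c d -> a = c /\ b = d.
Proof.
move=> [_ E] [_ E']; split.
  by have := E 1 0; rewrite E' !mulr1 !mulr0 !addr0.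
by have := E 0 1; rewrite E' !mulr1 !mulr0 !add0r.
Qed.

Lemma grad_derive f p a b h k : grad f p a b -> 'D_(h, k) f p = a * h + b * k.
Proof. by move=> [df fE]; rewrite deriveE. Qed.

Lemma analytic2_grad f p : analytic2_at f p -> exists a b, grad f p a b.
Proof.
move=> /analytic2_differentiable df; exists ('d f p (1, 0)), ('d f p (0, 1)).
split=> // h k.
have -> : (h, k) = h *: (1, 0) + k *: (0, 1) :> R * R.
  rewrite [RHS]surjective_pairing; congr pair.
    by rewrite /= /GRing.scale /= mulr1 mulr0 addr0.
  by rewrite /= /GRing.scale /= mulr1 mulr0 add0r.
by rewrite linearD !linearZ; congr (_ + _); exact: mulrC.
Qed.

Lemma plim_grad t q f p : plim t q f -> N p.1 < t -> N p.2 < t ->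
  exists a b : R, [/\ (fun n => ev p.1 p.2 (deriv (q n))) @ \oo --> a,
    (fun n => ev p.1 p.2 (derY (q n))) @ \oo --> b & grad f p a b].
Proof.
case: p => x y qf x0 y0; have [a [b [ha hb df E]]] := plim_diff qf x0 y0.
by exists a, b; split.
Qed.

Lemma grad_curve f (g1 g2 : R -> R) t a b d1 d2 :
  grad f (g1 t, g2 t) a b -> is_derive t (1 : R) g1 d1 -> is_derive t (1 : R) g2 d2 ->
  is_derive t (1 : R) (fun s => f (g1 s, g2 s)) (a * d1 + b * d2).
Proof.
move=> [df fE] [h1 <-] [h2 <-].
have k1 := (derivable1_diffP _ _).1 h1; have k2 := (derivable1_diffP _ _).1 h2.
have dp := differentiable_pair k1 k2.
have dc := differentiable_comp dp df.
apply: DeriveDef; first exact: diff_derivable.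
rewrite deriveE// diff_comp//= diff_pair//= fE.
by rewrite -!deriveE.
Qed.

Lemma is_derive_pair (g1 g2 : R -> R) t d1 d2 :
  is_derive t (1 : R) g1 d1 -> is_derive t (1 : R) g2 d2 ->
  is_derive t (1 : R) (fun s => (g1 s, g2 s)) (d1, d2).
Proof.
move=> [h1 <-] [h2 <-].
have k1 := (derivable1_diffP _ _).1 h1; have k2 := (derivable1_diffP _ _).1 h2.
have dp := differentiable_pair k1 k2.
apply: DeriveDef; first exact: diff_derivable.
by rewrite deriveE// diff_pair//= -!deriveE.
Qed.

Lemma is_derive_fst (g : R -> R * R) t d : is_derive t (1 : R) g d ->
  is_derive t (1 : R) (fun s => (g s).1) d.1 /\ is_derive t (1 : R) (fun s => (g s).2) d.2.
Proof.
move=> [h <-]; have k := (derivable1_diffP _ _).1 h.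
have [d1 E1] := grad_fst (g t); have [d2 E2] := grad_snd (g t).
have c1 : differentiable ((fst : R * R -> R) \o g) t by exact: differentiable_comp.
have c2 : differentiable ((snd : R * R -> R) \o g) t by exact: differentiable_comp.
split; apply: DeriveDef; first by apply: diff_derivable; exact: c1.
- rewrite (deriveE _ c1) diff_comp//= (deriveE _ k).
  by case: ('d g t 1) => x y; rewrite E1 mul1r mul0r addr0.
- by apply: diff_derivable; exact: c2.
- rewrite (deriveE _ c2) diff_comp//= (deriveE _ k).
  by case: ('d g t 1) => x y; rewrite E2 mul0r mul1r add0r.
Qed.

Lemma box_open (c d : R) : open [set v : R * R | N v.1 < c /\ N v.2 < d].
Proof.
have -> : [set v : R * R | N v.1 < c /\ N v.2 < d] =
    (fun v => N v.1) @^-1` [set x | x < c] `&` (fun v => N v.2) @^-1` [set x | x < d].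
  by apply/seteqP; split => v /=.
apply: openI; apply: open_comp; try exact: open_lt.
  by move=> v _; apply: continuous_comp; [exact: cvg_fst|exact: norm_continuous].
by move=> v _; apply: continuous_comp; [exact: cvg_snd|exact: norm_continuous].
Qed.

Lemma open_box (A : set (R * R)) p : open A -> A p ->
  exists2 d : R, 0 < d & forall v, N (v.1 - p.1) < d -> N (v.2 - p.2) < d -> A v.
Proof.
move=> oA Ap; have := open_nbhs_nbhs (conj oA Ap).
move=> /nbhs_ballP[d /= d0 dA]; exists d => // v v1 v2; apply: dA.
by split; rewrite /ball /= distrC.
Qed.

Lemma open_of_box (A : set (R * R)) : (forall p, A p -> exists2 d : R, 0 < d &
    forall v, N (v.1 - p.1) < d -> N (v.2 - p.2) < d -> A v) -> open A.
Proof.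
move=> H; rewrite openE => p /H[d d0 dA]; apply/nbhs_ballP; exists d => //= v [].
by rewrite /ball /= => v1 v2; apply: dA; rewrite distrC.
Qed.

Lemma continuous_box f p (e : R) : {for p, continuous f} -> 0 < e ->
  exists2 d : R, 0 < d & forall v, N (v.1 - p.1) < d -> N (v.2 - p.2) < d ->
    N (f v - f p) < e.
Proof.
move=> cf e0; have /cvgrPdist_lt/(_ e e0)/nbhs_ballP[d /= d0 dP] := cf.
exists d => // v v1 v2; rewrite distrC; apply: dP.
by split; rewrite /ball /= distrC.
Qed.

End Gradient.

Section InverseFunction.
Variable R : realType.
Implicit Types (f : R * R -> R) (p : R * R).
Notation N := (@Num.norm _ R).

Let sN := @seminorm_normr R.

Lemma open_analytic_lt (A : set (R * R)) f (c : R) : open A ->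
  (forall p, A p -> analytic2_at f p) -> open [set v | A v /\ N (f v) < c].
Proof.
move=> oA fA; apply: open_of_box => p [Ap fpc].
have [d d0 dA] := open_box oA Ap.
have e0 : 0 < c - N (f p) by rewrite subr_gt0.
have [e e0' eP] := continuous_box (analytic2_continuous (fA _ Ap)) e0.
exists (Num.min d e); first by rewrite lt_min d0.
move=> v; rewrite !lt_min => /andP[v1 v1'] /andP[v2 v2']; split; first exact: dA.
have := eP v v1' v2'; have := ler_normD (f v - f p) (f p); rewrite subrK; lra.
Qed.

Lemma analytic2_lin (x y : R) f g p : analytic2_at f p -> analytic2_at g p ->
  analytic2_at (fun v => x * f v + y * g v) p.
Proof.
by move=> fa ga; apply: analytic2D; apply: analytic2M => //; exact: analytic2_cst.
Qed.

(** Injectivity of the identity plus a small Lipschitz map: each component of the perturbation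
    varies by at most 1/32 of the l1 distance of the two points, so this distance is at most 1/16 of
    itself. *)
Lemma contraction_eq0 (x y z t u : R) (s1 s2 s3 s4 : R) :
  x + s1 = t -> z + s3 = t -> y + s2 = u -> forall w, w + s4 = u ->
  N (s1 - s3) <= (N (x - z) + N (y - w)) * (16^-1 / (4 - 2)) ->
  N (s2 - s4) <= (N (x - z) + N (y - w)) * (16^-1 / (4 - 2)) ->
  z = x /\ w = y.
Proof.
move=> e1 e3 e2 w e4; have -> : 4 - 2 = 2 :> R by lra.
have -> : s1 - s3 = - (x - z) by lra.
have -> : s2 - s4 = - (y - w) by lra.
rewrite !normrN => L1 L2.
have X0 := normr_ge0 (x - z); have Y0 := normr_ge0 (y - w).
have X1 : N (x - z) = 0 by lra.
have Y1 : N (y - w) = 0 by lra.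
by split; apply/eqP; rewrite eq_sym -subr_eq0 -normr_eq0 ?X1 ?Y1.
Qed.

(** Composition with the inverse of the Jacobian matrix, followed by a zoom, reduces the claim to
    [near_identity_inverse]. The bound delta on U lets later uses force U into a given
    neighborhood. *)
Lemma inverse_function f1 f2 (a b c d delta : R) :
  analytic2_at f1 (0, 0) -> analytic2_at f2 (0, 0) ->
  f1 (0, 0) = 0 -> f2 (0, 0) = 0 ->
  grad f1 (0, 0) a b -> grad f2 (0, 0) c d -> a * d - b * c != 0 -> 0 < delta ->
  exists (U W : set (R * R)) (l1 l2 : R * R -> R),
    [/\ [/\ open U, U (0, 0) & forall u, U u -> N u.1 < delta /\ N u.2 < delta],
        open W /\ W (0, 0),
        forall u, U u -> [/\ W (f1 u, f2 u), l1 (f1 u, f2 u) = u.1,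
          l2 (f1 u, f2 u) = u.2, analytic2_at f1 u & analytic2_at f2 u] &
        forall w, W w -> [/\ U (l1 w, l2 w), f1 (l1 w, l2 w) = w.1,
          f2 (l1 w, l2 w) = w.2, analytic2_at l1 w & analytic2_at l2 w]].
Proof.
move=> an1 an2 f10 f20 g1 g2; set D := _ - _ => D0 delta0.
(* (y1, y2) is the inverse of the Jacobian matrix at 0, and (m1, m2) is what the composite has
   beyond the identity, of order 2. *)
pose y1 (w : R * R) : R := d / D * w.1 + (- b / D) * w.2.
pose y2 (w : R * R) : R := (- c / D) * w.1 + a / D * w.2.
pose m1 v : R := y1 (f1 v, f2 v) - v.1.
pose m2 v : R := y2 (f1 v, f2 v) - v.2.
have yinj w w' : y1 w = y1 w' -> y2 w = y2 w' -> w = w'.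
  move=> e1 e2; rewrite [w]surjective_pairing [w']surjective_pairing.
  have E1 z : z.1 = a * y1 z + b * y2 z by rewrite /y1 /y2 /D; field.
  have E2 z : z.2 = c * y1 z + d * y2 z by rewrite /y1 /y2 /D; field.
  by rewrite !E1 !E2 e1 e2.
have am1 : analytic2_at m1 (0, 0).
  apply: analytic2B; last exact: analytic2_fst.
  exact: analytic2_lin.
have am2 : analytic2_at m2 (0, 0).
  apply: analytic2B; last exact: analytic2_snd.
  exact: analytic2_lin.
have gm (x y : R) (i : R * R -> R) (p q : R) : grad i (0, 0) p q ->
    x * a + y * c = p -> x * b + y * d = q ->
    grad (fun v => (x * f1 v + y * f2 v) - i v) (0, 0) 0 0.
  move=> gi ep eq.
  have := gradD (gradD (gradM (grad_cst x _) g1) (gradM (grad_cst y _) g2))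
    (gradM (grad_cst (-1) _) gi).
  rewrite !mul0r !addr0 ep eq !mulN1r !subrr.
  by congr (grad _ _ _ _); apply/funext => v; rewrite mulN1r.
have m10 : m1 (0, 0) = 0 by rewrite /m1 /y1 /= f10 f20 !mulr0 addr0 subr0.
have m20 : m2 (0, 0) = 0 by rewrite /m2 /y2 /= f10 f20 !mulr0 addr0 subr0.
have gm1 : grad m1 (0, 0) 0 0.
  by apply: (gm (d / D) (- b / D) _ 1 0 (@grad_fst R _)); rewrite /D; field.
have gm2 : grad m2 (0, 0) 0 0.
  by apply: (gm (- c / D) (a / D) _ 0 1 (@grad_snd R _)); rewrite /D; field.
have dz (m : R * R -> R) : grad m (0, 0) 0 0 ->
    'd m (0, 0) (1, 0) = 0 /\ 'd m (0, 0) (0, 1) = 0.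
  by move=> [_ E]; rewrite !E !mul0r addr0.
have d16 : 0 < 16^-1 :> R by rewrite invr_gt0.
have [e1 [e10 H1]] := plim_rescale d16 am1 m10 (dz _ gm1).1 (dz _ gm1).2.
have [e2 [e20 H2]] := plim_rescale d16 am2 m20 (dz _ gm2).1 (dz _ gm2).2.
have [r1 [r10 N1]] := analytic2_near an1.
have [r2 [r20 N2]] := analytic2_near an2.
pose e := Num.min (Num.min e1 e2) (Num.min (delta / 4) (Num.min (r1 / 4) (r2 / 4))).
have e0 : 0 < e by rewrite !lt_min e10 e20 !divr_gt0.
have ee1 : e <= e1 by rewrite /e !ge_min lexx.
have ee2 : e <= e2 by rewrite /e !ge_min lexx !orbT.
have ed : 2 * e < delta.
  have : e <= delta / 4 by rewrite /e !ge_min lexx !orbT.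
  lra.
have er1 : 2 * e < r1.
  have : e <= r1 / 4 by rewrite /e !ge_min lexx !orbT.
  lra.
have er2 : 2 * e < r2.
  have : e <= r2 / 4 by rewrite /e !ge_min lexx !orbT.
  lra.
clearbody e.
have [|q1 [pq1 q1B _]] := H1 e; first by rewrite e0.
have [|q2 [pq2 q2B _]] := H2 e; first by rewrite e0.
set k1 := (fun v => _) in pq1; set k2 := (fun v => _) in pq2.
have [A [B [l1 [l2 [pA pB lP]]]]] := near_identity_inverse pq1 pq2 q1B q2B.
have an u : N u.1 < 2 * e -> N u.2 < 2 * e -> analytic2_at f1 u /\ analytic2_at f2 u.
  move=> u1 u2; have := N1 u; have := N2 u; rewrite !add0r => h2 h1.
  by split; [apply: h1|apply: h2]; exact: lt_trans (_ : _ < 2 * e) _.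
have y1a p : analytic2_at y1 p.
  by apply: analytic2_lin; [exact: analytic2_fst|exact: analytic2_snd].
have y2a p : analytic2_at y2 p.
  by apply: analytic2_lin; [exact: analytic2_fst|exact: analytic2_snd].
(* The half-width 2 e is the rescaled bound 2 on the preimages found by [near_identity_inverse], and
   preimages are unique inside this box. Hence U, cut out of the box by the preimage of W,
   corresponds exactly to W. *)
pose box := [set u : R * R | N u.1 < 2 * e /\ N u.2 < 2 * e].
pose U := [set u | [set u | box u /\ N (y1 (f1 u, f2 u)) < e] u /\ N (y2 (f1 u, f2 u)) < e].
pose W := [set w | [set w | setT w /\ N (y1 w) < e] w /\ N (y2 w) < e].
have oU : open U.
  have key p : box p -> analytic2_at (fun u => y1 (f1 u, f2 u)) p /\
      analytic2_at (fun u => y2 (f1 u, f2 u)) p.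
    by move=> [p1 p2]; have [h1 h2] := an p p1 p2; split; exact: analytic2_lin.
  apply: open_analytic_lt => [|p [/key[]//]].
  by apply: open_analytic_lt => [|p /key[]//]; exact: box_open.
have oW : open W.
  apply: open_analytic_lt => [|p _]; last exact: y2a.
  by apply: open_analytic_lt => [|p _]; [exact: openT|exact: y1a].
have y10 : y1 (0, 0) = 0 by rewrite /y1 /= !mulr0 addr0.
have y20 : y2 (0, 0) = 0 by rewrite /y2 /= !mulr0 addr0.
have eN0 : e != 0 by rewrite gt_eqF.
have k1E v : v.1 + k1 v = e^-1 * y1 (f1 (e * v.1, e * v.2), f2 (e * v.1, e * v.2)).
  by rewrite /k1 /m1 /= mulrBr mulKf// addrC subrK.
have k2E v : v.2 + k2 v = e^-1 * y2 (f1 (e * v.1, e * v.2), f2 (e * v.1, e * v.2)).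
  by rewrite /k2 /m2 /= mulrBr mulKf// addrC subrK.
have scale_lt x : N x < e -> N (e^-1 * x) < 1.
  by move=> xe; rewrite normrM gtr0_norm ?invr_gt0// ltr_pdivrMl// mulr1.
pose q (w : R * R) : R * R := (e^-1 * y1 w, e^-1 * y2 w).
have linv u : U u -> l1 (q (f1 u, f2 u)) = e^-1 * u.1 /\
    l2 (q (f1 u, f2 u)) = e^-1 * u.2.
  move=> [[[u1 u2] h1] h2]; pose v : R * R := (e^-1 * u.1, e^-1 * u.2).
  have [q1' q2' E1 E2] := lP (q (f1 u, f2 u)) (ltW (scale_lt _ h1)) (ltW (scale_lt _ h2)).
  have vu : (e * v.1, e * v.2) = u by rewrite [u]surjective_pairing /v /= !mulVKf.
  have F1 := k1E v; have F2 := k2E v; rewrite vu in F1 F2.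
  have two x : N x < 2 * e -> N (e^-1 * x) <= 2.
    by move=> xe; rewrite normrM gtr0_norm ?invr_gt0// ler_pdivrMl// mulrC ltW.
  have lt24 : 2 < 4 :> R by rewrite ltr_nat.
  have L1 := plim_lip pq1 q1B (two _ u1) (two _ u2) (ltW q1') (ltW q2') lt24.
  have L2 := plim_lip pq2 q2B (two _ u1) (two _ u2) (ltW q1') (ltW q2') lt24.
  move: L1 L2 E1 E2 F1 F2; rewrite -[(e^-1 * u.1, e^-1 * u.2)]/v.
  set z1 := l1 _; set z2 := l2 _.
  rewrite -[e^-1 * u.1]/(v.1) -[e^-1 * u.2]/(v.2).
  move: (k1 v) (k2 v) (k1 (z1, z2)) (k2 (z1, z2)) => s1 s2 s3 s4 L1 L2 E1 E2 F1 F2.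
  by rewrite /q /= in E1 E2; exact: contraction_eq0 F1 E1 F2 _ E2 L1 L2.
exists U, W, (fun w => e * l1 (q w)), (fun w => e * l2 (q w)); split.
- split=> //; last by move=> u [[[u1 u2] _] _]; split; exact: lt_trans (_ : _ < 2 * e) _.
  by rewrite /U /box /= f10 f20 y10 y20 normr0 mulr_gt0.
- by split=> //; rewrite /W /= y10 y20 normr0.
- move=> u Uu; have [E1 E2] := linv u Uu; have [[[u1 u2] h1] h2] := Uu.
  by have [a1 a2] := an u u1 u2; split=> //; rewrite ?E1 ?E2 mulVKf.
- move=> w [[_ h1] h2].
  have [q1' q2' E1 E2] := lP (q w) (ltW (scale_lt _ h1)) (ltW (scale_lt _ h2)).
  have := k1E (l1 (q w), l2 (q w)); have := k2E (l1 (q w), l2 (q w)).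
  rewrite /= E1 E2 /q /= => /(mulfI (invr_neq0 eN0)) F2 /(mulfI (invr_neq0 eN0)) F1.
  have fw := yinj _ _ (esym F1) (esym F2).
  have lin0 (l : R * R -> R) (D' : nat -> {poly {poly R}}) : plim 1 D' l ->
      analytic2_at (fun w => e * l (q w)) w.
    move=> pl; apply: analytic2M; first exact: analytic2_cst.
    apply: analytic2_comp; last 2 first.
    - by apply: analytic2M; [exact: analytic2_cst|exact: y1a].
    - by apply: analytic2M; [exact: analytic2_cst|exact: y2a].
    by apply: (plim_analytic2_in pl); exact: scale_lt.
  have two x : N x < 2 -> N (e * x) < 2 * e.
    by move=> x2; rewrite normrM gtr0_norm// mulrC ltr_pM2r.
  split.
  + by split; [split; [split; exact: two|]|]; rewrite /= fw.
  + exact: (congr1 fst fw).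
  + exact: (congr1 snd fw).
  + exact: lin0 pA.
  + exact: lin0 pB.
Qed.

End InverseFunction.

(** * Power series in one variable and local solutions *)

Section Flow.
Variable R : realType.
Notation P := {poly {poly R}}.
Notation N := (@Num.norm _ R).

Let sN := @seminorm_normr R.

(** Operators that are diagonal on the powers of the first variable; integration and the resolvent
    of an invariant curve are of this kind. *)
Definition scaleX (w : nat -> R) (p : P) : P :=
  \poly_(i < size p) ((w i)%:P * p`_i).

Lemma coef_scaleX w p i : (scaleX w p)`_i = (w i)%:P * p`_i.
Proof.
rewrite coef_poly; case: ltnP => // ip.
by rewrite nth_default// mulr0.
Qed.

Lemma scaleXB w p q : scaleX w p - scaleX w q = scaleX w (p - q).
Proof. by apply/polyP => i; rewrite coefB !coef_scaleX coefB mulrBr. Qed.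

Lemma nrm_scaleX w (C r : R) p : 0 <= r -> (forall i, N (w i) <= C) ->
  nrm N r (scaleX w p) <= C * nrm N r p.
Proof.
move=> r0 wC; rewrite /nrm (pnorm_widen (seminorm_pnorm sN r0) r (size_poly _ _)).
rewrite /pnorm big_distrr /=; apply: ler_sum => i _.
rewrite -/(scaleX w p) coef_scaleX mulrA ler_wpM2r ?exprn_ge0//.
rewrite (le_trans (pnormCM sN _ _ r0))// ler_wpM2r//.
exact: (pnorm_ge0 sN).
Qed.

(** At index 0 the multiplier is 0^-1 = 0, and the coefficient of [p * 'X] is 0 there too. *)
Definition intX (p : P) : P := scaleX (fun i => i%:R^-1) (p * 'X).

Lemma deriv_intX p : deriv (intX p) = p.
Proof.
apply/polyP => i; rewrite coef_deriv coef_scaleX coefMX /= -mulrnAl -polyCMn.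
by rewrite -[_ *+ _]mulr_natl mulfV ?pnatr_eq0// polyC1 mul1r.
Qed.

Lemma coef0_intX p : (intX p)`_0 = 0.
Proof. by rewrite coef_scaleX coefMX mulr0. Qed.

Lemma nrm_intX (r : R) p : 0 <= r -> nrm N r (intX p) <= r * nrm N r p.
Proof.
move=> r0; rewrite /intX (le_trans (nrm_scaleX (C := 1) _ r0 _))//.
  move=> i; rewrite ger0_norm ?invr_ge0 ?ler0n//.
  by case: i => [|i]; rewrite ?invr0 ?ler01// invf_le1 ?ler1n ?ltr0n.
by rewrite mul1r /nrm pnormMX//; exact: seminorm_pnorm.
Qed.

(** The shifted index matches the recursions, which express the derivative of an iterate through the
    preceding iterate. *)
Lemma curve_derive r a (g : R * R -> R) t (l : R) : plim r a g -> N t < r ->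
  (fun n => ev t 0 (deriv (a n.+1))) @ \oo --> l ->
  is_derive t (1 : R) (fun s => g (s, 0)) l.
Proof.
move=> pa tr al; have r0 : N 0 < r by rewrite normr0 (le_lt_trans _ tr).
have [x [y [ax _ gg]]] := @plim_grad _ _ _ _ (t, 0) pa tr r0.
have -> : l = x * 1 + y * 0.
  by rewrite mulr1 mulr0 addr0; apply: cvgn_uniq al _; exact: cvgn_shift ax.
exact: (grad_curve gg).
Qed.

(** Picard iteration for the integral equation. A curve is kept as a germ in two variables read
    along y = 0, so that the calculus of [plim] applies to it. *)
Lemma ode_local_solution (X1 X2 : R * R -> R) q :
  analytic2_at X1 q -> analytic2_at X2 q ->
  exists (e : R) (g1 g2 : R -> R), [/\ 0 < e, (g1 0, g2 0) = q &
    forall t, N t < e -> is_derive t (1 : R) g1 (X1 (g1 t, g2 t)) /\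
      is_derive t (1 : R) g2 (X2 (g1 t, g2 t))].
Proof.
move=> /analytic2_plim[r1 [p1 [r10 pl1]]] /analytic2_plim[r2 [p2 [r20 pl2]]].
pose t := Num.min r1 r2; have t0 : 0 < t by rewrite lt_min r10.
have {}pl1 : plim t p1 (fun v => X1 (q + v)).
  by apply: plim_le pl1; rewrite (ltW t0) ge_min lexx.
have {}pl2 : plim t p2 (fun v => X2 (q + v)).
  by apply: plim_le pl2; rewrite (ltW t0) ge_min lexx orbT.
clearbody t.
have sNt := seminorm_nrm sN (ltW t0).
have [B1 B10 p1B] := cauchyN_bounded sNt pl1.1.
have [B2 B20 p2B] := cauchyN_bounded sNt pl2.1.
have B0 : 0 < B1 + B2 by rewrite addr_gt0.
(* With this e the displacement e (B1 + B2) is t / 8: at most rho = t / 2, and 4 times it is exactly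
   the gap t - t / 2. *)
pose e := t / (8 * (B1 + B2)); have e0 : 0 < e by rewrite divr_gt0// mulr_gt0.
have eB : e * (B1 + B2) = t / 8 by rewrite /e; field; rewrite gt_eqF.
have sNe := seminorm_nrm sN (ltW e0).
have t2t : t / 2 < t by lra.
have [|||||||||||| a [b [ca cb as_ bs [[a0 b0] rec]]]] :=
  @fixpoint2 _ e (t / 2) t e (B1 + B2) (t / 2) p1 p2 (fun p q => intX p)
    (fun p q => intX q) 0 0 (ltW e0) t2t (ltW e0).
- by rewrite divr_ge0// ltW.
- exact: pl1.1.
- exact: pl2.1.
- by move=> n; rewrite lerD.
- by move=> p p' p'' p'''; rewrite /intX scaleXB mulrBl.
- by move=> p p' p'' p'''; rewrite /intX scaleXB mulrBl.
- move=> p p'; rewrite (le_trans (nrm_intX _ (ltW e0)))// ler_wpM2l ?(ltW e0)//.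
  by rewrite lerDl seminorm_ge0.
- move=> p p'; rewrite (le_trans (nrm_intX _ (ltW e0)))// ler_wpM2l ?(ltW e0)//.
  by rewrite lerDr seminorm_ge0.
- by rewrite (seminorm0 sNe) add0r.
- by rewrite (seminorm0 sNe) add0r.
- by rewrite eB; lra.
- by rewrite eB; lra.
have pa := plim_exists ca; have pb := plim_exists cb.
set g1 := (fun v : R * R => _) in pa; set g2 := (fun v : R * R => _) in pb.
have z : N 0 <= e by rewrite normr0 ltW.
have g00 : g1 (0, 0) = 0 /\ g2 (0, 0) = 0.
  split.
    apply: cvgn_uniq (cvgn_shift (pa.2 0 0 z z)) _.
    under eq_fun do rewrite ev00 (rec _).1 add0r coef0_intX coef0; exact: cvg_cst.
  apply: cvgn_uniq (cvgn_shift (pb.2 0 0 z z)) _.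
  under eq_fun do rewrite ev00 (rec _).2 add0r coef0_intX coef0; exact: cvg_cst.
exists e, (fun s => q.1 + g1 (s, 0)), (fun s => q.2 + g2 (s, 0)); split=> //.
  by rewrite g00.1 g00.2 !addr0 -surjective_pairing.
move=> s se.
have av n : N (ev s 0 (a n)) <= t / 2 by exact: le_trans (ev_le _ (ltW se) z) (as_ n).
have bv n : N (ev s 0 (b n)) <= t / 2 by exact: le_trans (ev_le _ (ltW se) z) (bs n).
have h1 := lim_ev pl1 t2t av bv (pa.2 s 0 (ltW se) z) (pb.2 s 0 (ltW se) z).
have h2 := lim_ev pl2 t2t av bv (pa.2 s 0 (ltW se) z) (pb.2 s 0 (ltW se) z).
have shift (g : R -> R) (c l : R) : is_derive s (1 : R) g l ->
    is_derive s (1 : R) (fun s => c + g s) l.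
  by move=> dg; apply: is_derive_eq (add0r _); exact: is_deriveD.
split; apply: shift.
  apply: (curve_derive pa se).
  by under eq_fun do rewrite (rec _).1 add0r deriv_intX ev_comp.
apply: (curve_derive pb se).
by under eq_fun do rewrite (rec _).2 add0r deriv_intX ev_comp.
Qed.

Lemma pcomp_dvdX (a b Q : P) : Q`_0`_0 = 0 ->
  exists Z, pcomp (a * 'X) (b * 'X) Q = Z * 'X.
Proof.
elim/poly_ind : Q => [|Q c _]; first by move=> _; exists 0; rewrite /pcomp ev20 mul0r.
rewrite coefD coefMX coefC /= add0r => c0.
have -> : c = drop_poly 1 c * 'X.
  by apply/polyP => -[|i]; rewrite coefMX ?coef_drop_poly ?addn1.
exists (pcomp (a * 'X) (b * 'X) Q * a + pcomp (a * 'X) (b * 'X) (drop_poly 1 c)%:P * b).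
rewrite /pcomp polyCM ev2D !ev2M ev2X ev2Y; ring.
Qed.

(** Along a curve through the origin, a nonlinearity of order 2 starts at degree 2 in the parameter,
    which is where the resolvent of the linear part becomes available. *)
Lemma pcomp_dvdX2 (a b Q : P) : Q`_0`_0 = 0 -> Q`_1`_0 = 0 -> Q`_0`_1 = 0 ->
  exists Z, pcomp (a * 'X) (b * 'X) Q = Z * 'X^2.
Proof.
elim/poly_ind : Q => [|Q c _].
  by move=> _ _ _; exists 0; rewrite /pcomp ev20 mul0r.
rewrite !coefD !coefMX !coefC /= !add0r addr0 => c0 Q0 c1.
have cE : c = drop_poly 1 c * 'X.
  by apply/polyP => -[|i]; rewrite coefMX ?coef_drop_poly ?addn1.
have [Z1 E1] := pcomp_dvdX a b Q0.
have d0 : ((drop_poly 1 c)%:P : P)`_0`_0 = 0 by rewrite coefC /= coef_drop_poly.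
have [Z2 E2] := pcomp_dvdX a b d0.
exists (Z1 * a + Z2 * b); rewrite cE /pcomp polyCM ev2D !ev2M ev2X ev2Y.
rewrite -!/(pcomp _ _ _) E1 E2; ring.
Qed.

End Flow.

(** * The eigenvalues of a center are not real *)

Section InvariantCurve.
Variable R : realType.
Notation P := {poly {poly R}}.
Notation N := (@Num.norm _ R).

Let sN := @seminorm_normr R.

Lemma analytic2_remainder (f : R * R -> R) (a b : R) : analytic2_at f (0, 0) ->
  f (0, 0) = 0 -> grad f (0, 0) a b ->
  let g := fun v : R * R => f v - (a * v.1 + b * v.2) in
  [/\ analytic2_at g (0, 0), g (0, 0) = 0 & grad g (0, 0) 0 0].
Proof.
move=> fa f0 fg g; split.
- apply: analytic2B => //; apply: analytic2_lin.
    exact: analytic2_fst.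
  exact: analytic2_snd.
- by rewrite /g f0 !mulr0 addr0 subrr.
- have h1 := gradM (grad_cst (- a) (0, 0)) (grad_fst (0, 0)).
  have h2 := gradM (grad_cst (- b) (0, 0)) (grad_snd (0, 0)).
  have := gradD fg (gradD h1 h2); rewrite !mul0r !mulr0 !mulr1 !addr0 add0r !subrr.
  by congr (grad _ _ _ _); apply/funext => v; rewrite /g opprD !mulNr.
Qed.

Lemma grad0_diff (m : R * R -> R) : grad m (0, 0) 0 0 ->
  'd m (0, 0) (1, 0) = 0 /\ 'd m (0, 0) (0, 1) = 0.
Proof. by move=> [_ E]; rewrite !E !mul0r addr0. Qed.

(** One sequence of polynomials serves all radii t <= r, so that t can be chosen after B is
    known. *)
Lemma small_plim_order2 (f : R * R -> R) : analytic2_at f (0, 0) -> f (0, 0) = 0 ->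
  grad f (0, 0) 0 0 ->
  exists (r B : R) (q : nat -> P), [/\ 0 < r, 0 < B,
    forall t, 0 < t <= r -> plim t q f /\ forall n, nrm N t (q n) <= (t / r) ^+ 2 * B &
    forall n, [/\ (q n)`_0`_0 = 0, (q n)`_1`_0 = 0 & (q n)`_0`_1 = 0]].
Proof.
move=> /analytic2_plim[r [p [r0 pf]]] f0 /grad0_diff[f1 f2].
have fE : (fun v => f ((0, 0) + v)) = f by apply/funext => v; rewrite add0r.
rewrite fE in pf.
have [q [qf q0 q1 q2]] := kill_linear r0 pf f0 f1 f2.
have [B B0 qB] := cauchyN_bounded (seminorm_nrm sN (ltW r0)) qf.1.
exists r, B, q; split=> // t /andP[t0 tr].
split; first by apply: plim_le qf; rewrite (ltW t0).
move=> n; have tE : t = t / r * r by rewrite divfK// gt_eqF.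
rewrite {1}tE (le_trans (nrm_scale1 sN (ltW r0) _ (q0 n) (q1 n) (q2 n)))//.
  by rewrite divr_ge0 ?(ltW r0) ?(ltW t0)//= ler_pdivrMr// mul1r.
by rewrite ler_wpM2l// exprn_ge0// divr_ge0// ltW.
Qed.

(* For the matrix M = [[a, b], [c, d]] with eigenvalue nu, this is the operator
   (k nu - M)^-1 on the coefficient of index k >= 2; it exists because nu is an
   eigenvalue of M of largest modulus. *)
Section Resolvent.
Variables (a b c d nu : R).
Hypotheses (nu0 : nu != 0) (chi : (nu - a) * (nu - d) = b * c).
Hypothesis dom : N (a + d - nu) <= N nu.

Let D (k : nat) : R := (k%:R * nu - a) * (k%:R * nu - d) - b * c.

(** [D k] is the characteristic polynomial at k nu, factored by means of its two roots nu and a + d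
    - nu. *)
Let DE k : D k.+1 = k%:R * nu * (k.+1%:R * nu - (a + d - nu)).
Proof. by rewrite /D -chi -natr1; ring. Qed.

(** The second factor is at least (k + 1) |nu| - |a + d - nu| >= k |nu|: the dominance of nu keeps
    multiples k nu with k >= 2 away from the spectrum. *)
Let D_ge k : k%:R ^+ 2 * N nu ^+ 2 <= N (D k.+1).
Proof.
rewrite DE !normrM ger0_norm ?ler0n//.
have -> : k%:R ^+ 2 * N nu ^+ 2 = k%:R * N nu * (k%:R * N nu) by ring.
rewrite ler_wpM2l ?mulr_ge0 ?ler0n//.
apply: le_trans (lerB_dist _ _).
rewrite normrM ger0_norm ?ler0n// -natr1; move: dom; lra.
Qed.

(** The entries of the adjugate grow linearly in k and the determinant quadratically; the factor 2
    comes from k + 2 <= 2 (k + 1)^2. *)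
Let C : R := 2 * (N nu + N a + N b + N c + N d) / N nu ^+ 2.

Let nu_gt0 : 0 < N nu. Proof. by rewrite normr_gt0. Qed.

Let D_neq0 k : D k.+2 != 0.
Proof.
rewrite -normr_gt0 (lt_le_trans _ (D_ge _))// mulr_gt0// exprn_gt0// ltr0n.
Qed.

Let C_ge0 : 0 <= C.
Proof. by rewrite divr_ge0 ?exprn_ge0// mulr_ge0// !addr_ge0. Qed.

Let quot_le k (x : R) : N x <= k.+2%:R * (N nu + N a + N b + N c + N d) ->
  N (x / D k.+2) <= C.
Proof.
move=> xle; set S := N nu + _ + _ + _ + _ in xle.
have S0 : 0 <= S by rewrite !addr_ge0.
rewrite normrM normfV ler_pdivrMr; last by rewrite normr_gt0.
rewrite (le_trans xle)//.
apply: (@le_trans _ _ (C * (k.+1%:R ^+ 2 * N nu ^+ 2))); last first.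
  by rewrite ler_wpM2l.
have -> : C * (k.+1%:R ^+ 2 * N nu ^+ 2) = 2 * S * k.+1%:R ^+ 2.
  by rewrite /C -/S; field; rewrite gt_eqF.
have -> : 2 * S * k.+1%:R ^+ 2 = (2 * k.+1%:R ^+ 2) * S by ring.
rewrite ler_wpM2r//.
have k1 : 1 <= k.+1%:R :> R by rewrite ler1n.
have -> : k.+2%:R = k.+1%:R + 1 :> R by rewrite natr1.
nra.
Qed.

(** The cut below degree 2 avoids k = 1, where k nu - M is singular. *)
Definition weight (x : nat -> R) (k : nat) : R :=
  if (k < 2)%N then 0 else x k / D k.

Let weight_le (x : nat -> R) k :
  (forall k, N (x k.+2) <= k.+2%:R * (N nu + N a + N b + N c + N d)) ->
  N (weight x k) <= C.
Proof.
move=> xle; rewrite /weight; case: k => [|[|k]] /=; rewrite ?normr0//.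
exact: quot_le.
Qed.

Let S0 : 0 <= N nu + N a + N b + N c + N d. Proof. by rewrite !addr_ge0. Qed.

Let cst_le (y : R) (k : nat) : N y <= N nu + N a + N b + N c + N d ->
  N y <= k.+2%:R * (N nu + N a + N b + N c + N d).
Proof.
by move=> h; rewrite (le_trans h)// ler_peMl// ler1n.
Qed.

Let lin_le (y : R) (k : nat) : N nu + N y <= N nu + N a + N b + N c + N d ->
  N (k.+2%:R * nu - y) <= k.+2%:R * (N nu + N a + N b + N c + N d).
Proof.
move=> h; apply: (le_trans (ler_normB _ _)).
rewrite normrM ger0_norm ?ler0n//.
have k1 : 1 <= k.+2%:R :> R by rewrite ler1n.
have y0 := normr_ge0 y.
apply: (@le_trans _ _ (k.+2%:R * (N nu + N y))); last by rewrite ler_wpM2l ?ler0n.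
by rewrite mulrDr lerD2l ler_peMl.
Qed.

Let w11 k : N (weight (fun k => k%:R * nu - d) k) <= C.
Proof.
apply: weight_le => j; apply: lin_le.
have := normr_ge0 a; have := normr_ge0 b; have := normr_ge0 c; lra.
Qed.
Let w22 k : N (weight (fun k => k%:R * nu - a) k) <= C.
Proof.
apply: weight_le => j; apply: lin_le.
have := normr_ge0 d; have := normr_ge0 b; have := normr_ge0 c; lra.
Qed.
Let w12 k : N (weight (fun=> b) k) <= C.
Proof.
apply: weight_le => j; apply: cst_le.
have := normr_ge0 d; have := normr_ge0 a; have := normr_ge0 c.
have := normr_ge0 nu; lra.
Qed.
Let w21 k : N (weight (fun=> c) k) <= C.
Proof.
apply: weight_le => j; apply: cst_le.
have := normr_ge0 d; have := normr_ge0 a; have := normr_ge0 b.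
have := normr_ge0 nu; lra.
Qed.

(** [res1] and [res2] are the rows of the adjugate of k nu - M divided by its determinant [D k]. *)
Definition res1 (p q : P) : P :=
  scaleX (weight (fun k => k%:R * nu - d)) p + scaleX (weight (fun=> b)) q.
Definition res2 (p q : P) : P :=
  scaleX (weight (fun=> c)) p + scaleX (weight (fun k => k%:R * nu - a)) q.

Let nrm_res1 r p q : 0 <= r -> nrm N r (res1 p q) <= C * (nrm N r p + nrm N r q).
Proof.
move=> r0; rewrite (le_trans (seminormD (seminorm_nrm sN r0) _ _))// mulrDr.
by rewrite lerD// nrm_scaleX.
Qed.
Let nrm_res2 r p q : 0 <= r -> nrm N r (res2 p q) <= C * (nrm N r p + nrm N r q).
Proof.
move=> r0; rewrite (le_trans (seminormD (seminorm_nrm sN r0) _ _))// mulrDr.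
by rewrite lerD// nrm_scaleX.
Qed.

Let coef_res (p q : P) k : (k < 2)%N -> (res1 p q)`_k = 0 /\ (res2 p q)`_k = 0.
Proof.
by move=> k2; rewrite !coefD !coef_scaleX /weight k2 !mul0r addr0.
Qed.

(** The operator nu t d/dt multiplies degree k by k nu, so from degree 2 on the equation is inverted
    by the resolvent; in degree 1 the eigenvector equation takes its place. *)
Let resE (p q : P) (v1 v2 : R) :
  a * v1 + b * v2 = nu * v1 -> c * v1 + d * v2 = nu * v2 ->
  (forall k, (k < 2)%N -> p`_k = 0 /\ q`_k = 0) ->
  let g1 := v1%:P%:P * 'X + res1 p q in let g2 := v2%:P%:P * 'X + res2 p q in
  nu%:P%:P * ('X * deriv g1) = a%:P%:P * g1 + b%:P%:P * g2 + p /\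
  nu%:P%:P * ('X * deriv g2) = c%:P%:P * g1 + d%:P%:P * g2 + q.
Proof.
move=> e1 e2 pq g1 g2.
have coefg k : g1`_k = (if k == 1%N then v1%:P else 0) + (res1 p q)`_k /\
    g2`_k = (if k == 1%N then v2%:P else 0) + (res2 p q)`_k.
  by rewrite !coefD !mul_polyC !coefZ !coefX; case: eqP; rewrite ?mulr1 ?mulr0.
clearbody g1 g2.
have coefl (x : R) (g : P) k : (x%:P%:P * ('X * deriv g))`_k = (x * k%:R)%:P * g`_k.
  rewrite coefCM mulrC [_ * g`_k]mulrC coefXM; case: k => [|k] /=.
    by rewrite mul0r mulr0 mulr0.
  by rewrite coef_deriv polyCM (mulrC x%:P) mulrA rmorph_nat mulr_natr.
split; apply/polyP => k; rewrite coefl !coefD !coefCM (coefg k).1 ?(coefg k).2.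
  case: k => [|[|k]].
  - have [-> _] := pq 0%N isT; have [-> ->] := coef_res p q (isT : (0 < 2)%N).
    by rewrite /= !addr0 !mulr0 addr0.
  - have [-> _] := pq 1%N isT; have [-> ->] := coef_res p q (isT : (1 < 2)%N).
    by rewrite /= !addr0 mulr1 -!polyCM -polyCD e1.
  - rewrite /= !add0r !coefD !coef_scaleX /weight /=; have Dk := D_neq0 k.
    set K := k.+2 in Dk *; set x := p`_K; set y := q`_K.
    have E1 : nu * K%:R * ((K%:R * nu - d) / D K) =
        a * ((K%:R * nu - d) / D K) + b * (c / D K) + 1.
      by rewrite /D in Dk *; field.
    have E2 : nu * K%:R * (b / D K) = a * (b / D K) + b * ((K%:R * nu - a) / D K).
      by field.
    transitivity ((nu * K%:R * ((K%:R * nu - d) / D K))%:P * x + (nu * K%:R * (b / D K))%:P * y).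
      by rewrite !polyCM; ring.
    by rewrite E1 E2 !polyCD !polyCM polyC1; ring.
case: k => [|[|k]].
- have [_ ->] := pq 0%N isT; have [-> ->] := coef_res p q (isT : (0 < 2)%N).
  by rewrite /= !addr0 !mulr0 addr0.
- have [_ ->] := pq 1%N isT; have [-> ->] := coef_res p q (isT : (1 < 2)%N).
  by rewrite /= !addr0 mulr1 -!polyCM -polyCD e2.
- rewrite /= !add0r !coefD !coef_scaleX /weight /=; have Dk := D_neq0 k.
  set K := k.+2 in Dk *; set x := p`_K; set y := q`_K.
  have E1 : nu * K%:R * (c / D K) = c * ((K%:R * nu - d) / D K) + d * (c / D K).
    by field.
  have E2 : nu * K%:R * ((K%:R * nu - a) / D K) =
      c * (b / D K) + d * ((K%:R * nu - a) / D K) + 1.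
    by rewrite /D in Dk *; field.
  transitivity ((nu * K%:R * (c / D K))%:P * x + (nu * K%:R * ((K%:R * nu - a) / D K))%:P * y).
    by rewrite !polyCM; ring.
  by rewrite E1 E2 !polyCD !polyCM polyC1; ring.
Qed.

(* Briot-Bouquet: an eigenvector is tangent to an analytic invariant curve. *)
Lemma invariant_curve (X1 X2 : R * R -> R) (v1 v2 : R) :
  analytic2_at X1 (0, 0) -> analytic2_at X2 (0, 0) ->
  X1 (0, 0) = 0 -> X2 (0, 0) = 0 ->
  grad X1 (0, 0) a b -> grad X2 (0, 0) c d ->
  a * v1 + b * v2 = nu * v1 -> c * v1 + d * v2 = nu * v2 ->
  N v1 <= 1 -> N v2 <= 1 ->
  exists (e : R) (g1 g2 : R -> R), [/\ 0 < e, (g1 0, g2 0) = (0, 0),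
    is_derive (0 : R) (1 : R) g1 v1 /\ is_derive (0 : R) (1 : R) g2 v2 &
    forall t, N t < e -> exists d1 d2 : R,
      [/\ is_derive t (1 : R) g1 d1, is_derive t (1 : R) g2 d2,
        nu * (t * d1) = X1 (g1 t, g2 t) & nu * (t * d2) = X2 (g1 t, g2 t)]].
Proof.
move=> an1 an2 X10 X20 gr1 gr2 ev1 ev2 v1le v2le.
have [a1 z1 G1] := analytic2_remainder an1 X10 gr1.
have [a2 z2 G2] := analytic2_remainder an2 X20 gr2.
set F1 := (fun v => _) in a1 z1 G1; set F2 := (fun v => _) in a2 z2 G2.
have [r1 [B1 [q1 [r10 B10 q1P q1z]]]] := small_plim_order2 a1 z1 G1.
have [r2 [B2 [q2 [r20 B20 q2P q2z]]]] := small_plim_order2 a2 z2 G2.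
pose B := B1 / r1 ^+ 2 + B2 / r2 ^+ 2.
have B0 : 0 < B by rewrite addr_gt0// divr_gt0// exprn_gt0.
(* The first two bounds keep the radius 4 e of the nonlinearity within r1 and r2. The third makes C
   (16 e^2 B) at most e / 2, which meets both conditions of [fixpoint2] for rho = e and the gap 4 e
   - 2 e. *)
pose e := Num.min (Num.min (r1 / 4) (r2 / 4)) (1 / (32 * (C * B + 1))).
have CB0 : 0 <= C * B by rewrite mulr_ge0// ltW.
have CB1 : 0 < 32 * (C * B + 1) by rewrite mulr_gt0// ltr_wpDl.
have e0 : 0 < e by rewrite !lt_min !divr_gt0.
have er1 : 4 * e <= r1.
  have : e <= r1 / 4 by rewrite /e !ge_min lexx.
  by rewrite ler_pdivlMr// mulrC.
have er2 : 4 * e <= r2.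
  have : e <= r2 / 4 by rewrite /e !ge_min lexx orbT.
  by rewrite ler_pdivlMr// mulrC.
have eC : e * (32 * (C * B + 1)) <= 1.
  have : e <= 1 / (32 * (C * B + 1)) by rewrite /e !ge_min lexx !orbT.
  by rewrite ler_pdivlMr.
clearbody e; have e40 : 0 < 4 * e by rewrite mulr_gt0.
have [|pl1 b1] := q1P (4 * e); first by rewrite e40.
have [|pl2 b2] := q2P (4 * e); first by rewrite e40.
have N1 : N 1 <= 1 by rewrite normr1.
have sNe := seminorm_nrm sN (ltW e0).
have sum_le n : nrm N (4 * e) (q1 n) + nrm N (4 * e) (q2 n) <= 16 * e ^+ 2 * B.
  apply: (le_trans (lerD (b1 n) (b2 n))).
  by rewrite le_eqVlt; apply/orP; left; apply/eqP; rewrite /B; field; rewrite !gt_eqF.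
have CBe : C * (16 * e ^+ 2 * B) <= e / 2.
  have -> : C * (16 * e ^+ 2 * B) = (e * (32 * (C * B))) * (e / 2) by field.
  rewrite -[leRHS]mul1r ler_wpM2r ?divr_ge0 ?(ltW e0)// (le_trans _ eC)//.
  by rewrite ler_wpM2l ?(ltW e0)// ler_wpM2l// lerDl.
have [|||||||||||| g1 [g2 [c1 c2 s1 s2 [[i1 i2] rec]]]] :=
  @fixpoint2 _ e (2 * e) (4 * e) C (16 * e ^+ 2 * B) e q1 q2 res1 res2
    (v1%:P%:P * 'X) (v2%:P%:P * 'X) (ltW e0) _ C_ge0 (ltW e0).
- by rewrite ltr_pM2r// ltr_nat.
- exact: pl1.1.
- exact: pl2.1.
- exact: sum_le.
- by move=> p q p' q'; rewrite /res1 opprD addrACA !scaleXB.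
- by move=> p q p' q'; rewrite /res2 opprD addrACA !scaleXB.
- by move=> p q; apply: nrm_res1; exact: ltW.
- by move=> p q; apply: nrm_res2; exact: ltW.
- have h : nrm N e (v1%:P%:P : P) <= 1 by rewrite nrmCC// ltW.
  have := seminormMle sNe h (nrmX sN N1 (ltW e0)); lra.
- have h : nrm N e (v2%:P%:P : P) <= 1 by rewrite nrmCC// ltW.
  have := seminormMle sNe h (nrmX sN N1 (ltW e0)); lra.
- by rewrite (le_trans CBe)// ler_pdivrMr// ler_peMr ?(ltW e0)// ler1n.
- by move: CBe e0; move: (C * _) => z; lra.
have pg1 := plim_exists c1; have pg2 := plim_exists c2.
set h1 := (fun v : R * R => _) in pg1; set h2 := (fun v : R * R => _) in pg2.
have divX n : exists u1 u2, g1 n = u1 * 'X /\ g2 n = u2 * 'X.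
  have dv (p : P) : p`_0 = 0 -> exists u, p = u * 'X.
    elim/poly_ind: p => [|p k _]; first by exists 0; rewrite mul0r.
    by rewrite coefD coefMX coefC /= add0r => ->; exists p; rewrite addr0.
  have [z1' z2'] : (g1 n)`_0 = 0 /\ (g2 n)`_0 = 0.
    case: n => [|n]; first by rewrite i1 i2 !coefMX.
    have [r1z r2z] := coef_res (pcomp (g1 n) (g2 n) (q1 n)) (pcomp (g1 n) (g2 n) (q2 n))
      (isT : (0 < 2)%N).
    split; first by rewrite (rec n).1 coefD r1z coefMX addr0.
    by rewrite (rec n).2 coefD r2z coefMX addr0.
  have [u1 E1] := dv _ z1'; have [u2 E2] := dv _ z2'.
  by exists u1, u2.
have low n k : (k < 2)%N -> (pcomp (g1 n) (g2 n) (q1 n))`_k = 0 /\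
    (pcomp (g1 n) (g2 n) (q2 n))`_k = 0.
  move=> k2; have [u1 [u2 [-> ->]]] := divX n.
  have [x1 x2 x3] := q1z n; have [y1 y2 y3] := q2z n.
  have [Z1 ->] := pcomp_dvdX2 u1 u2 x1 x2 x3.
  have [Z2 ->] := pcomp_dvdX2 u1 u2 y1 y2 y3.
  by rewrite !coefMXn k2.
have z : N 0 <= e by rewrite normr0 ltW.
have z' : N 0 < e by rewrite normr0.
have h00 : h1 (0, 0) = 0 /\ h2 (0, 0) = 0.
  split.
    apply: cvgn_uniq (pg1.2 0 0 z z) _.
    have E n : ev 0 0 (g1 n) = 0.
      by have [u1 [u2 [-> _]]] := divX n; rewrite evM evX mulr0.
    by under eq_fun do rewrite E; exact: cvg_cst.
  apply: cvgn_uniq (pg2.2 0 0 z z) _.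
  have E n : ev 0 0 (g2 n) = 0.
    by have [u1 [u2 [_ ->]]] := divX n; rewrite evM evX mulr0.
  by under eq_fun do rewrite E; exact: cvg_cst.
have coef1 n : (g1 n.+1)`_1 = v1%:P /\ (g2 n.+1)`_1 = v2%:P.
  have [r1z r2z] := coef_res (pcomp (g1 n) (g2 n) (q1 n)) (pcomp (g1 n) (g2 n) (q2 n))
    (isT : (1 < 2)%N).
  split; first by rewrite (rec n).1 coefD r1z addr0 mul_polyC coefZ coefX mulr1.
  by rewrite (rec n).2 coefD r2z addr0 mul_polyC coefZ coefX mulr1.
exists e, (fun s => h1 (s, 0)), (fun s => h2 (s, 0)); split=> //.
- by rewrite h00.1 h00.2.
- split.
    apply: (curve_derive pg1 z').
    under eq_fun do rewrite ev00 coef_deriv mulr1n (coef1 _).1 coefC /=.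
    exact: cvg_cst.
  apply: (curve_derive pg2 z').
  under eq_fun do rewrite ev00 coef_deriv mulr1n (coef1 _).2 coefC /=.
  exact: cvg_cst.
move=> t te.
have [d1 [y1 [cd1 _ gd1]]] := @plim_grad _ _ _ _ (t, 0) pg1 te z'.
have [d2 [y2 [cd2 _ gd2]]] := @plim_grad _ _ _ _ (t, 0) pg2 te z'.
exists d1, d2.
have lt24 : 2 * e < 4 * e by rewrite ltr_pM2r// ltr_nat.
have av n : N (ev t 0 (g1 n)) <= 2 * e by exact: le_trans (ev_le _ (ltW te) z) (s1 n).
have bv n : N (ev t 0 (g2 n)) <= 2 * e by exact: le_trans (ev_le _ (ltW te) z) (s2 n).
have cg1 := pg1.2 t 0 (ltW te) z; have cg2 := pg2.2 t 0 (ltW te) z.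
have L1 := lim_ev pl1 lt24 av bv cg1 cg2.
have L2 := lim_ev pl2 lt24 av bv cg1 cg2.
have resn n := resE ev1 ev2 (low n).
split.
- exact: (curve_derive pg1 te (cvgn_shift cd1)).
- exact: (curve_derive pg2 te (cvgn_shift cd2)).
- have -> : X1 (h1 (t, 0), h2 (t, 0)) =
      a * h1 (t, 0) + b * h2 (t, 0) + F1 (h1 (t, 0), h2 (t, 0)).
    by rewrite /F1 /= addrC subrK.
  apply: (@cvgn_uniq _ (fun n => nu * (t * ev t 0 (deriv (g1 n.+1))))).
    by do 2 apply: cvgMr; exact: cvgn_shift cd1.
  have E n : nu * (t * ev t 0 (deriv (g1 n.+1))) =
      a * ev t 0 (g1 n.+1) + b * ev t 0 (g2 n.+1) + ev (ev t 0 (g1 n)) (ev t 0 (g2 n)) (q1 n).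
    have := congr1 (ev t 0) (resn n).1.
    by rewrite -(rec n).1 -(rec n).2 evZ evM evX !evD !evZ ev_comp.
  under eq_fun do rewrite E.
  by apply: cvgD => //; apply: cvgD; apply: cvgMr; exact: (@cvgn_shift _ (fun n => ev t 0 _)).
- have -> : X2 (h1 (t, 0), h2 (t, 0)) =
      c * h1 (t, 0) + d * h2 (t, 0) + F2 (h1 (t, 0), h2 (t, 0)).
    by rewrite /F2 /= addrC subrK.
  apply: (@cvgn_uniq _ (fun n => nu * (t * ev t 0 (deriv (g2 n.+1))))).
    by do 2 apply: cvgMr; exact: cvgn_shift cd2.
  have E n : nu * (t * ev t 0 (deriv (g2 n.+1))) =
      c * ev t 0 (g1 n.+1) + d * ev t 0 (g2 n.+1) + ev (ev t 0 (g1 n)) (ev t 0 (g2 n)) (q2 n).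
    have := congr1 (ev t 0) (resn n).2.
    by rewrite -(rec n).1 -(rec n).2 evZ evM evX !evD !evZ ev_comp.
  under eq_fun do rewrite E.
  by apply: cvgD => //; apply: cvgD; apply: cvgMr; exact: (@cvgn_shift _ (fun n => ev t 0 _)).
Qed.

End Resolvent.
End InvariantCurve.

Section RealEigenvalues.
Variable R : realType.
Notation N := (@Num.norm _ R).

Lemma periodic_nat (d : R -> R * R) (T : R) : (forall t, d (t + T) = d t) ->
  forall (n : nat) t, d (t + n%:R * T) = d t /\ d (t - n%:R * T) = d t.
Proof.
move=> dT; elim=> [|n IH] t; first by rewrite mul0r subr0 addr0.
split; first by rewrite -natr1 mulrDl mul1r addrA dT (IH t).1.
rewrite -(dT (t - _)) -natr1 mulrDl mul1r opprD addrA subrK; exact: (IH t).2.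
Qed.

Lemma derive_continuous1 (g : R -> R) (t d e : R) : is_derive t (1 : R) g d -> 0 < e ->
  exists2 r : R, 0 < r & forall s, N (s - t) < r -> N (g s - g t) < e.
Proof.
move=> [h _] e0.
have cg := differentiable_continuous ((derivable1_diffP _ _).1 h).
have /cvgrPdist_lt/(_ e e0)/nbhs_ballP[r /= r0 rP] := cg.
by exists r => // s sr; rewrite distrC; apply: rP; rewrite /ball /= distrC.
Qed.

Lemma derive_nonzero (g : R -> R) (t d r : R) : is_derive t (1 : R) g d -> d != 0 ->
  g t = 0 -> 0 < r -> exists s, [/\ s != t, N (s - t) < r & g s != 0].
Proof.
move=> [gd gE] d0 gt0 r0; apply: contrapT => H.
have : \forall s \near t, g s = cst 0 s.
  apply/nbhs_ballP; exists r => // s; rewrite /ball /= distrC => sr.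
  have [->//|st] := eqVneq s t.
  by apply: contrapT => /eqP gs; apply: H; exists s.
move=> /(near_eq_derive (1 : R)) E; move: gE; rewrite E derive_cst => d0'.
by rewrite -d0' eqxx in d0.
Qed.

Lemma real_eigenvector (a b c d : R) : a * d - b * c != 0 ->
  0 <= (a - d) ^+ 2 + 4 * (b * c) ->
  exists nu v1 v2 : R, [/\ nu != 0, (nu - a) * (nu - d) = b * c,
    N (a + d - nu) <= N nu,
    a * v1 + b * v2 = nu * v1 /\ c * v1 + d * v2 = nu * v2 &
    [/\ N v1 <= 1, N v2 <= 1 & v1 != 0 \/ v2 != 0]].
Proof.
move=> det0 disc0; set D := _ + _ in disc0; pose s := Num.sqrt D.
have ss : s * s = D by rewrite -expr2 sqr_sqrtr.
have s0 : 0 <= s by exact: sqrtr_ge0.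
have [nu [nu_chi nu_dom]] : exists nu : R, (nu - a) * (nu - d) = b * c /\
    N (a + d - nu) <= N nu.
  (* The sign of the trace decides which root has the larger modulus. *)
  have [tr0|tr0] := leP 0 (a + d).
    exists ((a + d + s) / 2); split.
      have -> : ((a + d + s) / 2 - a) * ((a + d + s) / 2 - d) =
        (s * s - (a - d) ^+ 2) / 4 by field.
      by rewrite ss /D; field.
    have -> : a + d - (a + d + s) / 2 = (a + d - s) / 2 by field.
    rewrite [leRHS]ger0_norm; last by lra.
    rewrite ler_norml; lra.
  exists ((a + d - s) / 2); split.
    have -> : ((a + d - s) / 2 - a) * ((a + d - s) / 2 - d) =
      (s * s - (a - d) ^+ 2) / 4 by field.
    by rewrite ss /D; field.
  have -> : a + d - (a + d - s) / 2 = (a + d + s) / 2 by field.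
  rewrite [leRHS]ler0_norm; last by lra.
  rewrite ler_norml; lra.
have nu0 : nu != 0.
  apply: contraNneq det0 => z; move: nu_chi; rewrite z !sub0r => E.
  by have -> : a * d = - a * - d by [ring]; rewrite E subrr.
have [v1 [v2 [e1 e2 v0]]] : exists v1 v2 : R, [/\ a * v1 + b * v2 = nu * v1,
    c * v1 + d * v2 = nu * v2 & v1 != 0 \/ v2 != 0].
  (* (nu - d, c) satisfies the eigenvector equations and may only fail to be non-zero. In the
     remaining case c = 0, nu = d the matrix is triangular and an eigenvector is written down. *)
  have [c0|c0] := eqVneq c 0; last first.
    by exists (nu - d), c; split; [rewrite -nu_chi; ring|ring|right].
  have [nud|nud] := eqVneq nu d; last first.
    exists (nu - d), c; split; [rewrite -nu_chi; ring|ring|left].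
    by rewrite subr_eq0.
  have [b0|b0] := eqVneq b 0; last first.
    by exists b, (nu - a); split; [ring|rewrite c0 nud; ring|left].
  have [ad|ad] := eqVneq a d.
    by exists 1, 0; rewrite c0 b0 ad nud oner_eq0; split; [ring|ring|left].
  exists 0, 1; rewrite c0 b0 nud oner_eq0; split; [ring|ring|by right].
exists nu; pose k := (1 + N v1 + N v2)^-1.
have k0 : 0 < 1 + N v1 + N v2 by rewrite ltr_wpDr// ltr_wpDr.
have kn : N k = k by rewrite ger0_norm// invr_ge0 ltW.
exists (k * v1), (k * v2); split=> //.
  by rewrite !(mulrCA _ k) -!mulrDr e1 e2.
rewrite !normrM kn; split.
- by rewrite ler_pdivrMl// mulr1 -addrA addrCA lerDl addr_ge0.
- by rewrite ler_pdivrMl// mulr1 lerDr addr_ge0.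
- by rewrite !mulf_eq0 !negb_or invr_eq0 gt_eqF//=.
Qed.

(* Otherwise the invariant curve (h1, h2) of a real eigenvalue nu carries the
   solution (h1, h2) (x0 exp (nu t)), which is periodic and tends to (0, 0). *)
Lemma center_negative_discriminant (Omega : set (R * R)) (X : R * R -> R * R)
    (a b c d : R) : analytic2_at (fun q => (X q).1) (0, 0) ->
  analytic2_at (fun q => (X q).2) (0, 0) -> is_center Omega X (0, 0) ->
  grad (fun q => (X q).1) (0, 0) a b -> grad (fun q => (X q).2) (0, 0) c d ->
  a * d - b * c != 0 -> (a - d) ^+ 2 + 4 * (b * c) < 0.
Proof.
move=> an1 an2 [X0 [U [oU U0 UO cU]]] g1 g2 det0; rewrite ltNge; apply/negP => disc0.
have [nu [v1 [v2 [nu0 chi dom [e1 e2] [v1le v2le v0]]]]] := real_eigenvector det0 disc0.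
have X10 : (X (0, 0)).1 = 0 by rewrite X0.
have X20 : (X (0, 0)).2 = 0 by rewrite X0.
have [e [h1 [h2 [e0 [h10 h20] [dh1 dh2] hP]]]] :=
  invariant_curve nu0 chi dom an1 an2 X10 X20 g1 g2 e1 e2 v1le v2le.
have [r r0 rU] := open_box oU U0.
have small (h : R -> R) (v q : R) : is_derive (0 : R) (1 : R) h v -> h 0 = 0 -> 0 < q ->
    exists2 s : R, 0 < s & forall t, N t < s -> N (h t) < q.
  move=> dh hz q0; have [s s0 sP] := derive_continuous1 dh q0.
  by exists s => // t ts; have := sP t; rewrite hz !subr0; exact.
have [s1 s10 s1P] := small _ _ _ dh1 h10 r0.
have [s2 s20 s2P] := small _ _ _ dh2 h20 r0.
pose del := Num.min e (Num.min s1 s2).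
have del0 : 0 < del by rewrite !lt_min e0 s10.
have inU t : N t < del -> U (h1 t, h2 t).
  rewrite !lt_min => /and3P[_ t1 t2]; apply: rU => /=; rewrite subr0.
    exact: s1P.
  exact: s2P.
have dele : del <= e by rewrite ge_min lexx.
clearbody del.
have [x0 [x0n0 x0d hx0]] : exists x : R, [/\ x != 0, N x < del & (h1 x, h2 x) <> (0, 0)].
  case: v0 => v0.
    have [x [x1 x2 x3]] := derive_nonzero dh1 v0 h10 del0.
    exists x; split=> //; first by rewrite -(subr0 x).
    by move=> [E _]; rewrite E eqxx in x3.
  have [x [x1 x2 x3]] := derive_nonzero dh2 v0 h20 del0.
  exists x; split=> //; first by rewrite -(subr0 x).
  by move=> [_ E]; rewrite E eqxx in x3.
pose u (t : R) : R := x0 * expR (nu * t).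
have uN t : N (u t) = N x0 * expR (nu * t) by rewrite normrM [N (expR _)]ger0_norm ?expR_ge0.
have du t : is_derive t (1 : R) u (nu * u t).
  have h : is_derive t (1 : R) (fun t => nu * t) nu.
    by have := @is_deriveZ _ _ _ id nu t 1 1 (is_derive_id _ _); rewrite /GRing.scale /= mulr1.
  have := is_derive1_comp (is_derive_expR (nu * t)) h.
  move=> /(@is_deriveZ _ _ _ _ x0) k.
  by apply: is_derive_eq k _; rewrite /u /GRing.scale /=; ring.
(* As |u| is monotone, I is an interval, and it is unbounded in the direction of time in which u
   tends to 0. On I the curve is a solution that stays in U. *)
pose I := [set t : R | N (u t) < del].
pose G (t : R) := (h1 (u t), h2 (u t)).
have I0 : I 0 by rewrite /I /= /u mulr0 expR0 mulr1.
have G0 : G 0 = (h1 x0, h2 x0) by rewrite /G /u mulr0 expR0 mulr1.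
have oI : open I.
  have -> : I = (fun t => N (u t)) @^-1` [set x | x < del] by [].
  apply: open_comp; last exact: open_lt.
  move=> t _; apply: continuous_comp; last exact: norm_continuous.
  by apply: differentiable_continuous; apply/derivable1_diffP; have [] := du t.
have iI : is_interval I.
  move=> x y; rewrite /I /= => Ix Iy z /andP[xz zy]; rewrite uN in Ix; rewrite uN in Iy.
  have [nu1|nu1] := leP 0 nu.
    rewrite uN (le_lt_trans _ Iy)// ler_wpM2l// ler_expR ler_wpM2l//.
  rewrite uN (le_lt_trans _ Ix)// ler_wpM2l// ler_expR; rewrite ler_wnM2l// ltW//.
have sol : is_solution Omega X I G.
  move=> t It; split; first by apply/UO/inU.
  have ue : N (u t) < e by exact: lt_le_trans It dele.
  have [d1 [d2 [dd1 dd2 E1 E2]]] := hP _ ue.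
  have k1 := is_derive1_comp dd1 (du t); have k2 := is_derive1_comp dd2 (du t).
  have -> : X (G t) = (d1 * (nu * u t), d2 * (nu * u t)).
    by rewrite [X (G t)]surjective_pairing -E1 -E2; congr pair; ring.
  exact: is_derive_pair.
have [dd [[_ [T [T0 dT]] _] ddG _]] : exists d : R -> R * R,
    [/\ is_periodic_solution Omega X d, forall t : R, I t -> d t = G t &
        surrounds (range d) (0, 0)].
  by apply: (cU (h1 x0, h2 x0) I G) => //; exact: inU.
have nT : 0 < N nu * T by rewrite mulr_gt0// normr_gt0.
(* Shifting time 0 by enough periods, backward for nu > 0 and forward for nu < 0, makes u small
   without changing the value of dd. *)
have to0 (q : R) : 0 < q -> exists t, dd t = dd 0 /\ N (u t) < q.
  move=> q0; pose w := ln (q / N x0).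
  have xp : 0 < N x0 by rewrite normr_gt0.
  have wE : expR w = q / N x0 by rewrite /w lnK// posrE divr_gt0.
  pose n := (Num.truncn (N w / (N nu * T))).+1.
  have nw : N w < n%:R * (N nu * T).
    by rewrite -ltr_pdivrMr// truncnS_gt.
  have fin t : nu * t = - (n%:R * (N nu * T)) -> N (u t) < q.
    move=> E; rewrite uN E mulrC -ltr_pdivlMr// -wE ltr_expR.
    have := ler_norm (- w); rewrite normrN; lra.
  have [nu1|nu1] := leP 0 nu.
    exists (0 - n%:R * T); split; first exact: (periodic_nat dT n 0).2.
    by apply: fin; rewrite ger0_norm//; ring.
  exists (0 + n%:R * T); split; first exact: (periodic_nat dT n 0).1.
  by apply: fin; rewrite ltr0_norm//; ring.
apply: hx0; rewrite -G0 -ddG//.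
have le0 (q : R) : 0 < q -> N (dd 0).1 < q /\ N (dd 0).2 < q.
  move=> q0; have [t1 t10 t1P] := small _ _ _ dh1 h10 q0.
  have [t2 t20 t2P] := small _ _ _ dh2 h20 q0.
  have m0 : 0 < Num.min del (Num.min t1 t2) by rewrite !lt_min del0 t10.
  have [t [<- ]] := to0 _ m0; rewrite !lt_min => /and3P[u0 u1 u2].
  by rewrite ddG//; split; [exact: t1P|exact: t2P].
have z (x : R) : (forall q, 0 < q -> N x < q) -> x = 0.
  move=> H; apply/eqP; rewrite -normr_eq0 eq_le normr_ge0 andbT leNgt.
  by apply/negP => /H; rewrite ltxx.
rewrite [dd 0]surjective_pairing; congr pair; apply: z => q /le0[] //.
Qed.

End RealEigenvalues.

(** * Normal form along the rotation field *)

Section ComplexPoly.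
Variable R : realType.
Notation C := R[i].
Notation P := {poly {poly R}}.
Notation PC := {poly {poly R[i]}}.
Notation N := (@Num.norm _ R).
Local Open Scope complex_scope.

Let sN := @seminorm_normr R.

(** The l1 modulus takes its values in R, as [seminorm] requires, whereas the norm of [R[i]] takes
    its values in [R[i]]. *)
Definition cmod (z : C) : R := N (complex.Re z) + N (complex.Im z).

Lemma seminorm_cmod : seminorm cmod.
Proof.
split; rewrite /cmod.
- by rewrite /= normr0 addr0.
- by case=> x y /=; rewrite !normrN.
- move=> [x y] [x' y'] /=; have := ler_normD x x'; have := ler_normD y y'; lra.
- move=> [x y] [x' y'] /=.
  have h1 := ler_normB (x * x') (y * y'); have h2 := ler_normD (x * y') (y * x').
  rewrite !normrM in h1 h2; rewrite mulrDl !mulrDr; lra.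
Qed.

Let sC := seminorm_cmod.

Lemma cmod1 : cmod 1 <= 1. Proof. by rewrite /cmod /= normr1 normr0 addr0. Qed.

Lemma cmod_real (x : R) : cmod x%:C = N x.
Proof. by rewrite /cmod /= normr0 addr0. Qed.

Lemma cmod_conj z : cmod (conjc z) = cmod z.
Proof. by case: z => x y; rewrite /cmod /= normrN. Qed.

Definition emb1 : {rmorphism C -> PC} := polyC \o polyC.

(* A polynomial p stands for the function p(z, conj z); [sig p] stands for its
   complex conjugate, and [embed q] for q(z conj z). *)
Definition sig : PC -> PC := ev2 (emb1 \o (@conjc R)) 'X%:P 'X.

Lemma sigB p q : sig (p - q) = sig p - sig q. Proof. exact: ev2B. Qed.

Lemma nrm_sig p : nrm cmod 1 (sig p) <= nrm cmod 1 p.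
Proof.
apply: ev2_le; first exact: sC.
- exact/seminorm_nrm/ler01/sC.
- by move=> x; rewrite /= nrmCC// cmod_conj.
- by apply: nrmY; [exact: sC|exact: cmod1|exact: ler01].
- by apply: nrmX; [exact: sC|exact: cmod1|exact: ler01].
Qed.

Definition rx (s : nat -> nat -> C) (p : PC) : PC :=
  \poly_(i < size p) \poly_(j < size p`_i) (s i j * p`_i`_j).

Lemma coef_rx s p i j : (rx s p)`_i`_j = s i j * p`_i`_j.
Proof.
rewrite coef_poly; case: ltnP => [ip|ip]; last first.
  by rewrite [p`_i]nth_default// !coef0 mulr0.
by rewrite coef_poly; case: ltnP => // jp; rewrite [p`_i`_j]nth_default// mulr0.
Qed.

Lemma poly2P (p q : PC) : (forall i j, p`_i`_j = q`_i`_j) -> p = q.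
Proof. by move=> H; apply/polyP => i; apply/polyP => j. Qed.

Lemma rxB s p q : rx s (p - q) = rx s p - rx s q.
Proof. by apply: poly2P => i j; rewrite !coefB !coef_rx !coefB mulrBr. Qed.

Lemma nrm_rx s (c r : R) p : 0 <= r -> 0 <= c -> (forall i j, cmod (s i j) <= c) ->
  nrm cmod r (rx s p) <= c * nrm cmod r p.
Proof.
move=> r0 c0 sc; rewrite /nrm (pnorm_widen (seminorm_pnorm sC r0) r (size_poly _ _)).
rewrite [in leRHS]/pnorm big_distrr /=; apply: ler_sum => i _.
rewrite mulrA ler_wpM2r ?exprn_ge0// coef_poly ltn_ord.
rewrite (pnorm_widen sC r (size_poly _ _)) big_distrr /=.
apply: ler_sum => j _; rewrite mulrA ler_wpM2r ?exprn_ge0//.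
rewrite coef_poly ltn_ord (le_trans (seminormM sC _ _))// ler_wpM2r//.
exact: seminorm_ge0.
Qed.

Definition embed (q : {poly R}) : PC := \poly_(i < size q) ((q`_i)%:C *: 'X^i).

Lemma coef_embed q i j : (embed q)`_i`_j = if i == j then (q`_i)%:C else 0.
Proof.
rewrite coef_poly; case: ltnP => [iq|iq].
  by rewrite coefZ coefXn eq_sym; case: eqP => _; rewrite ?mulr1 ?mulr0.
by rewrite coef0 nth_default// if_same.
Qed.

Lemma embedD p q : embed (p + q) = embed p + embed q.
Proof.
apply: poly2P => i j; rewrite !coefD !coef_embed coefD.
by case: eqP => _; rewrite ?addr0// rmorphD.
Qed.

Lemma embedN q : embed (- q) = - embed q.
Proof.
apply: poly2P => i j; rewrite !coefN !coef_embed coefN.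
by case: eqP => _; rewrite ?oppr0// rmorphN.
Qed.

Lemma embedB p q : embed (p - q) = embed p - embed q.
Proof. by rewrite embedD embedN. Qed.

Lemma nrm_embed q : nrm cmod 1 (embed q) <= pnorm N 1 q.
Proof.
rewrite /nrm (pnorm_widen (seminorm_pnorm sC ler01) 1 (size_poly _ _)).
apply: ler_sum => i _; rewrite ler_wpM2r ?exprn_ge0// coef_poly ltn_ord.
rewrite -mul_polyC (le_trans (pnormCM sC _ _ ler01))// cmod_real.
rewrite -[leRHS]mulr1 ler_wpM2l//.
have h := seminormXle i (seminorm_pnorm sC ler01) _ (pnormX sC cmod1 ler01).
have := h; rewrite expr1n; apply.
by rewrite -polyC1 pnormC// cmod1.
Qed.

(* The coefficients of the monomials z (z conj z)^i, which span the kernel of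
   the operator [rotD] - i. *)
Definition resonant (f : C -> R) (p : PC) : {poly R} :=
  \poly_(i < size p) f p`_i.+1`_i.

Lemma coef_resonant (f : {additive C -> R}) p i :
  (resonant f p)`_i = f p`_i.+1`_i.
Proof.
rewrite coef_poly; case: ltnP => // ip.
by rewrite [p`_i.+1]nth_default ?coef0 ?raddf0// leqW.
Qed.

Lemma resonantB (f : {additive C -> R}) p q :
  resonant f (p - q) = resonant f p - resonant f q.
Proof. by apply/polyP => i; rewrite coefB !coef_resonant !coefB raddfB. Qed.

Lemma pnorm_resonant (f : {additive C -> R}) p : (forall z, N (f z) <= cmod z) ->
  pnorm N 1 (resonant f p) <= nrm cmod 1 p.
Proof.
move=> fC; rewrite (pnorm_widen sN 1 (size_poly _ _)) /nrm.
have s1 := seminorm_pnorm sC ler01.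
apply: le_trans (partial_pnorm_le p (size p).+1 s1 ler01).
rewrite big_ord_recl /= -[leLHS]add0r lerD ?mulr_ge0 ?exprn_ge0 ?pnorm_ge0//.
apply: ler_sum => i _; rewrite expr1n mulr1 expr1n mulr1 coef_resonant.
rewrite (le_trans (fC _))//.
by have := coef_le_pnorm sC p`_i.+1 i ler01; rewrite expr1n mulr1.
Qed.

Lemma Re_le_cmod z : N (complex.Re z) <= cmod z.
Proof. by rewrite /cmod lerDl. Qed.

Lemma Im_le_cmod z : N (complex.Im z) <= cmod z.
Proof. by rewrite /cmod lerDr. Qed.

(* [rotD] is the rotation field z d/dz - conj(z) d/d(conj z) times i. *)
Definition rotD (p : PC) : PC :=
  ('i)%:P%:P * ('X * deriv p - 'X%:P * derY p).

Lemma coef_rotD p a b : (rotD p)`_a`_b = (0 +i* (a%:R - b%:R)) * p`_a`_b.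
Proof.
rewrite coefCM coefCM coefB coefB coefXM coefCM coefXM /derY coef_map /=.
have -> : (0 +i* (a%:R - b%:R)) = 'i * ((a%:R : C) - b%:R) :> C.
  have E (n : nat) : n%:R = (n%:R : R)%:C :> C by rewrite rmorph_nat.
  rewrite !E; apply/eqP; rewrite eq_complex /=; apply/andP.
  by split; apply/eqP; ring.
rewrite -mulrA; congr (_ * _); rewrite mulrBl.
congr (_ - _).
  case: a => [|a] /=; first by rewrite coef0 mul0r.
  by rewrite coef_deriv coefMn mulr_natl.
case: b => [|b] /=; first by rewrite mul0r.
by rewrite coef_deriv mulr_natl.
Qed.

Lemma rotDM p q : rotD (p * q) = rotD p * q + p * rotD q.
Proof. rewrite /rotD derivM derYM; ring. Qed.

Lemma rotDD p q : rotD (p + q) = rotD p + rotD q.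
Proof. rewrite /rotD derivD derYD; ring. Qed.

Lemma rotDX : rotD 'X = ('i)%:P%:P * 'X.
Proof. by rewrite /rotD derivX derYX mulr1 mulr0 subr0. Qed.

Lemma rotDY : rotD 'X%:P = - (('i)%:P%:P * 'X%:P).
Proof. by rewrite /rotD derivC derYC derivX mulr0 sub0r mulr1 mulrN. Qed.

Lemma rotDC c : rotD c%:P%:P = 0.
Proof. by rewrite /rotD derivC derYC derivC polyC0 !mulr0 subrr mulr0. Qed.

(** The inverse of i (a - b) - (al + i), the multiplier of [rotD] minus al + i. The resonant indices
    a = b + 1 are left out even for al != 0, which makes the bound below independent of al. *)
Definition homological (al : R) (a b : nat) : C :=
  if (a == b.+1)%N then 0 else ((- al) +i* (a%:R - b%:R - 1))^-1.

(** There are no small divisors: off resonance the imaginary part a - b - 1 is a non-zero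
    integer. *)
Lemma cmod_homological al a b : cmod (homological al a b) <= 2.
Proof.
rewrite /homological; case: eqP => [_|ab]; first by rewrite /cmod /= normr0 addr0.
set q : R := a%:R - b%:R - 1.
have q1 : 1 <= N q.
  have -> : q = (a%:Z - b%:Z - 1)%:~R by rewrite /q !rmorphB.
  rewrite -intr_norm ler1z -gtz0_ge1 normr_gt0 subr_eq0 subr_eq.
  by apply/eqP; rewrite -[1]/(1%:Z) -PoszD => -[h]; apply: ab; rewrite h add1n.
have n2 : 0 < al ^+ 2 + q ^+ 2.
  by rewrite ltr_wpDl ?sqr_ge0// -real_normK ?num_real// exprn_gt0// (lt_le_trans _ q1).
rewrite /cmod /= sqrrN normrN !normrM !normrN normfV [N (_ + _)]gtr0_norm//.
rewrite -mulrDl ler_pdivrMr// -[al ^+ 2]real_normK ?num_real//.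
rewrite -[q ^+ 2]real_normK ?num_real//.
move: (N al) (N q) q1 => x y y1.
have h1 := sqr_ge0 (x - 1); have h2 : y <= y ^+ 2 by rewrite expr2 ler_peMl// (le_trans ler01).
have h3 : 0 <= x ^+ 2 by exact: sqr_ge0.
rewrite sqrrB in h1; lra.
Qed.

Definition solve (al : R) (p : PC) : PC := rx (homological al) p.

Lemma rotD_solve al p : rotD (solve al p) =
  (al +i* 1)%:P%:P * solve al p + p
  - 'X * (embed (resonant (@complex.Re R) p) + ('i)%:P%:P * embed (resonant (@complex.Im R) p)).
Proof.
apply: poly2P => a b; rewrite coef_rotD !coefB !coefD !coefCM coefXM /solve coef_rx.
rewrite /homological.
have -> : (if (a == 0)%N then 0 else (embed (resonant (@complex.Re R) p) +
    ('i)%:P%:P * embed (resonant (@complex.Im R) p))`_a.-1)`_b =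
    if (a == b.+1)%N then p`_a`_b else 0.
  case: a => [|a]; rewrite ?coef0//= coefD coefCM coefD coefCM !coef_embed eqSS.
  case: eqP => [->|_]; last by rewrite mulr0 addr0.
  by rewrite !coef_resonant -complexE.
case: eqP => [->|ab]; first by rewrite mul0r !mulr0 add0r subrr.
rewrite subr0; set w : C := (- al +i* _).
have w0 : w != 0.
  rewrite /w eq_complex /= negb_and; apply/orP; right.
  rewrite subr_eq0 subr_eq.
  by apply/eqP => h; apply: ab; apply/eqP; rewrite -(eqr_nat R) h -natr1 addrC.
have -> : (0 +i* (a%:R - b%:R)) = (al +i* 1) + w :> C.
  by rewrite /w; apply/eqP; rewrite eq_complex /=; apply/andP; split; apply/eqP; ring.
by rewrite mulrDl !mulrA mulfV// mul1r.
Qed.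

End ComplexPoly.

Section NormalFormPoly.
Variable R : realType.
Notation C := R[i].
Notation PC := {poly {poly R[i]}}.
Notation N := (@Num.norm _ R).
Local Open Scope complex_scope.

Let sN := @seminorm_normr R.
Let sC := seminorm_cmod R.
Let sC1 : seminorm (nrm (@cmod R) 1). Proof. exact/seminorm_nrm/ler01/sC. Qed.
Let sR1 : seminorm (pnorm N 1). Proof. exact/seminorm_pnorm/ler01/sN. Qed.

Lemma coef00_ev2 (f : {rmorphism C -> C}) (a b F : PC) : a`_0`_0 = 0 -> b`_0`_0 = 0 ->
  (ev2 (@emb1 R \o f) a b F)`_0`_0 = f F`_0`_0.
Proof.
move=> a0 b0; elim/poly_ind : F => [|Q c _]; first by rewrite ev20 !coef0 rmorph0.
have -> : (Q * 'X + c%:P)`_0 = c by rewrite coefD coefMX coefC add0r.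
rewrite ev2_cons !coefD !coef0M a0 mulr0 add0r.
elim/poly_ind : c => [|d e _]; first by rewrite rmorph0 horner0 !coef0 rmorph0.
rewrite rmorphD rmorphM /= map_polyX map_polyC hornerD hornerM hornerX hornerC.
have -> : (d * 'X + e%:P)`_0 = e by rewrite coefD coefMX coefC add0r.
by rewrite !coefD !coef0M b0 mulr0 add0r !coefC.
Qed.

Lemma coef00_pcomp (a b F : PC) : a`_0`_0 = 0 -> b`_0`_0 = 0 -> F`_0`_0 = 0 ->
  (pcomp a b F)`_0`_0 = 0.
Proof.
move=> a0 b0 F0; have := coef00_ev2 (@idfun C) F a0 b0.
by rewrite F0 (@ev2_eq _ _ (@emb1 R \o @idfun C) (@emb1 R)).
Qed.

(* With D = [rotD], the equation
     D (z + k) = (1 + t) ((al + i) (z + k) + F (z + k)) - eta z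
   reads D k = (al + i) k + nform + z (i t - e) with e = eta - al (1 + t): k is
   obtained by inverting D - (al + i) off the resonant monomials, and i t - e is
   chosen to cancel the resonant ones. *)
Definition nform (al : R) (F k : PC) (t : {poly R}) : PC :=
  (1 + embed t) * pcomp ('X + k) ('X%:P + sig k) F + (al +i* 1)%:P%:P * (embed t * k).

Section Iteration.
(** A is [cmod] of al + i. The product A del = 1/16 makes the quadratic term (al + i) t k of [nform]
    small compared with del, and eps does the same for the term in F. *)
Variables (al del eps A : R) (F : nat -> PC).
Hypotheses (AE : A = N al + 1) (delE : del = (16 * A)^-1) (epsE : eps = del / 8).
Hypotheses (cF : cauchyN (nrm (@cmod R) 4) F) (FB : forall n, nrm (@cmod R) 4 (F n) <= eps).
Hypothesis F0 : forall n, (F n)`_0`_0 = 0.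

Notation M := (nrm (@cmod R) 1).
Notation m := (pnorm N 1).

Let A1 : 1 <= A. Proof. by rewrite AE lerDr. Qed.
Let Adel : A * del = 16^-1.
Proof. by rewrite delE; field; rewrite gt_eqF// (lt_le_trans _ A1). Qed.
Let del0 : 0 < del. Proof. by rewrite delE invr_gt0 mulr_gt0// (lt_le_trans _ A1). Qed.
Let del16 : del <= 16^-1.
Proof. by rewrite -Adel ler_peMl// ltW. Qed.
Let eps0 : 0 < eps. Proof. by rewrite epsE divr_gt0. Qed.

Let M1 : M 1 <= 1.
Proof. by rewrite -polyC1 -polyC1 nrmCC// cmod1. Qed.

Let argX k : M k <= del -> M ('X + k) <= 2.
Proof.
move=> kd; rewrite (le_trans (seminormD sC1 _ _))//.
have := nrmX sC (@cmod1 R) (@ler01 R); move: del16 kd; lra.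
Qed.

Let argY k : M k <= del -> M ('X%:P + sig k) <= 2.
Proof.
move=> kd; rewrite (le_trans (seminormD sC1 _ _))//.
have := nrmY sC (@cmod1 R) (@ler01 R); have := nrm_sig k; move: del16 kd; lra.
Qed.

Let iM (x : C) : M ((polyC \o polyC) x) <= cmod x.
Proof. by rewrite /= nrmCC. Qed.

Let Fcomp_le n k : M k <= del -> M (pcomp ('X + k) ('X%:P + sig k) (F n)) <= eps.
Proof.
move=> kd; rewrite (le_trans _ (FB n))//.
have h24 : ((0 : R) <= 2) && ((2 : R) <= 4) by rewrite ler0n (ler_nat R 2 4).
exact: le_trans (ev2_le sC sC1 iM _ (argX kd) (argY kd)) (le_nrm sC _ h24).
Qed.

Let Fcomp_lip n k k' : M k <= del -> M k' <= del ->
  M (pcomp ('X + k) ('X%:P + sig k) (F n) - pcomp ('X + k') ('X%:P + sig k') (F n))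
  <= eps * M (k - k').
Proof.
move=> kd kd'; have h24 : 2 < 4 :> R by rewrite ltr_nat.
apply: le_trans (ev2_lip sC sC1 iM (F n) (argX kd) (argY kd) (argX kd') (argY kd') h24) _.
have -> : 'X + k - ('X + k') = k - k' by rewrite opprD addrACA subrr add0r.
have -> : 'X%:P + sig k - ('X%:P + sig k') = sig (k - k').
  by rewrite opprD addrACA subrr add0r sigB.
have -> : 4 - 2 = 2 :> R by lra.
have h := nrm_sig (k - k'); have k0 := seminorm_ge0 sC1 (k - k').
have Fn := FB n; have Fn0 : 0 <= nrm (@cmod R) 4 (F n) by apply: nrm_ge0.
have h2 : M (k - k') + M (sig (k - k')) <= 2 * M (k - k') by lra.
apply: (@le_trans _ _ (2 * M (k - k') * (nrm (@cmod R) 4 (F n) / 2))).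
  by rewrite ler_wpM2r// divr_ge0.
have -> : 2 * M (k - k') * (nrm (@cmod R) 4 (F n) / 2) = nrm (@cmod R) 4 (F n) * M (k - k').
  by field.
by rewrite ler_wpM2r.
Qed.

Let cst_le : M ((al +i* 1)%:P%:P) <= A.
Proof. by rewrite nrmCC// /cmod /= normr1 AE. Qed.

Let one_embed t : m t <= del -> M (1 + embed t) <= 1 + del.
Proof.
move=> td; rewrite (le_trans (seminormD sC1 _ _))//.
by apply: lerD; [exact: M1|exact: le_trans (nrm_embed t) td].
Qed.

Let nform_le n k t : M k <= del -> m t <= del -> M (nform al (F n) k t) <= del / 4.
Proof.
move=> kd td; rewrite (le_trans (seminormD sC1 _ _))//.
have h1 := seminormMle sC1 (one_embed td) (Fcomp_le n kd).
have h2 := seminormMle sC1 cst_le (seminormMle sC1 (le_trans (nrm_embed _) td) kd).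
apply: (le_trans (lerD h1 h2)).
rewrite mulrA Adel epsE; have := ler_wpM2r (ltW del0) del16; move: del0 del16; lra.
Qed.

Let nform_lip n k t k' t' : M k <= del -> m t <= del -> M k' <= del -> m t' <= del ->
  M (nform al (F n) k t - nform al (F n) k' t') <= (M (k - k') + m (t - t')) / 8.
Proof.
move=> kd td kd' td'; rewrite /nform; set f := pcomp _ _ _; set f' := pcomp _ _ _.
set c := (_)%:P%:P : PC.
have -> : (1 + embed t) * f + c * (embed t * k) - ((1 + embed t') * f' + c * (embed t' * k')) =
    (embed (t - t') * f + (1 + embed t') * (f - f')) +
    c * (embed t * (k - k') + embed (t - t') * k').
  by rewrite embedB; ring.
have e1 := seminormMle sC1 (nrm_embed (t - t')) (Fcomp_le n kd).
have e2 := seminormMle sC1 (one_embed td') (Fcomp_lip n kd kd').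
have e3 := seminormMle sC1 (le_trans (nrm_embed _) td) (lexx (M (k - k'))).
have e4 := seminormMle sC1 (nrm_embed (t - t')) kd'.
have e34 := le_trans (seminormD sC1 (embed t * (k - k')) (embed (t - t') * k')) (lerD e3 e4).
have e5 := seminormMle sC1 cst_le e34.
have e12 := le_trans (seminormD sC1 (embed (t - t') * f) ((1 + embed t') * (f - f')))
  (lerD e1 e2).
apply: (le_trans (seminormD sC1 _ _)); apply: (le_trans (lerD e12 e5)).
have -> : A * (del * M (k - k') + m (t - t') * del) =
    A * del * (M (k - k') + m (t - t')) by ring.
rewrite Adel.
have x0 := seminorm_ge0 sC1 (k - k'); have y0 := seminorm_ge0 sR1 (t - t').
set x := M (k - k') in x0 *; set y := m (t - t') in y0 *.
have ee : eps <= 128^-1 by rewrite epsE; move: del16; lra.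
have h1 : y * eps <= y * 128^-1 by rewrite ler_wpM2l.
have h2 : eps * x <= 128^-1 * x by rewrite ler_wpM2r.
have h3 : (1 + del) * (eps * x) <= 2 * (128^-1 * x).
  apply: ler_pM => //; first by move: del0; lra.
    by rewrite mulr_ge0// ltW.
  by move: del16; lra.
move: h1 h3 x0 y0; lra.
Qed.

Let S (u : (PC * {poly R})%type) := M u.1 <= del /\ m u.2 <= del.
Let nm (u : (PC * {poly R})%type) : R := M u.1 + m u.2.
Let Phi n (u : (PC * {poly R})%type) : (PC * {poly R})%type :=
  (solve al (nform al (F n) u.1 u.2), - resonant (@complex.Im R) (nform al (F n) u.1 u.2)).

Let solve_le p : M (solve al p) <= 2 * M p.
Proof. by apply: nrm_rx => // i j; exact: cmod_homological. Qed.

Let res_le p : m (- resonant (@complex.Im R) p) <= M p.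
Proof. by rewrite (seminormN sR1) pnorm_resonant//; exact: Im_le_cmod. Qed.

(** The factor 3 is 2 from [solve] plus 1 from [resonant]; together with the 1/8 of [nform_lip] the
    contraction rate is 3/8. *)
Let Phi_diff n n' u v : nm (Phi n u - Phi n' v) <=
  3 * M (nform al (F n) u.1 u.2 - nform al (F n') v.1 v.2).
Proof.
rewrite /nm /Phi /= -rxB -opprD -resonantB.
have h1 := solve_le (nform al (F n) u.1 u.2 - nform al (F n') v.1 v.2).
have h2 := res_le (nform al (F n) u.1 u.2 - nform al (F n') v.1 v.2).
rewrite /solve in h1; lra.
Qed.

Lemma normal_form_poly : exists (k : nat -> PC) (t : nat -> {poly R}),
  [/\ cauchyN M k, cauchyN m t, forall n, M (k n) <= del /\ m (t n) <= del,
    forall n, (k n)`_0`_0 = 0 &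
    cauchyN M (fun n => nform al (F n) (k n) (t n)) /\
    forall n, k n.+1 = solve al (nform al (F n) (k n) (t n)) /\
      t n.+1 = - resonant (@complex.Im R) (nform al (F n) (k n) (t n))].
Proof.
have z1 : M 0 = 0 := seminorm0 sC1; have z2 : m 0 = 0 := seminorm0 sR1.
have S0 : S (0, 0) by split; rewrite /= ?z1 ?z2 ltW.
have SPhi n u : S u -> S (Phi n u).
  move=> [u1 u2]; have h := nform_le n u1 u2; split => /=.
    by rewrite (le_trans (solve_le _))//; move: h del0; lra.
  by rewrite (le_trans (res_le _))//; move: h del0; lra.
have NB u v : S u -> S v -> nm (u - v) <= 4 * del.
  move=> [u1 u2] [v1 v2]; rewrite /nm /=.
  have := seminormB sC1 u.1 v.1; have := seminormB sR1 u.2 v.2; lra.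
have ND u v : nm (u + v) <= nm u + nm v.
  by rewrite /nm /= addrACA lerD// seminormD.
have contr n u v : S u -> S v -> nm (Phi n u - Phi n v) <= nm (u - v) / 2.
  move=> [u1 u2] [v1 v2]; rewrite (le_trans (Phi_diff _ _ _ _))//.
  have := nform_lip n u1 u2 v1 v2.
  have : 0 <= nm (u - v) by rewrite addr_ge0// ?(seminorm_ge0 sC1) ?(seminorm_ge0 sR1).
  rewrite /nm /=; lra.
have unif (e : R) : 0 < e -> exists n0, forall n n' u,
    (n0 <= n)%N -> (n0 <= n')%N -> S u -> nm (Phi n u - Phi n' u) <= e.
  move=> e0; have e6 : 0 < e / 6 by rewrite divr_gt0.
  have [n0 n0P] := cF e6; exists n0 => n n' u nn nn' [u1 u2].
  rewrite (le_trans (Phi_diff _ _ _ _))//.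
  have -> : nform al (F n) u.1 u.2 - nform al (F n') u.1 u.2 =
      (1 + embed u.2) * pcomp ('X + u.1) ('X%:P + sig u.1) (F n - F n').
    by rewrite /nform /pcomp ev2B; ring.
  have h24 : ((0 : R) <= 2) && ((2 : R) <= 4) by rewrite ler0n (ler_nat R 2 4).
  have h1 := le_trans (ev2_le sC sC1 iM (F n - F n') (argX u1) (argY u1)) (le_nrm sC _ h24).
  have h2 := seminormMle sC1 (one_embed u2) (le_trans h1 (n0P _ _ nn nn')).
  have h3 : (1 + del) * (e / 6) <= 2 * (e / 6).
    by rewrite ler_wpM2r ?ltW//; move: del16; lra.
  by move: (le_trans h2 h3); rewrite /pcomp; lra.
have cu := cauchyN_iterates S0 SPhi NB ND contr unif.
have uS n : S (iterates Phi (0, 0) n) := iterates_in S0 SPhi n.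
pose u := iterates Phi (0, 0).
have ck : cauchyN M (fun n => (u n).1).
  move=> e /cu[n0 n0P]; exists n0 => n n' x y; apply: le_trans (n0P n n' x y).
  by rewrite /nm lerDl (seminorm_ge0 sR1).
have ct : cauchyN m (fun n => (u n).2).
  move=> e /cu[n0 n0P]; exists n0 => n n' x y; apply: le_trans (n0P n n' x y).
  by rewrite /nm lerDr (seminorm_ge0 sC1).
have k00 n : (u n).1`_0`_0 = 0.
  elim: n => [|n IH]; first by rewrite !coef0.
  rewrite /u /= /solve coef_rx /nform !coefD !coef0M -/u.
  have s0 : (sig (u n).1)`_0`_0 = 0.
    by rewrite /sig coef00_ev2 ?IH ?rmorph0// ?coefX ?coefC /= ?coef0 ?coefX.
  rewrite IH coef00_pcomp ?mulr0 ?addr0 ?mulr0//.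
    by rewrite !coefD IH coefX /= coef0 addr0.
  by rewrite !coefD s0 coefC /= coefX addr0.
exists (fun n => (u n).1), (fun n => (u n).2); split=> //.
split; last by [].
have h24 : 2 < 4 :> R by rewrite ltr_nat.
have ce : cauchyN M (fun n => embed (u n).2).
  by apply: (cauchyN_le sR1 ler01 _ ct) => n n'; rewrite mul1r -embedB nrm_embed.
have cs : cauchyN M (fun n => sig (u n).1).
  by apply: (cauchyN_le sC1 ler01 _ ck) => n n'; rewrite mul1r -sigB nrm_sig.
have aX n := argX (uS n).1; have aY n := argY (uS n).1.
apply: cauchyND => //; apply: cauchyNM => //.
- by apply: cauchyND => //; exact: cauchyN_cst.
- apply: (cauchyN_ev2 sC sC1 iM h24 aX aY cF).
    by apply: cauchyND => //; exact: cauchyN_cst.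
  by apply: cauchyND => //; exact: cauchyN_cst.
- exact: cauchyN_cst.
- exact: cauchyNM.
Qed.

End Iteration.
End NormalFormPoly.

(** * From the variables (z, conj z) back to (x, y) *)

Section RealForm.
Variable R : realType.
Notation C := R[i].
Notation P := {poly {poly R}}.
Notation PC := {poly {poly R[i]}}.
Notation N := (@Num.norm _ R).
Local Open Scope complex_scope.

Let sN := @seminorm_normr R.
Let sC := seminorm_cmod R.

Definition cev (z w : C) (p : PC) : C := ev2 (@idfun C) z w p.

Lemma cevD z w p q : cev z w (p + q) = cev z w p + cev z w q.
Proof. exact: ev2D. Qed.

Lemma cevB z w p q : cev z w (p - q) = cev z w p - cev z w q.
Proof. exact: ev2B. Qed.

Lemma cevM z w p q : cev z w (p * q) = cev z w p * cev z w q.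
Proof. exact: ev2M. Qed.

Lemma cevC z w c : cev z w c%:P%:P = c. Proof. exact: ev2C. Qed.

Lemma cevX z w : cev z w 'X = z. Proof. exact: ev2X. Qed.

Lemma cevY z w : cev z w 'X%:P = w. Proof. exact: ev2Y. Qed.

Lemma cev1 z w : cev z w 1 = 1. Proof. exact: rmorph1. Qed.

Lemma cev_sub (K : comNzRingType) (f : {rmorphism K -> C}) z w (a b : PC)
    (p : {poly {poly K}}) :
  cev z w (ev2 (@emb1 R \o f) a b p) = ev2 f (cev z w a) (cev z w b) p.
Proof.
rewrite /cev [LHS](ev2_morph (@emb1 R \o f) (ev2 (@idfun C) z w)).
by apply: ev2_eq => x; exact: ev2C.
Qed.

Lemma cev_pcomp z w (a b p : PC) :
  cev z w (pcomp a b p) = cev (cev z w a) (cev z w b) p.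
Proof.
rewrite /cev [LHS](ev2_morph (@emb1 R) (ev2 (@idfun C) z w)).
by apply: ev2_eq => x; exact: ev2C.
Qed.

Lemma cev_sig z p : cev z (conjc z) (sig p) = conjc (cev z (conjc z) p).
Proof.
rewrite /sig cev_sub cevX cevY [RHS](ev2_morph (@idfun C) (@conjc R)).
by case: z => u v; rewrite /= opprK; exact: ev2_eq.
Qed.

Lemma cev_embed x y (q : {poly R}) :
  cev (x +i* y) (x +i* - y) (embed q) = (q.[x ^+ 2 + y ^+ 2])%:C.
Proof.
elim/poly_ind : q => [|q c IH].
  rewrite horner0 rmorph0 -[RHS](cevC (x +i* y) (x +i* - y)) !polyC0; congr cev.
  by apply: poly2P => i j; rewrite coef_embed !coef0 if_same.
have -> : embed (q * 'X + c%:P) = embed q * ('X * 'X%:P) + (c%:C)%:P%:P.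
  apply: poly2P => i j; rewrite coefD mulrA coefMC coefMX coefD coefMX coef_embed.
  rewrite coefD coefMX coefC coefC.
  case: i => [|i] /=; case: j => [|j] //=; rewrite ?coef0 ?coefC /= ?addr0 ?add0r//.
  - by rewrite eqSS coef_embed.
rewrite cevD !cevM cevX cevY cevC IH hornerD hornerM hornerX hornerC.
by apply/eqP; rewrite eq_complex /=; apply/andP; split; apply/eqP; ring.
Qed.

Definition rsub (p : PC) : PC :=
  ev2 (@emb1 R) ('X + ('i)%:P%:P * 'X%:P) ('X - ('i)%:P%:P * 'X%:P) p.

Definition mapRe (p : PC) : P := map_poly (map_poly (@complex.Re R)) p.

(* The polynomial in (x, y) whose value is the real part of p (x + iy, x - iy). *)
Definition reP (p : PC) : P := mapRe (rsub p).

Lemma coef_mapRe p i j : (mapRe p)`_i`_j = complex.Re p`_i`_j.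
Proof. by rewrite coef_map /= coef_map. Qed.

Lemma mapReB p q : mapRe (p - q) = mapRe p - mapRe q.
Proof. exact: raddfB. Qed.

Lemma rsubB p q : rsub (p - q) = rsub p - rsub q.
Proof. exact: ev2B. Qed.

Lemma rePB p q : reP (p - q) = reP p - reP q.
Proof. by rewrite /reP rsubB mapReB. Qed.

Lemma ev_mapRe x y p : ev x y (mapRe p) = complex.Re (cev x%:C y%:C p).
Proof.
have Re_mul (z : C) (u : R) : complex.Re (z * u%:C) = complex.Re z * u.
  by case: z => a b /=; rewrite mulr0 subr0.
have inner (c : {poly C}) : (map_poly (@complex.Re R) c).[y] = complex.Re (c.[y%:C]).
  elim/poly_ind : c => [|c e IH]; first by rewrite raddf0 !horner0.
  rewrite raddfD /= hornerD map_polyC hornerC !hornerMXaddC raddfD /= Re_mul -IH.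
  congr (_ + _); rewrite -hornerMX; congr (_.[_]).
  apply/polyP => i; rewrite coef_map /= !coefMX coef_map.
  by case: ifP.
elim/poly_ind : p => [|p c IH].
  by rewrite [mapRe 0]raddf0 /cev /ev !ev20.
have -> : mapRe (p * 'X + c%:P) = mapRe p * 'X + (map_poly (@complex.Re R) c)%:P.
  apply/polyP => i; rewrite coef_map /= !coefD !coefMX !coefC.
  by case: i => [|i] /=; rewrite ?add0r ?addr0// coef_map.
rewrite /ev /cev !ev2_cons raddfD /= Re_mul; congr (_ * _ + _); first exact: IH.
by rewrite !map_poly_id// inner.
Qed.

Lemma ev_reP x y p : ev x y (reP p) = complex.Re (cev (x +i* y) (x +i* - y) p).
Proof.
rewrite /reP ev_mapRe; congr complex.Re; rewrite /rsub.
rewrite [LHS](ev2_morph (@emb1 R) (ev2 (@idfun C) x%:C y%:C)).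
rewrite (@ev2_eq _ _ _ (@idfun C)); last by move=> z; exact: ev2C.
have eX : cev x%:C y%:C ('X + ('i)%:P%:P * 'X%:P) = x +i* y.
  rewrite cevD cevM cevX cevY cevC.
  by apply/eqP; rewrite eq_complex /=; apply/andP; split; apply/eqP; ring.
have eY : cev x%:C y%:C ('X - ('i)%:P%:P * 'X%:P) = x +i* - y.
  rewrite cevB cevM cevX cevY cevC.
  by apply/eqP; rewrite eq_complex /=; apply/andP; split; apply/eqP; ring.
by rewrite -eX -eY.
Qed.

(** The radius is halved because z = x + i y has norm up to r + r as a polynomial in x and y. This
    is the origin of the radius 1/2 in the real normal form. *)
Lemma nrm_reP (r : R) p : 0 <= r -> nrm N r (reP p) <= nrm (@cmod R) (r + r) p.
Proof.
move=> r0; have s2 := seminorm_nrm sC r0.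
apply: (@le_trans _ _ (nrm (@cmod R) r (rsub p))).
  have h q : pnorm N r (map_poly (@complex.Re R) q) <= pnorm (@cmod R) r q.
    exact: (pnorm_map q sC sN r0 (@Re_le_cmod R)).
  exact: (pnorm_map (rsub p) (seminorm_pnorm sC r0) (seminorm_pnorm sN r0) r0 h).
have hX := nrmX sC (@cmod1 R) r0.
have hY : nrm (@cmod R) r (('i)%:P%:P * 'X%:P) <= r.
  have h : nrm (@cmod R) r (('i)%:P%:P : PC) <= 1.
    by rewrite nrmCC// /cmod /= normr0 normr1 add0r.
  apply: (le_trans (seminormMle s2 h (nrmY sC (@cmod1 R) r0))).
  by rewrite (mul1r r).
have iC (z : C) : nrm (@cmod R) r (@emb1 R z) <= cmod z by rewrite /= nrmCC.
apply: (ev2_le sC s2 iC).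
- by apply: (le_trans (seminormD s2 _ _)); exact: lerD.
- by apply: (le_trans (seminormB s2 _ _)); exact: lerD.
Qed.

(** The field x d/dy - y d/dx, which is [rotD] in real coordinates. *)
Definition rotP (K : comNzRingType) (p : {poly {poly K}}) : {poly {poly K}} :=
  'X * derY p - 'X%:P * deriv p.

Lemma rotPM (K : comNzRingType) (p q : {poly {poly K}}) :
  rotP (p * q) = rotP p * q + p * rotP q.
Proof. rewrite /rotP derivM derYM; ring. Qed.

Lemma rotPD (K : comNzRingType) (p q : {poly {poly K}}) : rotP (p + q) = rotP p + rotP q.
Proof. rewrite /rotP derivD derYD; ring. Qed.

Lemma rotP_X (K : comNzRingType) : rotP ('X : {poly {poly K}}) = - 'X%:P.
Proof. by rewrite /rotP derivX derYX mulr1 mulr0 sub0r. Qed.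

Lemma rotP_Y (K : comNzRingType) : rotP ('X%:P : {poly {poly K}}) = 'X.
Proof. by rewrite /rotP derivC derYC derivX mulr0 subr0 mulr1. Qed.

Lemma rotP_C (K : comNzRingType) (c : K) : rotP c%:P%:P = 0.
Proof. by rewrite /rotP derivC derYC derivC polyC0 !mulr0 subrr. Qed.

Lemma rsubD p q : rsub (p + q) = rsub p + rsub q. Proof. exact: ev2D. Qed.
Lemma rsubM p q : rsub (p * q) = rsub p * rsub q. Proof. exact: ev2M. Qed.
Lemma rsubC c : rsub c%:P%:P = c%:P%:P. Proof. exact: ev2C. Qed.
Lemma rsubX : rsub 'X = 'X + ('i)%:P%:P * 'X%:P. Proof. exact: ev2X. Qed.
Lemma rsubY : rsub 'X%:P = 'X - ('i)%:P%:P * 'X%:P. Proof. exact: ev2Y. Qed.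

(** Both sides are derivations along the ring morphism [rsub], so it suffices to compare them on the
    two variables and on constants. *)
Lemma rotP_rsub p : rotP (rsub p) = rsub (rotD p).
Proof.
have ii : ('i : C)%:P%:P * ('i)%:P%:P = - 1 :> PC.
  have e : ('i : C) * 'i = - 1 by rewrite -expr2 sqr_i.
  by rewrite -polyCM -polyCM e !polyCN ?polyC1.
have RX : rotP (rsub 'X) = rsub (rotD 'X).
  rewrite rotDX rsubM rsubC rsubX rotPD rotPM rotP_C rotP_X rotP_Y mul0r add0r.
  by rewrite mulrDr mulrA ii; ring.
have RY : rotP (rsub 'X%:P) = rsub (rotD 'X%:P).
  rewrite rotDY -mulNr rsubM -!polyCN rsubC rsubY -mulNr -!polyCN rotPD rotPM rotP_C.
  rewrite rotP_X rotP_Y mul0r add0r !polyCN mulrDr !mulNr mulrN opprK mulrA ii; ring.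
have R0 : rotP (rsub 0) = rsub (rotD 0).
  have z0 : (0 : C)%:P%:P = 0 :> PC by rewrite !polyC0.
  have r0 : rsub 0 = 0 by rewrite -z0 rsubC.
  by rewrite r0 -z0 rotP_C rotDC r0.
have HM a b : rotP (rsub a) = rsub (rotD a) -> rotP (rsub b) = rsub (rotD b) ->
    rotP (rsub (a * b)) = rsub (rotD (a * b)).
  move=> ha hb; rewrite rotDM rsubD (rsubM a b) (rsubM (rotD a) b) (rsubM a (rotD b)).
  by rewrite rotPM ha hb.
have HD a b : rotP (rsub a) = rsub (rotD a) -> rotP (rsub b) = rsub (rotD b) ->
    rotP (rsub (a + b)) = rsub (rotD (a + b)).
  by move=> ha hb; rewrite rotDD (rsubD a b) (rsubD (rotD a)) rotPD ha hb.
elim/poly_ind : p => [|p c IH]; first exact: R0.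
apply: (HD _ _ (HM _ _ IH RX)).
elim/poly_ind : c => [|c e IHc]; first exact: R0.
rewrite polyCD polyCM; apply: (HD _ _ (HM _ _ IHc RY)).
by rewrite rotDC rsubC rotP_C; have := rsubC 0; rewrite !polyC0.
Qed.

Lemma rotP_reP p : rotP (reP p) = reP (rotD p).
Proof.
rewrite /reP -rotP_rsub; apply/polyP => i; apply/polyP => j.
rewrite coef_mapRe /rotP !coefB raddfB /=; congr (_ - _).
  rewrite !coefXM; case: i => [|i] /=; first by rewrite !coef0.
  rewrite !coef_map /= !coef_deriv raddfMn /=.
  by rewrite coef_map.
rewrite !coefCM !coefXM; case: j => [|j] //=.
by rewrite !coef_deriv !coefMn raddfMn /= coef_mapRe.
Qed.

(** Transfers a recursion for polynomials to a differential equation for the limit: the rotation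
    derivative converges both to its value on f and to the limit of the right-hand sides. *)
Lemma rotation_limit r (k : nat -> PC) (f : R * R -> R) x y (a b L : R) :
  plim r (reP \o k) f -> N x < r -> N y < r -> grad f (x, y) a b ->
  (fun n => complex.Re (cev (x +i* y) (x +i* - y) (rotD (k n.+1)))) @ \oo --> L ->
  - y * a + x * b = L.
Proof.
move=> kf xh yh fab kL.
have [a' [b' [la lb fab']]] := plim_grad kf (xh : N (x, y).1 < _) (yh : N (x, y).2 < _).
have [-> ->] := grad_uniq fab fab'.
apply: (cvgn_uniq _ kL).
have h : (fun n => - y * ev x y (deriv (reP (k n.+1))) + x * ev x y (derY (reP (k n.+1))))
    @ \oo --> - y * a' + x * b'.
  apply: cvgD; apply: cvgM.
  - exact: cvg_cst.
  - exact: cvgn_shift la.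
  - exact: cvg_cst.
  - exact: cvgn_shift lb.
apply: cvg_trans h.
apply: near_eq_cvg; apply: nearW => n /=.
rewrite -ev_reP -rotP_reP /rotP evB !evM.
by rewrite /ev !ev2X !ev2Y; ring.
Qed.

End RealForm.

Section NormalForm.
Variable R : realType.
Notation C := R[i].
Notation P := {poly {poly R}}.
Notation PC := {poly {poly R[i]}}.
Notation N := (@Num.norm _ R).
Local Open Scope complex_scope.

Let sN := @seminorm_normr R.
Let sC := seminorm_cmod R.

Lemma nrm_reP_half (p : PC) : nrm N 2^-1 (reP p) <= nrm (@cmod R) 1 p.
Proof.
have e : (2^-1 + 2^-1 : R) = 1 by field.
by have := @nrm_reP R 2^-1 p; rewrite e; apply; rewrite invr_ge0.
Qed.

Definition rcC : {rmorphism R -> C} := real_complex R.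

(* The complex function p + i q in the variables (z, conj z). *)
Definition cplx (p q : P) : PC :=
  ev2 (@emb1 R \o rcC) (((2^-1)%:C)%:P%:P * ('X + 'X%:P))
    ((0 +i* - 2^-1)%:P%:P * ('X - 'X%:P)) p
  + ('i)%:P%:P * ev2 (@emb1 R \o rcC) (((2^-1)%:C)%:P%:P * ('X + 'X%:P))
    ((0 +i* - 2^-1)%:P%:P * ('X - 'X%:P)) q.

Lemma ev2_real x y p : ev2 rcC x%:C y%:C p = (ev x y p)%:C.
Proof.
by rewrite /ev [RHS](ev2_morph (@idfun R) rcC); exact: ev2_eq.
Qed.

Lemma cev_cplx x y p q : cev (x +i* y) (x +i* - y) (cplx p q) = ev x y p +i* ev x y q.
Proof.
rewrite /cplx cevD cevM cevC !cev_sub !cevM !cevC cevD cevB cevX cevY.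
have -> : (2^-1)%:C * ((x +i* y) + (x +i* - y)) = x%:C :> C.
  by apply/eqP; rewrite eq_complex /=; apply/andP; split; apply/eqP; field.
have -> : (0 +i* - 2^-1) * ((x +i* y) - (x +i* - y)) = y%:C :> C.
  by apply/eqP; rewrite eq_complex /=; apply/andP; split; apply/eqP; field.
rewrite !ev2_real.
by apply/eqP; rewrite eq_complex /=; apply/andP; split; apply/eqP; ring.
Qed.

Lemma cplxB p q p' q' : cplx p q - cplx p' q' = cplx (p - p') (q - q').
Proof. rewrite /cplx !ev2B; ring. Qed.

Lemma nrm_cplx p q : nrm (@cmod R) 4 (cplx p q) <= nrm N 4 p + nrm N 4 q.
Proof.
have f0 : (0 : R) <= 4 by [].
have s4 := seminorm_nrm sC f0.
have hX := nrmX sC (@cmod1 R) f0; have hY := nrmY sC (@cmod1 R) f0.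
have ir (z : R) : nrm (@cmod R) 4 ((@emb1 R \o rcC) z) <= N z.
  by rewrite /= nrmCC// cmod_real.
have c1 : nrm (@cmod R) 4 (((2^-1)%:C)%:P%:P : PC) <= 2^-1.
  by rewrite nrmCC// cmod_real ger0_norm// invr_ge0.
have c2 : nrm (@cmod R) 4 ((0 +i* - 2^-1)%:P%:P : PC) <= 2^-1.
  by rewrite nrmCC// /cmod /= normr0 normrN add0r ger0_norm// invr_ge0.
have c3 : nrm (@cmod R) 4 (('i)%:P%:P : PC) <= 1.
  by rewrite nrmCC// /cmod /= normr0 normr1 add0r.
have e : (2^-1 * (4 + 4) : R) = 4 by field.
have aB : nrm (@cmod R) 4 (((2^-1)%:C)%:P%:P * ('X + 'X%:P)) <= 4.
  have := seminormMle s4 c1 (le_trans (seminormD s4 _ _) (lerD hX hY)).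
  by rewrite e.
have bB : nrm (@cmod R) 4 ((0 +i* - 2^-1)%:P%:P * ('X - 'X%:P)) <= 4.
  have := seminormMle s4 c2 (le_trans (seminormB s4 _ _) (lerD hX hY)).
  by rewrite e.
apply: (le_trans (seminormD s4 _ _)); apply: lerD.
  exact: (ev2_le sN s4 ir _ aB bB).
apply: (le_trans (seminormMle s4 c3 (ev2_le sN s4 ir _ aB bB))).
by rewrite mul1r.
Qed.

Lemma cev00 (s : PC) : cev 0 0 s = s`_0`_0.
Proof.
rewrite /cev; elim/poly_ind : s => [|s c _]; first by rewrite ev20 !coef0.
rewrite ev2_cons mulr0 add0r coefD coefMX coefC add0r map_poly_id//.
by rewrite horner_coef0.
Qed.

Lemma cplx00 (p q : P) : p`_0`_0 = 0 -> q`_0`_0 = 0 -> (cplx p q)`_0`_0 = 0.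
Proof.
move=> p0 q0.
by have := cev_cplx 0 0 p q; rewrite oppr0 cev00 !ev00 p0 q0.
Qed.

Lemma cev_nform al x y (p q : P) (k : PC) (t : {poly R}) (u v r : R) :
  cev (x +i* y) (x +i* - y) k = u +i* v -> r = t.[x ^+ 2 + y ^+ 2] ->
  cev (x +i* y) (x +i* - y) (nform al (cplx p q) k t) =
    ((1 + r) * ev (x + u) (y + v) p + al * (r * u) - r * v) +i*
    ((1 + r) * ev (x + u) (y + v) q + r * u + al * (r * v)).
Proof.
move=> kE tE; have hp : cev (x +i* y) (x +i* - y) (pcomp ('X + k) ('X%:P + sig k) (cplx p q)) =
    ev (x + u) (y + v) p +i* ev (x + u) (y + v) q.
  rewrite cev_pcomp [cev _ _ ('X + k)]cevD [cev _ _ ('X%:P + _)]cevD cevX cevY kE.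
  have -> : cev (x +i* y) (x +i* - y) (sig k) = (u +i* - v).
    by have := cev_sig (x +i* y) k; rewrite /= kE.
  have -> : (x +i* y) + (u +i* v) = (x + u) +i* (y + v) by [].
  have -> : (x +i* - y) + (u +i* - v) = (x + u) +i* - (y + v) by rewrite opprD.
  exact: cev_cplx.
rewrite /nform cevD cevM hp cevD cev1 cevM cevM cevC cev_embed kE -tE.
by apply/eqP; rewrite eq_complex /=; apply/andP; split; apply/eqP; ring.
Qed.

(** Pointwise versions of the limit rules, from which the limit of a long expression is built as a
    single term. *)
Lemma limD (u v : R^nat) (a b : R) : u @ \oo --> a -> v @ \oo --> b ->
  (fun n => u n + v n) @ \oo --> a + b.
Proof. exact: cvgD. Qed.

Lemma limN (u : R^nat) (a : R) : u @ \oo --> a -> (fun n => - u n) @ \oo --> - a.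
Proof. exact: cvgN. Qed.

Lemma limM (u v : R^nat) (a b : R) : u @ \oo --> a -> v @ \oo --> b ->
  (fun n => u n * v n) @ \oo --> a * b.
Proof. exact: cvgM. Qed.

Lemma limC (a : R) : (fun=> a : R) @ \oo --> a.
Proof. exact: cvg_cst. Qed.

Lemma complex_split (al a b u v x y s t e c : R) : e = c + s ->
  (al +i* 1) * (a +i* b) + (u +i* v) - (x +i* y) * (s%:C + 'i * (- t)%:C) =
  (al * a - b + u - (x * (e - c) + y * t)) +i* (a + al * b + v - (y * (e - c) - x * t)) :> C.
Proof.
by move=> ->; apply/eqP; rewrite eq_complex /=; apply/andP; split; apply/eqP; ring.
Qed.

Lemma normal_form (al del : R) (p1 p2 : nat -> P) (f1 f2 : R * R -> R) :
  del = (16 * (N al + 1))^-1 -> plim 4 p1 f1 -> plim 4 p2 f2 ->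
  (forall n, nrm N 4 (p1 n) <= del / 16) -> (forall n, nrm N 4 (p2 n) <= del / 16) ->
  (forall n, (p1 n)`_0`_0 = 0) -> (forall n, (p2 n)`_0`_0 = 0) ->
  exists (A B : nat -> P) (k1 k2 : R * R -> R) (t e : nat -> {poly R}) (T H : R -> R),
  [/\ [/\ plim 2^-1 A k1, plim 2^-1 B k2,
        forall n, nrm N 2^-1 (A n) <= del /\ nrm N 2^-1 (B n) <= del &
        k1 (0, 0) = 0 /\ k2 (0, 0) = 0],
    [/\ cauchyN (pnorm N 1) t, forall n, pnorm N 1 (t n) <= del &
        forall x, N x <= 1 -> (fun n => (t n).[x]) @ \oo --> T x],
    cauchyN (pnorm N 1) e /\
      forall x, N x <= 1 -> (fun n => (e n).[x]) @ \oo --> H x &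
    forall x y, N x < 2^-1 -> N y < 2^-1 -> exists a b c d,
      let u := x + k1 (x, y) in let v := y + k2 (x, y) in
      let r := x ^+ 2 + y ^+ 2 in
      [/\ grad k1 (x, y) a b, grad k2 (x, y) c d,
        - y * (1 + a) + x * b = (1 + T r) * (al * u - v + f1 (u, v)) - H r * x &
        - y * c + x * (1 + d) = (1 + T r) * (u + al * v + f2 (u, v)) - H r * y]].
Proof.
move=> delE p1f p2f p1B p2B p10 p20.
have del0 : 0 < del by rewrite delE invr_gt0 mulr_gt0// ltr_wpDl.
have del16 : del <= 16^-1.
  by rewrite delE lef_pV2 ?posrE ?mulr_gt0 ?ltr_wpDl// ler_peMr// lerDr.
have s4 := seminorm_nrm sN (ler0n R 4); have h0 : (0 : R) <= 2^-1 by rewrite invr_ge0.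
have cF : cauchyN (nrm (@cmod R) 4) (fun n => cplx (p1 n) (p2 n)).
  move=> z z0; have z2 : 0 < z / 2 by rewrite divr_gt0.
  have [n1 n1P] := p1f.1 _ z2; have [n2 n2P] := p2f.1 _ z2.
  exists (maxn n1 n2) => n m; rewrite !geq_max => /andP[a1 a2] /andP[b1 b2].
  rewrite cplxB (le_trans (nrm_cplx _ _))//.
  by have := n1P n m a1 b1; have := n2P n m a2 b2; lra.
have FB n : nrm (@cmod R) 4 (cplx (p1 n) (p2 n)) <= del / 8.
  by rewrite (le_trans (nrm_cplx _ _))//; have := p1B n; have := p2B n; lra.
have F0 n : (cplx (p1 n) (p2 n))`_0`_0 = 0 by apply: cplx00.
have [k [t [ck ct kt k0 [cn rec]]]] := normal_form_poly erefl delE erefl cF FB F0.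
(* The imaginary part of k is the real part of - i k, so that [reP] yields both components. *)
pose A n := reP (k n); pose B n := reP (- ('i)%:P%:P * k n).
have sC1 : seminorm (nrm (@cmod R) 1) by exact/seminorm_nrm/ler01/sC.
have i1 : nrm (@cmod R) 1 (- ('i)%:P%:P : PC) <= 1.
  by rewrite (seminormN sC1) nrmCC// /cmod /= normr0 normr1 add0r.
have cik : cauchyN (nrm (@cmod R) 1) (fun n => - ('i)%:P%:P * k n).
  by apply: cauchyNM => //; exact: cauchyN_cst.
have creP (q : nat -> PC) : cauchyN (nrm (@cmod R) 1) q ->
    cauchyN (nrm N 2^-1) (fun n => reP (q n)).
  by apply: (cauchyN_le sC1 ler01) => n m; rewrite mul1r -rePB nrm_reP_half.
have [k1 pA] : exists f : R * R -> R, plim 2^-1 A f by eexists; exact/plim_exists/creP.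
have [k2 pB] : exists f : R * R -> R, plim 2^-1 B f by eexists; exact/plim_exists/creP.
have AB n : nrm N 2^-1 (A n) <= del /\ nrm N 2^-1 (B n) <= del.
  have [kn _] := kt n; split; apply: (le_trans (nrm_reP_half _)) => //.
  by apply: (le_trans (seminormMle sC1 i1 kn)); rewrite mul1r.
(* This is the eta in the equation of [nform]; the e of that equation is the second summand alone,
   the real resonant part. *)
pose e n := al *: (1 + t n) + resonant (@complex.Re R) (nform al (cplx (p1 n) (p2 n)) (k n) (t n)).
have s1 : seminorm (pnorm N 1) := seminorm_pnorm sN ler01.
have ce : cauchyN (pnorm N 1) e.
  apply: cauchyND => //; last first.
    apply: (cauchyN_le sC1 ler01 _ cn) => n m.
    by rewrite mul1r -resonantB pnorm_resonant//; exact: Re_le_cmod.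
  under [X in cauchyN _ X]funext => n do rewrite -mul_polyC.
  apply: cauchyNM => //; first exact: cauchyN_cst.
  by apply: cauchyND => //; exact: cauchyN_cst.
have lim1 (q : nat -> {poly R}) : cauchyN (pnorm N 1) q ->
    forall x, N x <= 1 -> (fun n => (q n).[x]) @ \oo --> limn (fun n => (q n).[x]).
  move=> cq x x1; have [l ql] : exists l : R, (fun n => (q n).[x]) @ \oo --> l.
    apply: cauchyN_cvg; apply: (cauchyN_le s1 ler01 _ cq) => n m.
    by rewrite mul1r -hornerN -hornerD; exact: horner_le_pnorm.
  by rewrite (cvg_lim _ ql).
pose T (x : R) : R := limn (fun n => (t n).[x]); pose H (x : R) : R := limn (fun n => (e n).[x]).
exists A, B, k1, k2, t, e, T, H; split.
- split=> //.
  have z : N (0 : R) <= 2^-1 by rewrite normr0.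
  have ev0 (q : PC) : q`_0`_0 = 0 -> complex.Re (cev 0 0 q) = 0 by move=> q0; rewrite cev00 q0.
  have h1 : (fun n => ev 0 0 (A n)) = cst 0.
    by apply/funext => n; rewrite /A ev_reP oppr0 ev0 ?k0.
  have h2 : (fun n => ev 0 0 (B n)) = cst 0.
    by apply/funext => n; rewrite /B ev_reP oppr0 cevM [cev _ _ (k n)]cev00 k0 mulr0.
  have l1 := pA.2 0 0 z z; have l2 := pB.2 0 0 z z; rewrite h1 in l1; rewrite h2 in l2.
  by split; [apply: cvgn_uniq l1 _|apply: cvgn_uniq l2 _]; exact: cvg_cst.
- by split=> // [n|]; [have [] := kt n|exact: lim1].
- by split=> //; exact: lim1.
move=> x y xh yh.
have [a [b [_ _ kab]]] := plim_grad pA (xh : N (x, y).1 < _) (yh : N (x, y).2 < _).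
have [c [d [_ _ kcd]]] := plim_grad pB (xh : N (x, y).1 < _) (yh : N (x, y).2 < _).
set r := x ^+ 2 + y ^+ 2.
have r1 : N r <= 1.
  have q (w : R) : N w < 2^-1 -> w ^+ 2 <= 2^-1.
    move=> w2; rewrite -real_normK ?num_real// expr2.
    by have := ler_pM (normr_ge0 w) (normr_ge0 w) (ltW w2) (ltW w2); clear; lra.
  rewrite ger0_norm ?addr_ge0 ?sqr_ge0//; have := q _ xh; have := q _ yh; rewrite /r; lra.
have lA := pA.2 x y (ltW xh) (ltW yh); have lB := pB.2 x y (ltW xh) (ltW yh).
have At n := le_trans (ev_le (A n) (ltW xh) (ltW yh)) (AB n).1.
have Bt n := le_trans (ev_le (B n) (ltW xh) (ltW yh)) (AB n).2.
have lt := lim1 _ ct _ r1; have le := lim1 _ ce _ r1.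
have argb w z : N w < 2^-1 -> N z <= del -> N (w + z) <= 2.
  by move=> h1 h2; rewrite (le_trans (ler_normD _ _))//; move: del16 h1 h2; clear; lra.
have h24 : (2 : R) < 4 by rewrite (ltr_nat R 2 4).
have lxA : (fun n => x + ev x y (A n)) @ \oo --> x + k1 (x, y).
  by apply: cvgD => //; exact: cvg_cst.
have lyB : (fun n => y + ev x y (B n)) @ \oo --> y + k2 (x, y).
  by apply: cvgD => //; exact: cvg_cst.
have lf1 := lim_ev p1f h24 (fun n => argb _ _ xh (At n)) (fun n => argb _ _ yh (Bt n)) lxA lyB.
have lf2 := lim_ev p2f h24 (fun n => argb _ _ xh (At n)) (fun n => argb _ _ yh (Bt n)) lxA lyB.
have kE n : cev (x +i* y) (x +i* - y) (k n) = ev x y (A n) +i* ev x y (B n).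
  rewrite /A /B !ev_reP cevM -polyCN -polyCN cevC.
  by case: (cev _ _ _) => u v /=; rewrite !(mul0r, mulN1r, oppr0, sub0r, opprK, subr0).
have nE n := cev_nform al (p1 n) (p2 n) (kE n) (erefl (t n).[r]).
have eE n : (e n).[r] = al * (1 + (t n).[r]) +
    (resonant (@complex.Re R) (nform al (cplx (p1 n) (p2 n)) (k n) (t n))).[r].
  by rewrite hornerD hornerZ hornerD hornerC.
have rE n := rotD_solve al (nform al (cplx (p1 n) (p2 n)) (k n) (t n)).
have DE n : cev (x +i* y) (x +i* - y) (rotD (k n.+1)) =
    (al * ev x y (A n.+1) - ev x y (B n.+1)
     + ((1 + (t n).[r]) * ev (x + ev x y (A n)) (y + ev x y (B n)) (p1 n) +
        al * ((t n).[r] * ev x y (A n)) - (t n).[r] * ev x y (B n))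
     - (x * ((e n).[r] - al * (1 + (t n).[r])) + y * (t n.+1).[r]))
    +i* (ev x y (A n.+1) + al * ev x y (B n.+1)
     + ((1 + (t n).[r]) * ev (x + ev x y (A n)) (y + ev x y (B n)) (p2 n) +
        (t n).[r] * ev x y (A n) + al * ((t n).[r] * ev x y (B n)))
     - (y * ((e n).[r] - al * (1 + (t n).[r])) - x * (t n.+1).[r])).
  have := rec n; have := rE n; have := nE n; have := eE n; have := kE n.+1.
  move: (nform _ _ _ _) => nf kE1 eE1 nE1 rE1 [kn tn]; rewrite -kn in rE1.
  rewrite rE1 cevB cevD nE1 [cev _ _ (_ * k _)]cevM kE1 [cev _ _ ('X * _)]cevM cevX.
  rewrite cevD [cev _ _ (_ * embed _)]cevM !cevC !cev_embed -/r.
  have -> : (resonant (@complex.Im R) nf).[r] = - (t n.+1).[r] by rewrite tn hornerN opprK.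
  exact: complex_split.
have DE2 n : complex.Re (cev (x +i* y) (x +i* - y) (rotD (- ('i)%:P%:P * k n.+1))) =
    complex.Im (cev (x +i* y) (x +i* - y) (rotD (k n.+1))).
  rewrite rotDM -polyCN -polyCN rotDC mul0r add0r cevM cevC.
  by case: (cev _ _ _) => u v /=; rewrite !(mul0r, mulN1r, oppr0, sub0r, opprK, subr0).
have lt' := cvgn_shift lt; have lA' := cvgn_shift lA; have lB' := cvgn_shift lB.
have l1t := limD (@limC 1) lt; have lee := limD le (limN (limM (@limC al) l1t)).
exists a, b, c, d => /=; split=> //.
  pose L := al * k1 (x, y) - k2 (x, y) + ((1 + T r) * f1 (x + k1 (x, y), y + k2 (x, y)) +
    al * (T r * k1 (x, y)) - T r * k2 (x, y)) - (x * (H r - al * (1 + T r)) + y * T r).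
  have hL := rotation_limit (k := k) (L := L) pA xh yh kab.
  have -> : - y * (1 + a) + x * b = L - y.
    rewrite -hL; first by ring.
    rewrite (funext (fun n => congr1 (@complex.Re R) (DE n))).
    exact: (limD (limD (limD (limM (@limC al) lA') (limN lB'))
      (limD (limD (limM l1t lf1) (limM (@limC al) (limM lt lA))) (limN (limM lt lB))))
      (limN (limD (limM (@limC x) lee) (limM (@limC y) lt')))).
  by rewrite /L; ring.
pose L := k1 (x, y) + al * k2 (x, y) + ((1 + T r) * f2 (x + k1 (x, y), y + k2 (x, y)) +
    T r * k1 (x, y) + al * (T r * k2 (x, y))) - (y * (H r - al * (1 + T r)) - x * T r).
have hL := rotation_limit (k := fun n => - ('i)%:P%:P * k n) (L := L) pB xh yh kcd.
have -> : - y * c + x * (1 + d) = L + x.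
  rewrite -hL; first by ring.
  rewrite (funext (fun n => etrans (DE2 n) (congr1 (@complex.Im R) (DE n)))).
  exact: (limD (limD (limD lA' (limM (@limC al) lB'))
    (limD (limD (limM l1t lf2) (limM lt lA)) (limM (@limC al) (limM lt lB))))
    (limN (limD (limM (@limC y) lee) (limN (limM (@limC x) lt'))))).
by rewrite /L; ring.
Qed.

End NormalForm.

(** * The normal form of a planar field with non-real eigenvalues *)

Section TwistedRotation.
Variable R : realType.
Notation N := (@Num.norm _ R).

Let sN := @seminorm_normr R.

(* The inner product of the perturbed equation with v gives v = 0. *)
Lemma perp_small_perturbation (a b c d v1 v2 h x y : R) :
  N a <= 4^-1 -> N b <= 4^-1 -> N c <= 4^-1 -> N d <= 4^-1 ->
  (1 + a) * v1 + b * v2 = h * x -> c * v1 + (1 + d) * v2 = h * y ->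
  x * v1 + y * v2 = 0 -> h * x = 0 /\ h * y = 0.
Proof.
move=> a4 b4 c4 d4 e1 e2 e3.
have e : ((1 + a) * v1 + b * v2) * v1 + (c * v1 + (1 + d) * v2) * v2 = 0.
  by rewrite e1 e2 -!mulrA -mulrDr e3 mulr0.
have ha : - (4^-1 * v1 ^+ 2) <= a * v1 ^+ 2.
  by rewrite -mulNr ler_wpM2r ?sqr_ge0//; move: a4; rewrite ler_norml => /andP[].
have hd : - (4^-1 * v2 ^+ 2) <= d * v2 ^+ 2.
  by rewrite -mulNr ler_wpM2r ?sqr_ge0//; move: d4; rewrite ler_norml => /andP[].
have hp : N (v1 * v2) <= 2^-1 * (v1 ^+ 2 + v2 ^+ 2).
  have h1 := sqr_ge0 (v1 - v2); have h2 := sqr_ge0 (v1 + v2).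
  rewrite sqrrB in h1; rewrite sqrrD in h2; rewrite ler_norml; apply/andP; split; lra.
have hb : - (2^-1 * N (v1 * v2)) <= (b + c) * (v1 * v2).
  have : N ((b + c) * (v1 * v2)) <= 2^-1 * N (v1 * v2).
    rewrite normrM ler_wpM2r// (le_trans (ler_normD _ _))//; lra.
  by rewrite ler_norml => /andP[].
have v0 : v1 ^+ 2 + v2 ^+ 2 <= 0.
  have : v1 ^+ 2 + v2 ^+ 2 + a * v1 ^+ 2 + (b + c) * (v1 * v2) + d * v2 ^+ 2 = 0.
    by rewrite -e; ring.
  lra.
have q1 := sqr_ge0 v1; have q2 := sqr_ge0 v2.
have z1 : v1 = 0 by apply/eqP; rewrite -sqrf_eq0 eq_le q1 andbT; lra.
have z2 : v2 = 0 by apply/eqP; rewrite -sqrf_eq0 eq_le q2 andbT; lra.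
by rewrite -e1 -e2 z1 z2 !mulr0 !addr0.
Qed.

(** A Cauchy estimate from radius 1/2 to radius 1/4: the gradient is at most (1/16) / (1/4), the
    bound that [perp_small_perturbation] asks for. *)
Lemma plim_grad_le (del : R) A (k : R * R -> R) x y a b :
  plim 2^-1 A k -> (forall n, nrm N 2^-1 (A n) <= del) -> del <= 16^-1 ->
  N x <= 4^-1 -> N y <= 4^-1 -> grad k (x, y) a b -> N a <= 4^-1 /\ N b <= 4^-1.
Proof.
move=> Ak Ad del16 x4 y4 kab.
have h42 : (4^-1 : R) < 2^-1 by lra.
have [a' [b' [la lb kab']]] := plim_grad Ak
  (le_lt_trans x4 h42 : N (x, y).1 < _) (le_lt_trans y4 h42 : N (x, y).2 < _).
have [-> ->] := grad_uniq kab kab'.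
have bd n : nrm N 2^-1 (A n) / (2^-1 - 4^-1) <= 4^-1.
  rewrite (_ : 2^-1 - 4^-1 = 4^-1 :> R); last by field.
  by rewrite ler_pdivrMr ?invr_gt0// (le_trans (Ad n))// (le_trans del16)//; lra.
have idM (z : R) : N (@idfun R z) <= N z by [].
split; [apply: (cvgn_norm_le la) => n|apply: (cvgn_norm_le lb) => n].
  exact: le_trans (ev2_derX_le sN sN idM _ x4 y4 h42) (bd n).
exact: le_trans (ev2_derY_le sN sN idM _ x4 y4 h42) (bd n).
Qed.

Lemma grad_affine (k1 k2 : R * R -> R) (x y a b c d eps m n : R) :
  grad k1 (x, y) a b -> grad k2 (x, y) c d ->
  grad (fun v => eps * ((v.1 + k1 v) + m * (v.2 + k2 v))) (x, y)
    (eps * ((1 + a) + m * c)) (eps * (b + m * (1 + d))) /\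
  grad (fun v => eps * (n * (v.2 + k2 v))) (x, y) (eps * (n * c)) (eps * (n * (1 + d))).
Proof.
move=> g1 g2.
have h1 := gradD (grad_fst (x, y)) g1; have h2 := gradD (grad_snd (x, y)) g2.
have h3 := gradD h1 (gradM (grad_cst m (x, y)) h2).
split; [apply: grad_eq (gradM (grad_cst eps (x, y)) h3) _ _|
  apply: grad_eq (gradM (grad_cst eps (x, y)) (gradM (grad_cst n (x, y)) h2)) _ _];
  rewrite /=; ring.
Qed.

Lemma grad_lin_comp (f : R * R -> R) (m n a b : R) : grad f (0, 0) a b ->
  grad (fun v => f (v.1 + m * v.2, n * v.2)) (0, 0) a (a * m + b * n).
Proof.
move=> fab.
have g1 := gradD (grad_fst (0 : R, 0 : R)) (gradM (grad_cst m (0, 0)) (grad_snd (0, 0))).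
have g2 := gradM (grad_cst n (0 : R, 0 : R)) (grad_snd (0, 0)).
have fab' : grad f (((0 : R), (0 : R)).1 + m * ((0 : R), (0 : R)).2, n * ((0 : R), (0 : R)).2) a b.
  by rewrite /= !mulr0 addr0.
by apply: grad_eq (grad_comp fab' g1 g2) _ _ => /=; ring.
Qed.

Lemma analytic2_scale (c : R) f p : analytic2_at f p -> analytic2_at (fun v => c * f v) p.
Proof. by move=> fp; apply: analytic2M => //; exact: analytic2_cst. Qed.

(** A linear change L conjugates DX(0) / beta to multiplication by al + i, where beta is the
    imaginary part of an eigenvalue. The remainder (f1, f2), after a zoom, is the nonlinearity given
    to [normal_form]. *)
Lemma twisted_rotation (X : R * R -> R * R) (a b c d : R) :
  analytic2_at (fun q => (X q).1) (0, 0) -> analytic2_at (fun q => (X q).2) (0, 0) ->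
  X (0, 0) = (0, 0) ->
  grad (fun q => (X q).1) (0, 0) a b -> grad (fun q => (X q).2) (0, 0) c d ->
  (a - d) ^+ 2 + 4 * (b * c) < 0 ->
  exists (K1 K2 E1 E2 : R * R -> R) (beta : R) (t e : nat -> {poly R}) (T H : R -> R),
  [/\ 0 < beta /\ (K1 (0, 0) = 0 /\ K2 (0, 0) = 0),
    (forall v, N v.1 < 2^-1 -> N v.2 < 2^-1 -> analytic2_at K1 v /\ analytic2_at K2 v) /\
    (exists a b c d, [/\ grad K1 (0, 0) a b, grad K2 (0, 0) c d & a * d - b * c != 0]),
    [/\ cauchyN (pnorm N 1) t, forall n, pnorm N 1 (t n) <= 16^-1 &
      forall x, N x <= 1 -> (fun n => (t n).[x]) @ \oo --> T x],
    cauchyN (pnorm N 1) e /\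
      forall x, N x <= 1 -> (fun n => (e n).[x]) @ \oo --> H x &
    forall x y, N x < 4^-1 -> N y < 4^-1 -> exists a b c d,
      [/\ grad K1 (x, y) a b, grad K2 (x, y) c d,
        - y * a + x * b = (1 + T (x ^+ 2 + y ^+ 2)) / beta * (X (K1 (x, y), K2 (x, y))).1
          - H (x ^+ 2 + y ^+ 2) * E1 (x, y),
        - y * c + x * d = (1 + T (x ^+ 2 + y ^+ 2)) / beta * (X (K1 (x, y), K2 (x, y))).2
          - H (x ^+ 2 + y ^+ 2) * E2 (x, y) &
        forall v1 v2 h, a * v1 + b * v2 = h * E1 (x, y) -> c * v1 + d * v2 = h * E2 (x, y) ->
          x * v1 + y * v2 = 0 -> h * x = 0 /\ h * y = 0]].
Proof.
move=> X1an X2an X0 X1g X2g disc.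
pose al0 : R := (a + d) / 2; pose beta : R := Num.sqrt (- ((a - d) ^+ 2 + 4 * (b * c))) / 2.
have beta0 : 0 < beta by rewrite divr_gt0// sqrtr_gt0 oppr_gt0.
have bne : beta != 0 by rewrite gt_eqF.
have beta2 : beta ^+ 2 = - ((a - d) ^+ 2 + 4 * (b * c)) / 4.
  rewrite /beta expr_div_n sqr_sqrtr; last by rewrite oppr_ge0 ltW.
  by congr (_ / _); ring.
have cne : c != 0.
  by apply/eqP => c0; move: disc; rewrite c0 !mulr0 addr0 ltNge sqr_ge0.
(* L sends the basis vectors to (1, 0) and (m, n) = (DX(0) - al0) (1, 0) / beta, since
   multiplication by i maps the first basis vector to the second. It is invertible because c !=
   0. *)
pose m := (a - al0) / beta; pose n := c / beta; pose al := al0 / beta.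
have nne : n != 0 by rewrite mulf_neq0// invr_eq0.
clearbody beta.
have an1 : analytic2_at (fun v => (X (v.1 + m * v.2, n * v.2)).1) (0, 0).
  apply: (@analytic2_comp _ (fun q => (X q).1)).
  - by rewrite /= !mulr0 addr0.
  - apply: analytic2D; first exact: analytic2_fst.
    by apply: analytic2_scale; exact: analytic2_snd.
  - by apply: analytic2_scale; exact: analytic2_snd.
have an2 : analytic2_at (fun v => (X (v.1 + m * v.2, n * v.2)).2) (0, 0).
  apply: (@analytic2_comp _ (fun q => (X q).2)).
  - by rewrite /= !mulr0 addr0.
  - apply: analytic2D; first exact: analytic2_fst.
    by apply: analytic2_scale; exact: analytic2_snd.
  - by apply: analytic2_scale; exact: analytic2_snd.
have gr1 := grad_lin_comp m n X1g; have gr2 := grad_lin_comp m n X2g.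
pose f1 v := beta^-1 * (X (v.1 + m * v.2, n * v.2)).1
  + (- (m / (n * beta)) * (X (v.1 + m * v.2, n * v.2)).2 + (- al * v.1 + v.2)).
pose f2 v := (n * beta)^-1 * (X (v.1 + m * v.2, n * v.2)).2 + (- v.1 + - al * v.2).
have f1an : analytic2_at f1 (0, 0).
  apply: analytic2D; first exact: analytic2_scale.
  apply: analytic2D; first exact: analytic2_scale.
  by apply: analytic2D; [apply: analytic2_scale; exact: analytic2_fst|exact: analytic2_snd].
have f2an : analytic2_at f2 (0, 0).
  apply: analytic2D; first exact: analytic2_scale.
  by apply: analytic2D; [apply: analytic2N; exact: analytic2_fst|
    apply: analytic2_scale; exact: analytic2_snd].
have X0' : X (0 + m * 0, n * 0) = (0, 0) by rewrite !mulr0 addr0.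
have f10 : f1 (0, 0) = 0 by rewrite /f1 /= X0' /= !mulr0 !addr0.
have f20 : f2 (0, 0) = 0 by rewrite /f2 /= X0' /= !mulr0 oppr0 !addr0.
have g1 : grad f1 (0, 0) 0 0.
  have h := gradD (gradM (grad_cst beta^-1 (0, 0)) gr1)
    (gradD (gradM (grad_cst (- (m / (n * beta))) (0, 0)) gr2)
      (gradD (gradM (grad_cst (- al) (0, 0)) (grad_fst (0, 0))) (grad_snd (0, 0)))).
  apply: grad_eq h _ _; rewrite /= !mul0r !addr0 /al /m /n /al0; first by field; rewrite bne cne.
  have -> : b = (- 4 * beta ^+ 2 - (a - d) ^+ 2) / (4 * c) by rewrite beta2; field; rewrite cne.
  by field; rewrite bne cne.
have g2 : grad f2 (0, 0) 0 0.
  have h := gradD (gradM (grad_cst (n * beta)^-1 (0, 0)) gr2)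
    (gradD (gradM (grad_cst (- 1) (0, 0)) (grad_fst (0, 0)))
      (gradM (grad_cst (- al) (0, 0)) (grad_snd (0, 0)))).
  have -> : f2 = (fun v => (n * beta)^-1 * (X (v.1 + m * v.2, n * v.2)).2 +
     (- 1 * v.1 + - al * v.2)) by apply/funext => v; rewrite /f2 mulN1r.
  by apply: grad_eq h _ _; rewrite /= !mul0r !addr0 /al /m /n /al0; field; rewrite bne cne.
have dz (f : R * R -> R) : grad f (0, 0) 0 0 -> 'd f (0, 0) (1, 0) = 0 /\ 'd f (0, 0) (0, 1) = 0.
  by move=> [_ fd]; rewrite !fd !mul0r addr0.
pose del : R := (16 * (N al + 1))^-1.
have del0 : 0 < del by rewrite invr_gt0 mulr_gt0// ltr_wpDl.
have del16 : del <= 16^-1.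
  by rewrite lef_pV2 ?posrE ?mulr_gt0 ?ltr_wpDl// ler_peMr// lerDr.
have dd : 0 < del / 16 by rewrite divr_gt0.
have [r1 [r10 r1P]] := plim_rescale dd f1an f10 (dz _ g1).1 (dz _ g1).2.
have [r2 [r20 r2P]] := plim_rescale dd f2an f20 (dz _ g2).1 (dz _ g2).2.
have [eps [eps0 er1 er2]] : exists eps : R, [/\ 0 < eps, eps <= r1 & eps <= r2].
  by exists (Num.min r1 r2); rewrite lt_min r10 r20 !ge_min !lexx orbT.
have ene : eps != 0 by rewrite gt_eqF.
have e1 : 0 < eps <= r1 by rewrite eps0.
have e2 : 0 < eps <= r2 by rewrite eps0.
have [p1 [p1f p1d p10]] := r1P eps e1; have [p2 [p2f p2d p20]] := r2P eps e2.
have [A [B [k1 [k2 [t [e [T [H [[Ak Bk AB k0] [ct td tT] eH id]]]]]]]]] :=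
  normal_form erefl p1f p2f p1d p2d p10 p20.
have [k10 k20] := k0.
(* K = eps L (id + k) undoes the zoom and the linear change, and E = eps L is its linear model. *)
pose K1 (v : R * R) := eps * ((v.1 + k1 v) + m * (v.2 + k2 v)).
pose K2 (v : R * R) := eps * (n * (v.2 + k2 v)).
pose E1 (v : R * R) := eps * (v.1 + m * v.2); pose E2 (v : R * R) := eps * (n * v.2).
exists K1, K2, E1, E2, beta, t, e, T, H; split => //.
- by split=> //; rewrite /K1 /K2 /= k10 k20 !addr0 !mulr0 addr0 mulr0.
- split.
    move=> v v1 v2; have k1v := plim_analytic2_in Ak v1 v2; have k2v := plim_analytic2_in Bk v1 v2.
    have h2 : analytic2_at (fun v => v.2 + k2 v) v by apply: analytic2D => //; exact: analytic2_snd.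
    split; apply: analytic2_scale; last exact: analytic2_scale.
    apply: analytic2D; last exact: analytic2_scale.
    by apply: analytic2D => //; exact: analytic2_fst.
  have z2 : N (0 : R) < 2^-1 by rewrite normr0 invr_gt0.
  have z4 : N (0 : R) <= 4^-1 by rewrite normr0 invr_ge0.
  have [a1 [b1 [c1 [d1 [ka kc _ _]]]]] := id 0 0 z2 z2.
  have [K1g K2g] := grad_affine eps m n ka kc.
  exists (eps * ((1 + a1) + m * c1)), (eps * (b1 + m * (1 + d1))), (eps * (n * c1)),
    (eps * (n * (1 + d1))); split=> //.
  have [a4 b4] := plim_grad_le Ak (fun n => (AB n).1) del16 z4 z4 ka.
  have [c4 d4] := plim_grad_le Bk (fun n => (AB n).2) del16 z4 z4 kc.
  have -> : eps * (1 + a1 + m * c1) * (eps * (n * (1 + d1))) -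
    eps * (b1 + m * (1 + d1)) * (eps * (n * c1)) =
    eps ^+ 2 * n * ((1 + a1) * (1 + d1) - b1 * c1) by ring.
  apply: mulf_neq0; first by rewrite mulf_neq0 ?expf_neq0.
  (* The derivatives of k are at most 1/4, so (1 + a1) (1 + d1) >= 9/16 > 1/16 >= b1 c1. *)
  rewrite gt_eqF// subr_gt0.
  have h1 : N (b1 * c1) <= 4^-1 * 4^-1 by rewrite normrM ler_pM.
  apply: (le_lt_trans (ler_norm _)); apply: (le_lt_trans h1).
  have ga : 3 / 4 <= 1 + a1 by move: a4; rewrite ler_norml => /andP[? ?]; lra.
  have gd : 3 / 4 <= 1 + d1 by move: d4; rewrite ler_norml => /andP[? ?]; lra.
  have h34 : (0 : R) <= 3 / 4 by [].
  by apply: lt_le_trans (ler_pM h34 h34 ga gd); lra.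
- by split=> // i; rewrite (le_trans (td i)).
move=> x y x4 y4; have h42 : (4^-1 : R) < 2^-1 by lra.
have [a1 [b1 [c1 [d1 [ka kc]]]]] := id x y (lt_trans x4 h42) (lt_trans y4 h42).
have [K1g K2g] := grad_affine eps m n ka kc.
have [a4 b4] := plim_grad_le Ak (fun n => (AB n).1) del16 (ltW x4) (ltW y4) ka.
have [c4 d4] := plim_grad_le Bk (fun n => (AB n).2) del16 (ltW x4) (ltW y4) kc.
set r := x ^+ 2 + y ^+ 2 => I1 I2.
exists (eps * ((1 + a1) + m * c1)), (eps * (b1 + m * (1 + d1))), (eps * (n * c1)),
  (eps * (n * (1 + d1))).
split=> //.
- have -> : - y * (eps * (1 + a1 + m * c1)) + x * (eps * (b1 + m * (1 + d1))) =
    eps * ((- y * (1 + a1) + x * b1) + m * (- y * c1 + x * (1 + d1))) by ring.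
  rewrite I1 I2 /f1 /f2 /K1 /K2 /E1 /= -/r.
  have -> : eps * (x + k1 (x, y)) + m * (eps * (y + k2 (x, y))) =
    eps * (x + k1 (x, y) + m * (y + k2 (x, y))) by ring.
  have -> : n * (eps * (y + k2 (x, y))) = eps * (n * (y + k2 (x, y))) by ring.
  move: (k1 (x, y)) (k2 (x, y)) => x1 x2; set Xv := X (_, _); case: Xv => X1 X2 /=.
  by move: (H r) (T r) => Hr Tr; field; rewrite ene bne nne.
- have -> : - y * (eps * (n * c1)) + x * (eps * (n * (1 + d1))) =
    eps * n * (- y * c1 + x * (1 + d1)) by ring.
  rewrite I2 /f2 /K1 /K2 /E2 /= -/r.
  have -> : eps * (x + k1 (x, y)) + m * (eps * (y + k2 (x, y))) =
    eps * (x + k1 (x, y) + m * (y + k2 (x, y))) by ring.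
  have -> : n * (eps * (y + k2 (x, y))) = eps * (n * (y + k2 (x, y))) by ring.
  move: (k1 (x, y)) (k2 (x, y)) => x1 x2; set Xv := X (_, _); case: Xv => X1 X2 /=.
  by move: (H r) (T r) => Hr Tr; field; rewrite ene bne nne.
- move=> v1 v2 h; rewrite /E1 /E2 /= => q1 q2 q3.
  have nene : eps * n != 0 by rewrite mulf_neq0.
  have q2' : c1 * v1 + (1 + d1) * v2 = h * y.
    by apply: (mulfI nene); transitivity (h * (eps * (n * y))); [rewrite -q2; ring|ring].
  have q1' : (1 + a1) * v1 + b1 * v2 = h * x.
    apply: (mulfI ene); apply: (addIr (eps * m * (c1 * v1 + (1 + d1) * v2))).
    by rewrite {2}q2'; transitivity (h * (eps * (x + m * y))); [rewrite -q1; ring|ring].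
  exact: (perp_small_perturbation a4 b4 c4 d4 q1' q2' q3).
Qed.

End TwistedRotation.

(** * The normal form of a center has no radial part *)

Section NoTwist.
Variable R : realType.
Notation N := (@Num.norm _ R).

Let sN := @seminorm_normr R.

Lemma periodic_range (d : R -> R * R) (T : R) : 0 < T -> (forall t, d (t + T) = d t) ->
  forall t, exists2 s, `[0, T]%classic s & d s = d t.
Proof.
move=> T0 dT t; have Tn : T != 0 by rewrite gt_eqF.
have [t0|t0] := leP 0 t.
  have tT : 0 <= t / T by rewrite divr_ge0// ltW.
  exists (t - (Num.truncn (t / T))%:R * T); last exact: (periodic_nat dT _ t).2.
  have := truncn_itv tT; rewrite ler_pdivlMr// ltr_pdivrMr// -natr1 mulrDl mul1r => /andP[h1 h2].
  by rewrite /= in_itv /= subr_ge0 h1 /=; lra.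
have tT : 0 <= - t / T by rewrite divr_ge0 ?oppr_ge0// ltW.
exists (t + (Num.truncn (- t / T)).+1%:R * T); last exact: (periodic_nat dT _ t).1.
have := truncn_itv tT; rewrite ler_pdivlMr// ltr_pdivrMr// -natr1 mulrDl mul1r => /andP[h1 h2].
by rewrite /= in_itv /=; apply/andP; split; lra.
Qed.

(** The orbit is the image of one period, hence compact. The set D is there because the function to
    be minimized is controlled only where the coordinates of [no_twist] exist. *)
Lemma min_on_orbit (d : R -> R * R) (T t0 : R) (D : set (R * R)) (f : R * R -> R) :
  continuous d -> 0 < T -> (forall t, d (t + T) = d t) -> compact D ->
  (forall w, D w -> {for w, continuous f}) -> D (d t0) ->
  exists2 t1, D (d t1) & forall t, D (d t) -> f (d t1) <= f (d t).
Proof.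
move=> cd T0 dT cD cf Dt0.
have hd := @norm_hausdorff _ (R * R)%type.
have cI : compact (d @` `[0, T]%classic).
  apply: continuous_compact; last exact: segment_compact.
  exact: continuous_subspaceT.
have cA : compact (D `&` (d @` `[0, T]%classic)).
  apply: (subclosed_compact _ cD); last by move=> x [].
  by apply: closedI; apply: compact_closed.
have inI t : (d @` `[0, T]%classic) (d t).
  by have [s sI <-] := periodic_range T0 dT t; exists s.
have A0 : D `&` (d @` `[0, T]%classic) !=set0 by exists (d t0).
have wf : {within D `&` (d @` `[0, T]%classic), continuous f}.
  by apply: continuous_in_subspaceT => x /set_mem[Dx _]; exact: cf.
have [c /set_mem[Dc [t1 _ dc]] cmin] := compact_EVT_min A0 cA wf.
by exists t1; rewrite dc// => t Dt; apply: cmin; apply/mem_set.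
Qed.

(* At a point K zeta of a periodic orbit d that minimizes rho = |zeta|^2, the
   vector v = s zeta' - i zeta is orthogonal to zeta, and the equation for K
   says DK v = H E; this forces H rho = 0, and rho > 0 as d surrounds 0. *)
Lemma no_twist (Omega : set (R * R)) (X : R * R -> R * R) (K1 K2 E1 E2 : R * R -> R)
    (s H : R -> R) (a0 b0 c0 d0 : R) :
  analytic2_on Omega X -> is_center Omega X (0, 0) ->
  K1 (0, 0) = 0 -> K2 (0, 0) = 0 ->
  (forall v, N v.1 < 2^-1 -> N v.2 < 2^-1 -> analytic2_at K1 v /\ analytic2_at K2 v) ->
  grad K1 (0, 0) a0 b0 -> grad K2 (0, 0) c0 d0 -> a0 * d0 - b0 * c0 != 0 ->
  (forall x y, N x < 4^-1 -> N y < 4^-1 -> exists a b c d,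
      [/\ grad K1 (x, y) a b, grad K2 (x, y) c d,
        - y * a + x * b = s (x ^+ 2 + y ^+ 2) * (X (K1 (x, y), K2 (x, y))).1
          - H (x ^+ 2 + y ^+ 2) * E1 (x, y),
        - y * c + x * d = s (x ^+ 2 + y ^+ 2) * (X (K1 (x, y), K2 (x, y))).2
          - H (x ^+ 2 + y ^+ 2) * E2 (x, y) &
        forall v1 v2 h, a * v1 + b * v2 = h * E1 (x, y) -> c * v1 + d * v2 = h * E2 (x, y) ->
          x * v1 + y * v2 = 0 -> h * x = 0 /\ h * y = 0]) ->
  forall r0 : R, 0 < r0 -> exists r : R, [/\ 0 < r, r < r0 & H r = 0].
Proof.
move=> Xan [X0 [C [oC C0 CO cC]]] K10 K20 Kan g1 g2 det id r0 r00.
have z2 : N (0 : R) < 2^-1 by rewrite normr0 invr_gt0.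
have [K1a K2a] := Kan (0, 0) z2 z2.
have q4 : (0 : R) < 4^-1 by rewrite invr_gt0.
have [U [W [l1 [l2 [[oU U0 Ub] [oW W0] UP WP]]]]] :=
  inverse_function K1a K2a K10 K20 g1 g2 det q4.
have [u u0 uU] := open_box oU U0.
have [c c0' cC'] := open_box oC C0.
have [s1 s10 s1P] := continuous_box (analytic2_continuous K1a) c0'.
have [s2 s20 s2P] := continuous_box (analytic2_continuous K2a) c0'.
pose m := Num.min (Num.min u r0) (Num.min 1 (Num.min s1 s2)).
have m0 : 0 < m by rewrite !lt_min u0 r00 s10 s20 ltr01.
have [mu mr m1 ms1 ms2] : [/\ m <= u, m <= r0, m <= 1, m <= s1 & m <= s2].
  by rewrite /m !ge_min !lexx !orbT.
clearbody m; pose sg := m / 2; have sg0 : 0 < sg by rewrite divr_gt0.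
have sgm : sg < m by rewrite /sg; lra.
pose K v := (K1 v, K2 v).
have inC v : N v.1 <= sg -> N v.2 <= sg -> C (K v).
  move=> v1 v2; have h1 (q : R) : m <= q -> N (v.1 - 0) < q /\ N (v.2 - 0) < q.
    by rewrite !subr0 => mq; split; apply: lt_le_trans mq; exact: le_lt_trans sgm.
  apply: cC' => /=.
    by have [i1 i2] := h1 _ ms1; have := s1P v i1 i2; rewrite K10.
  by have [i1 i2] := h1 _ ms2; have := s2P v i1 i2; rewrite K20.
pose B := [set v : R * R | N v.1 <= sg /\ N v.2 <= sg].
have BU v : B v -> U v.
  by move=> [v1 v2]; apply: uU; rewrite subr0; apply: lt_le_trans mu; exact: le_lt_trans sgm.
have cK v : U v -> {for v, continuous K}.
  move=> Uv; have [_ _ _ k1 k2] := UP v Uv.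
  apply: differentiable_continuous.
  exact: (differentiable_pair (analytic2_differentiable k1) (analytic2_differentiable k2)).
have cB : compact B.
  have -> : B = `[- sg, sg]%classic `*` `[- sg, sg]%classic.
    have E (x : R) : `[- sg, sg]%classic x <-> N x <= sg by rewrite /= in_itv /= ler_norml.
    by apply/seteqP; split => v [h1 h2]; split; apply/E.
  by apply: compact_setX; exact: segment_compact.
have cD : compact (K @` B).
  apply: continuous_compact => //; apply: continuous_in_subspaceT => v /set_mem Bv.
  exact/cK/BU.
have zB : B (sg, 0) by split; rewrite /= ?normr0 ?ger0_norm// ltW.
pose q := K (sg, 0).
have Cq : C q by apply: inC; [exact: zB.1|exact: zB.2].
have qn0 : q <> (0, 0).
  move=> q0; have [_ l1q _ _ _] := UP _ (BU _ zB).
  have [_ l10 _ _ _] := UP _ U0.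
  move: q0 l1q; rewrite /q /K => -[-> ->]; move: l10; rewrite K10 K20 => -> /= e.
  by rewrite -e ltxx in sg0.
(* [is_center] only speaks of given solutions, so a local solution through q = K (sg, 0) has to be
   produced before a periodic one is obtained. *)
have [X1q X2q] := Xan q (CO _ Cq).
have [e [f1 [f2 [e0 fq df]]]] := ode_local_solution X1q X2q.
have [c' c'0 c'C] := open_box oC Cq.
have e00 : N (0 : R) < e by rewrite normr0.
have [df1 df2] := df 0 e00.
have [t1 t10 t1P] := derive_continuous1 df1 c'0.
have [t2 t20 t2P] := derive_continuous1 df2 c'0.
pose e' := Num.min e (Num.min t1 t2).
have e'0 : 0 < e' by rewrite !lt_min e0 t10 t20.
pose I := [set t : R | N t < e'].
have I0 : I 0 by rewrite /I /= normr0.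
have oI : open I.
  have -> : I = (fun t : R => N t) @^-1` [set x | x < e'] by [].
  apply: open_comp; last exact: open_lt.
  by move=> t _; exact: norm_continuous.
have iI : is_interval I.
  move=> x y; rewrite /I /= !ltr_norml => /andP[x1 x2] /andP[y1 y2] z /andP[xz zy].
  by rewrite ltr_norml (lt_le_trans x1 xz) (le_lt_trans zy y2).
have sol : is_solution Omega X I (fun t => (f1 t, f2 t)).
  move=> t; rewrite /I /= !lt_min => /and3P[i1 i2 i3]; split.
    apply/CO/c'C; rewrite -fq /=.
      by apply: t1P; rewrite subr0.
    by apply: t2P; rewrite subr0.
  by rewrite [X _]surjective_pairing; apply: is_derive_pair; have [] := df t i1.
have [d [[dsol [T [T0 dT]] _] dg [dn0 _]]] := cC q I _ Cq qn0 oI iI I0 sol fq.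
have dd t := (dsol t Logic.I).2.
have dq : d 0 = q by rewrite dg.
have cd : continuous d.
  move=> t; apply: differentiable_continuous; apply/derivable1_diffP.
  by have [] := dd t.
pose rho (w : R * R) := l1 w ^+ 2 + l2 w ^+ 2.
have KB w : (K @` B) w -> W w /\ B (l1 w, l2 w).
  move=> [v Bv <-]; have [Wv e1 e2 _ _] := UP v (BU v Bv).
  by split => //; rewrite /K e1 e2 -surjective_pairing.
have rc w : W w -> {for w, continuous rho}.
  move=> Ww; have [_ _ _ a1 a2] := WP w Ww; apply: analytic2_continuous.
  by apply: analytic2D; apply: analytic2M.
have Dd0 : (K @` B) (d 0) by rewrite dq; exists (sg, 0).
have [tm Dtm tmin] := min_on_orbit cd T0 dT cD (fun w Dw => rc w (KB w Dw).1) Dd0.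
have rsg : rho (d tm) <= sg ^+ 2.
  rewrite (le_trans (tmin 0 Dd0))// dq /rho /q.
  by have [_ e1 e2 _ _] := UP _ (BU _ zB); rewrite /K e1 e2 /= expr0n addr0.
have [Wtm Btm] := KB _ Dtm.
have [eps eps0 epsP] : exists2 eps : R, 0 < eps & forall t, N (t - tm) < eps -> W (d t).
  have /nbhs_ballP[eps /= eps0 epsP] : nbhs tm (d @^-1` W) by apply: cd; exact: open_nbhs_nbhs.
  by exists eps => // t tt; apply: epsP; rewrite /ball /= distrC.
(* The minimum over K(B) is a local minimum along the orbit: outside the square B, rho is at least
   sg^2, which is at least its value at tm. *)
have locmin t : N (t - tm) < eps -> rho (d tm) <= rho (d t).
  move=> /epsP Wt; have [Ut e1 e2 _ _] := WP _ Wt.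
  have [Bt|Bt] := pselect (B (l1 (d t), l2 (d t))).
    by apply: tmin; exists (l1 (d t), l2 (d t)) => //; rewrite /K e1 e2 -surjective_pairing.
  apply: (le_trans rsg); rewrite /rho.
  have sq (x y : R) : sg < N x -> sg ^+ 2 <= x ^+ 2 + y ^+ 2.
    move=> h; have h2 := sqr_ge0 y; rewrite -[x ^+ 2]real_normK ?num_real//.
    by have := ler_pM (ltW sg0) (ltW sg0) (ltW h) (ltW h); rewrite -!expr2; lra.
  have [h|h] := leP (N (l1 (d t))) sg; last exact: sq.
  have [h'|h'] := leP (N (l2 (d t))) sg; last by rewrite addrC; exact: sq.
  by exfalso; apply: Bt.
pose z1 t := l1 (d t); pose z2' t := l2 (d t).
have dz t : N (t - tm) < eps -> exists p1 p2, is_derive t (1 : R) z1 p1 /\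
    is_derive t (1 : R) z2' p2.
  move=> /epsP Wt; have [_ _ _ a1 a2] := WP _ Wt.
  have [ga [gb gg]] := analytic2_grad a1; have [gc [gd gg']] := analytic2_grad a2.
  have [dd1 dd2] := is_derive_fst (dd t).
  rewrite [d t]surjective_pairing in gg gg'.
  have h1 := grad_curve gg dd1 dd2; have h2 := grad_curve gg' dd1 dd2.
  do 2 eexists; split.
    have -> : z1 = (fun t => l1 ((d t).1, (d t).2)).
      by apply/funext => x; rewrite -surjective_pairing.
    exact: h1.
  have -> : z2' = (fun t => l2 ((d t).1, (d t).2)).
    by apply/funext => x; rewrite -surjective_pairing.
  exact: h2.
have tm0 : N (tm - tm) < eps by rewrite subrr normr0.
have [p1 [p2 [dz1 dz2]]] := dz tm tm0.
have rd : z1 tm * p1 + z2' tm * p2 = 0.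
  have dr t a b : is_derive t (1 : R) z1 a -> is_derive t (1 : R) z2' b ->
      is_derive t (1 : R) (fun t => rho (d t)) (2 * (z1 t * a + z2' t * b)).
    move=> h1 h2; pose p := (z1 t, z2' t).
    have h := grad_curve (gradD (gradM (grad_fst p) (grad_fst p))
      (gradM (grad_snd p) (grad_snd p))) h1 h2.
    have -> : (fun t => rho (d t)) = (fun t => z1 t * z1 t + z2' t * z2' t).
      by apply/funext => w; rewrite /rho !expr2.
    by apply: is_derive_eq h _; rewrite /p /=; ring.
  have inI t : t \in `]tm - eps, tm + eps[%R -> N (t - tm) < eps.
    by rewrite in_itv /= ltr_distl.
  have tin : tm \in `]tm - eps, tm + eps[%R.
    by rewrite in_itv /=; apply/andP; split; lra.
  have le : tm - eps <= tm + eps by lra.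
  have dm : is_derive tm (1 : R) (fun t => rho (d t)) 0.
    apply: (derive1_at_min le _ tin); last by move=> t /inI; exact: locmin.
    by move=> t /inI /dz[a [b [ha hb]]]; have [] := dr t a b ha hb.
  have [_ E1'] := dm; have [_ E2'] := dr tm p1 p2 dz1 dz2; rewrite E1' in E2'.
  by lra.
have [Bz1 Bz2] := Btm.
have [Uz e1 e2 _ _] := WP _ Wtm; have [u1 u2] := Ub _ Uz.
have [a [b [c1 [d1 [ka kc i1 i2 i3]]]]] := id _ _ u1 u2.
have Knear (Ki : R * R -> R) (pr : R * R -> R) x y (v : R) :
    (forall w, W w -> Ki (l1 w, l2 w) = pr w) ->
    grad Ki (z1 tm, z2' tm) x y -> is_derive tm (1 : R) (fun t => pr (d t)) v ->
    x * p1 + y * p2 = v.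
  move=> Kp gK [_ dv]; have [_ dv'] := grad_curve gK dz1 dz2; rewrite -dv -dv'.
  apply: near_eq_derive; exists eps => // t /= te; rewrite distrC in te.
  exact/Kp/epsP.
have [dd1 dd2] := is_derive_fst (dd tm).
have q1 := Knear K1 fst a b _ (fun w Ww => let: And5 _ e _ _ _ := WP w Ww in e) ka dd1.
have q2 := Knear K2 snd c1 d1 _ (fun w Ww => let: And5 _ _ e _ _ := WP w Ww in e) kc dd2.
rewrite /= e1 e2 -surjective_pairing in i1 i2.
set x := l1 (d tm) in i1 i2 i3 u1 Bz1 ka kc e1 e2 Uz Btm rd.
set y := l2 (d tm) in i1 i2 i3 u2 Bz2 ka kc e1 e2 Uz Btm rd.
set r := x ^+ 2 + y ^+ 2 in i1 i2.
have [h1 h2] : H r * x = 0 /\ H r * y = 0.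
  apply: (i3 (s r * p1 + y) (s r * p2 - x)).
  - transitivity (s r * (a * p1 + b * p2) - (- y * a + x * b)); first by ring.
    by rewrite i1 q1; ring.
  - transitivity (s r * (c1 * p1 + d1 * p2) - (- y * c1 + x * d1)); first by ring.
    by rewrite i2 q2; ring.
  - transitivity (s r * (z1 tm * p1 + z2' tm * p2)); first by rewrite /z1 /z2' -/x -/y /=; ring.
    by rewrite rd mulr0.
have xy0 : (x, y) <> (0, 0).
  move=> -[x0 y0]; apply: dn0; exists tm => //.
  by rewrite [d tm]surjective_pairing -e1 -e2 x0 y0 K10 K20.
have r_pos : 0 < r.
  rewrite lt_neqAle addr_ge0 ?sqr_ge0// andbT eq_sym paddr_eq0 ?sqr_ge0// !sqrf_eq0.
  by apply/negP => /andP[/eqP x0 /eqP y0]; apply: xy0; rewrite x0 y0.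
exists r; split => //.
  apply: (le_lt_trans rsg); rewrite expr2.
  have : sg * sg <= sg * 1 by rewrite ler_wpM2l ?ltW// (lt_le_trans sgm).
  by move: sgm mr; lra.
have [hx|] := eqVneq x 0; last by move=> xn; apply: (mulIf xn); rewrite h1 mul0r.
have yn : y != 0 by apply/eqP => y0; apply: xy0; rewrite hx y0.
by apply: (mulIf yn); rewrite h2 mul0r.
Qed.

End NoTwist.

(** * Vanishing of H as a power series *)

Section RotationForm.
Variable R : realType.
Notation N := (@Num.norm _ R).

Let sN := @seminorm_normr R.
Let s1 : seminorm (pnorm N 1). Proof. exact/seminorm_pnorm/ler01/sN. Qed.

Lemma pnorm_drop m (p : {poly R}) : pnorm N 1 (drop_poly m p) <= pnorm N 1 p.
Proof.
have sz : (size (drop_poly m p) <= size p)%N by rewrite size_drop_poly leq_subr.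
rewrite (pnorm_widen sN 1 sz) (pnorm_widen sN 1 (leq_addl m (size p))) big_split_ord /=.
rewrite -[leLHS]add0r lerD//; first by apply: sumr_ge0 => i _; rewrite expr1n mulr1.
by apply: ler_sum => i _; rewrite !expr1n coef_drop_poly addnC.
Qed.

(** B is independent of m. This is used twice below: at one m to detect the first non-zero
    coefficient, and for m tending to infinity once all coefficients vanish. *)
Lemma power_series_remainder (q : nat -> {poly R}) (H : R -> R) :
  cauchyN (pnorm N 1) q -> (forall x, N x <= 1 -> (fun n => (q n).[x]) @ \oo --> H x) ->
  exists (h : nat -> R) (B : R), 0 < B /\ forall m x, N x <= 1 ->
    N (H x - \sum_(i < m) h i * x ^+ i) <= B * N x ^+ m.
Proof.
move=> cq qH; have [B B0 qB] := cauchyN_bounded s1 cq.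
have coefl i : exists l : R, (fun n => (q n)`_i) @ \oo --> l.
  apply: cauchyN_cvg; apply: (cauchyN_le s1 ler01 _ cq) => n m.
  rewrite mul1r -coefB.
  by have := coef_le_pnorm sN (q n - q m) i ler01; rewrite expr1n mulr1.
have [h hP] := choice coefl.
exists h, B; split=> // m x x1.
have lims : (fun n => \sum_(i < m) (q n)`_i * x ^+ i) @ \oo --> \sum_(i < m) h i * x ^+ i.
  by apply: cvgn_sum => i; apply: limM; [exact: hP|exact: limC].
apply: (cvgn_norm_le (limD (qH x x1) (limN lims))) => n.
have -> : (q n).[x] - \sum_(i < m) (q n)`_i * x ^+ i = (drop_poly m (q n)).[x] * x ^+ m.
  rewrite -{1}(poly_take_drop m (q n)) hornerD hornerM hornerXn.
  rewrite (horner_coef_wide x (size_take_poly m (q n))).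
  rewrite addrAC (_ : \sum_(i < m) (take_poly m (q n))`_i * x ^+ i - _ = 0) ?add0r//.
  by apply/eqP; rewrite subr_eq0; apply/eqP; apply: eq_bigr => i _; rewrite coef_take_poly ltn_ord.
rewrite normrM normrX ler_wpM2r ?exprn_ge0// (le_trans _ (qB n))//.
exact: le_trans (horner_le_pnorm sN _ x1) (pnorm_drop _ _).
Qed.

(** If h m were the first non-zero coefficient, a zero r of H would satisfy |h m| r^m <= B r^(m+1),
    which fails for r < |h m| / B. *)
Lemma zeros_isolated (q : nat -> {poly R}) (H : R -> R) :
  cauchyN (pnorm N 1) q -> (forall x, N x <= 1 -> (fun n => (q n).[x]) @ \oo --> H x) ->
  (forall r0 : R, 0 < r0 -> exists r : R, [/\ 0 < r, r < r0 & H r = 0]) ->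
  forall x, N x < 1 -> H x = 0.
Proof.
move=> cq qH Hz; have [h [B [B0 hB]]] := power_series_remainder cq qH.
have h0 i : h i = 0.
  apply/eqP/negP => /negP hi0; have ex : exists i, h i != 0 by exists i.
  have [m hm mmin] := ex_minnP ex.
  have hlt j : (j < m)%N -> h j = 0.
    by move=> jm; apply/eqP/negP => /negP /mmin; rewrite leqNgt jm.
  have r0 : 0 < Num.min 1 (N (h m) / B) by rewrite lt_min ltr01 divr_gt0// normr_gt0.
  have [r [r_gt0 rlt Hr]] := Hz _ r0.
  move: rlt; rewrite lt_min => /andP[r1 rB].
  have Nr : N r = r by rewrite gtr0_norm.
  have := hB m.+1 r; rewrite Nr => /(_ (ltW r1)).
  rewrite Hr big_ord_recr /= big1 ?add0r; last by move=> i0 _; rewrite hlt ?mul0r.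
  rewrite normrN normrM normrX Nr exprS mulrA ler_pM2r ?exprn_gt0//.
  by rewrite leNgt mulrC -ltr_pdivlMr// rB.
move=> x x1; have Hx m : N (H x) <= B * N x ^+ m.
  have := hB m x (ltW x1); rewrite big1 ?subr0// => i _.
  by rewrite h0 mul0r.
have l0 : (fun m => B * N x ^+ m) @ \oo --> B * 0.
  by apply: limM; [exact: limC|apply: cvg_expr; rewrite normr_id].
apply/eqP/negP => /negP Hn0; have Hp : 0 < N (H x) / 2 by rewrite divr_gt0// normr_gt0.
have [n0 /(_ n0 (leqnn _))] := (cvgnP _ _).1 l0 _ Hp.
rewrite mulr0 subr0 => /(le_trans (ler_norm _))/(le_trans (Hx n0)).
by move: Hp; lra.
Qed.

Lemma rotation_form (Omega : set (R * R)) (X : R * R -> R * R) (a b c d : R) :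
  analytic2_on Omega X -> Omega (0, 0) -> is_center Omega X (0, 0) ->
  grad (fun q => (X q).1) (0, 0) a b -> grad (fun q => (X q).2) (0, 0) c d ->
  a * d - b * c != 0 ->
  exists (K1 K2 : R * R -> R) (beta : R) (t : nat -> {poly R}) (T : R -> R),
  [/\ 0 < beta /\ (K1 (0, 0) = 0 /\ K2 (0, 0) = 0),
    (forall v, N v.1 < 2^-1 -> N v.2 < 2^-1 -> analytic2_at K1 v /\ analytic2_at K2 v) /\
    (exists a b c d, [/\ grad K1 (0, 0) a b, grad K2 (0, 0) c d & a * d - b * c != 0]),
    [/\ cauchyN (pnorm N 1) t, forall n, pnorm N 1 (t n) <= 16^-1 &
      forall x, N x <= 1 -> (fun n => (t n).[x]) @ \oo --> T x] &
    forall x y, N x < 4^-1 -> N y < 4^-1 -> exists a b c d,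
      [/\ grad K1 (x, y) a b, grad K2 (x, y) c d,
        - y * a + x * b = (1 + T (x ^+ 2 + y ^+ 2)) / beta * (X (K1 (x, y), K2 (x, y))).1 &
        - y * c + x * d = (1 + T (x ^+ 2 + y ^+ 2)) / beta * (X (K1 (x, y), K2 (x, y))).2]].
Proof.
move=> Xan O0 cX g1 g2 det; have [X0 _] := cX; have [X1an X2an] := Xan _ O0.
have disc := center_negative_discriminant X1an X2an cX g1 g2 det.
have [K1 [K2 [E1 [E2 [beta [t [e [T [H [[b0 [K10 K20]] [Kan Kg] [ct tb tT] [ce eH] id]]]]]]]]]] :=
  twisted_rotation X1an X2an X0 g1 g2 disc.
have [a1 [b1 [c1 [d1 [k1 k2 kdet]]]]] := Kg.
have Hz := no_twist (s := fun r => (1 + T r) / beta) Xan cX K10 K20 Kan k1 k2 kdet id.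
have H0 := zeros_isolated ce eH Hz.
exists K1, K2, beta, t, T; split=> // x y x4 y4.
have [a2 [b2 [c2 [d2 [h1 h2 i1 i2 _]]]]] := id x y x4 y4.
have r1 : N (x ^+ 2 + y ^+ 2) < 1.
  have q (w : R) : N w < 4^-1 -> w ^+ 2 <= 4^-1.
    move=> w2; rewrite -real_normK ?num_real// expr2.
    by have := ler_pM (normr_ge0 w) (normr_ge0 w) (ltW w2) (ltW w2); lra.
  rewrite ger0_norm ?addr_ge0 ?sqr_ge0//; have := q _ x4; have := q _ y4; lra.
by exists a2, b2, c2, d2; split=> //; [rewrite i1|rewrite i2]; rewrite H0// mul0r subr0.
Qed.

End RotationForm.

(** * Potential *)

Section Potential.
Variable R : realType.
Notation C := R[i].
Notation P := {poly {poly R}}.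
Notation PC := {poly {poly R[i]}}.
Notation N := (@Num.norm _ R).
Local Open Scope complex_scope.

Let sN := @seminorm_normr R.
Let sC := seminorm_cmod R.
Let s1 : seminorm (pnorm N 1). Proof. exact/seminorm_pnorm/ler01/sN. Qed.
Let h0 : (0 : R) <= 2^-1. Proof. by rewrite invr_ge0. Qed.

Definition cst_in_y (p : {poly R}) : P := map_poly polyC p.

Lemma ev2_cst_in_y (A : comNzRingType) (iota : {rmorphism R -> A}) (a b : A) p :
  ev2 iota a b (cst_in_y p) = (map_poly iota p).[a].
Proof.
elim/poly_ind : p => [|p c IH].
  by rewrite /cst_in_y !rmorph0 horner0.
rewrite /cst_in_y rmorphD rmorphM /= map_polyX map_polyC ev2_cons IH map_polyC hornerC.
by rewrite [in RHS]rmorphD rmorphM /= map_polyX map_polyC hornerMXaddC.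
Qed.

Lemma ev_cst_in_y x y p : ev x y (cst_in_y p) = p.[x].
Proof. by rewrite /ev ev2_cst_in_y map_poly_id. Qed.

Lemma cst_in_yB p q : cst_in_y (p - q) = cst_in_y p - cst_in_y q.
Proof. exact: rmorphB. Qed.

Lemma nrm_cst_in_y r p : 0 <= r -> nrm N r (cst_in_y p) <= pnorm N r p.
Proof.
move=> r0; apply: (pnorm_map p sN (seminorm_pnorm sN r0) r0) => x.
by rewrite pnormC.
Qed.

Lemma plim_cst_in_y r (q : nat -> {poly R}) : 0 <= r -> cauchyN (pnorm N r) q ->
  exists g : R -> R, plim r (fun n => cst_in_y (q n)) (fun v => g v.1) /\
    forall x, N x <= r -> (fun n => (q n).[x]) @ \oo --> g x.
Proof.
move=> r0 cq.
have cq' : cauchyN (nrm N r) (fun n => cst_in_y (q n)).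
  apply: (cauchyN_le (seminorm_pnorm sN r0) ler01 _ cq) => n m.
  by rewrite mul1r -cst_in_yB nrm_cst_in_y.
have [_ pl] := plim_exists cq'.
exists (fun x => limn (fun n => ev x 0 (cst_in_y (q n)))).
have lx x : N x <= r ->
    (fun n => (q n).[x]) @ \oo --> limn (fun n => ev x 0 (cst_in_y (q n))).
  move=> xr; have := pl x 0 xr; rewrite normr0 => /(_ r0).
  by rewrite (funext (fun n => ev_cst_in_y x 0 (q n))).
split=> //; split=> // x y xr yr; rewrite (funext (fun n => ev_cst_in_y x y (q n))).
exact: lx.
Qed.

(* The mean of x^(2m) over the circle x^2 + y^2 = rho is rho^m / central m, so
   the mean of spread t (x) over that circle is t (rho). *)
Definition central (m : nat) : R := 4 ^+ m / ('C(m.*2, m))%:R.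

Definition spread (t : {poly R}) : {poly R} :=
  \poly_(i < (size t).*2) (if odd i then 0 else central i./2 * t`_(i./2)).

Lemma coef_spread t i :
  (spread t)`_i = if odd i then 0 else central i./2 * t`_(i./2).
Proof.
rewrite coef_poly; case: ltnP => // ti; case: ifP => // _.
by rewrite [t`__]nth_default ?mulr0// -[size t]doubleK half_leq.
Qed.

Lemma spreadB t u : spread (t - u) = spread t - spread u.
Proof.
apply/polyP => i; rewrite coefB !coef_spread coefB.
by case: ifP => _; rewrite ?subr0// mulrBr.
Qed.

Lemma sum_even (f : nat -> R) n : (forall i, odd i -> f i = 0) ->
  \sum_(i < n.*2) f i = \sum_(m < n) f m.*2.
Proof.
move=> fo; elim: n => [|n IH]; first by rewrite !big_ord0.
rewrite doubleS !big_ord_recr /= IH -/(n.*2.+1) (fo n.*2.+1) ?addr0//=.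
by rewrite odd_double.
Qed.

(** [central m] is at most 4^m, which the weight (1/2)^(2m) at radius 1/2 compensates. *)
Lemma pnorm_spread t : pnorm N 2^-1 (spread t) <= pnorm N 1 t.
Proof.
rewrite (pnorm_widen sN 2^-1 (size_poly _ _)).
rewrite (sum_even (f := fun i => N (spread t)`_i * 2^-1 ^+ i)); last first.
  by move=> i io; rewrite coef_spread io normr0 mul0r.
apply: ler_sum => m _; rewrite coef_spread odd_double doubleK normrM expr1n mulr1.
rewrite mulrAC -[leRHS]mul1r ler_wpM2r// /central -mul2n exprM.
have e : (2^-1 : R) ^+ 2 = 4^-1 by rewrite expr2; field.
have cm : (1 : R) <= ('C(2 * m, m))%:R by rewrite ler1n bin_gt0 leq_pmull.
rewrite e normrM normrX normfV [N 4]ger0_norm// [N _%:R]ger0_norm//.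
rewrite mulrAC -exprMn divff// expr1n mul1r.
by rewrite invf_le1// (lt_le_trans _ cm).
Qed.

(** The coordinate x, written as (z + conj z) / 2. *)
Definition midpoint : PC := ((2^-1)%:C)%:P%:P * ('X + 'X%:P).

Definition spreadC (t : {poly R}) : PC :=
  ev2 (@emb1 R \o @rcC R) midpoint 0 (cst_in_y (spread t)).

Lemma spreadCB t u : spreadC (t - u) = spreadC t - spreadC u.
Proof. by rewrite /spreadC spreadB cst_in_yB ev2B. Qed.

Lemma nrm_spreadC t : nrm (@cmod R) 2^-1 (spreadC t) <= pnorm N 1 t.
Proof.
have s2 := seminorm_nrm sC h0.
apply: le_trans (pnorm_spread t); apply: le_trans (nrm_cst_in_y _ h0).
have ir (z : R) : nrm (@cmod R) 2^-1 ((@emb1 R \o @rcC R) z) <= N z.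
  by rewrite /= nrmCC// cmod_real.
apply: (ev2_le sN s2 ir); last by rewrite (seminorm0 s2).
have c1 : nrm (@cmod R) 2^-1 (((2^-1)%:C)%:P%:P : PC) <= 2^-1.
  by rewrite nrmCC// cmod_real ger0_norm.
have hX := nrmX sC (@cmod1 R) h0; have hY := nrmY sC (@cmod1 R) h0.
have e : (2^-1 * (2^-1 + 2^-1) : R) = 2^-1 by field.
apply: (le_trans (seminormMle s2 c1 (le_trans (seminormD s2 _ _) (lerD hX hY)))).
by rewrite e.
Qed.

Lemma cev_spreadC x y t : cev (x +i* y) (x +i* - y) (spreadC t) = ((spread t).[x])%:C.
Proof.
rewrite /spreadC cev_sub ev2_cst_in_y /midpoint cevM cevC cevD cevX cevY.
have -> : (2^-1)%:C * ((x +i* y) + (x +i* - y)) = x%:C :> C.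
  by apply/eqP; rewrite eq_complex /=; apply/andP; split; apply/eqP; field.
by rewrite horner_map.
Qed.

Lemma coef_binomial n a b :
  (('X + 'X%:P : PC) ^+ n)`_a`_b = if (a + b == n)%N then ('C(n, b))%:R else 0.
Proof.
elim: n a b => [|n IH] a b.
  rewrite expr0 -polyC1 coefC; case: a => [|a]; last by rewrite coef0.
  by rewrite -polyC1 coefC; case: b => [|b].
rewrite exprS mulrDl !coefD coefXM coefCM coefXM.
case: a => [|a]; case: b => [|b] /=.
- by rewrite coef0 addr0.
- by rewrite coef0 add0r IH !add0n eqSS; case: eqP => // ->; rewrite !binn.
- by rewrite addr0 IH !addn0 eqSS; case: eqP => // _; rewrite !bin0.
- rewrite !IH !addSn !addnS eqSS; case: eqP => // _; last by rewrite addr0.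
  by rewrite -natrD -binS.
Qed.

(** The coefficient of (z conj z)^m in ((z + conj z) / 2)^(2m) is C(2m, m) / 4^m, which [central m]
    cancels. Hence spreadC t - embed t has no diagonal part, the one obstruction to inverting
    [rotD]. *)
Lemma spreadC_diag t m : (spreadC t)`_m`_m = (t`_m)%:C.
Proof.
have sz : (size (map_poly (@emb1 R \o @rcC R) (spread t)) <= m.*2.+1 + (size t).*2)%N.
  apply: leq_trans (leq_addl _ _); apply: leq_trans (size_poly _ _).
  exact: size_poly.
rewrite /spreadC ev2_cst_in_y (horner_coef_wide _ sz).
rewrite (@eq_bigr _ _ _ _ _ _ _ (fun i : 'I__ =>
  ((spread t)`_i * 2^-1 ^+ i)%:C%:P%:P * ('X + 'X%:P) ^+ i)); last first.
  by move=> i _; rewrite coef_map /= /midpoint exprMn mulrA -!rmorphXn /= -!rmorphM.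
rewrite coef_sum coef_sum.
rewrite (@eq_bigr _ _ _ _ _ _ _ (fun i : 'I__ => if (i : nat) == m.*2 then
  (central m * t`_m * 4^-1 ^+ m)%:C * ('C(m.*2, m))%:R else 0)); last first.
  move=> i _; rewrite coefCM coefCM coef_binomial addnn eq_sym.
  case: eqP => [->|_]; last by rewrite mulr0.
  rewrite coef_spread odd_double doubleK -mul2n exprM.
  by have -> : (2^-1 : R) ^+ 2 = 4^-1 by rewrite expr2; field.
rewrite -big_mkcond; move Ez : (_ * _ : C) => z.
rewrite (big_ord1_eq _ (fun=> z)) ltnS leq_addr -{z}Ez.
have cn : ('C(m.*2, m))%:R != 0 :> R by rewrite pnatr_eq0 -lt0n bin_gt0 -addnn leq_addr.
have -> : ('C(m.*2, m))%:R = (('C(m.*2, m))%:R : R)%:C :> C by rewrite rmorph_nat.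
rewrite -rmorphM /central; congr (_%:C).
have e : (4 : R) ^+ m * 4^-1 ^+ m = 1 by rewrite -exprMn divff// expr1n.
move: (_%:R) cn (4 ^+ m) (4^-1 ^+ m) e => c cn p q e.
by rewrite (_ : _ * c = p * q * t`_m * (c^-1 * c)); [rewrite e mulVf// mul1r mulr1|ring].
Qed.

(* Inverse of [rotD] off the diagonal monomials. *)
Definition unrot (a b : nat) : C := homological 0 a.+1 b.

Lemma rotD_unrot t : rotD (rx unrot (spreadC t)) = spreadC t - embed t.
Proof.
apply: poly2P => a b; rewrite coef_rotD coef_rx !coefB coef_embed /unrot /homological eqSS.
case: eqP => [->|ab]; first by rewrite mul0r mulr0 spreadC_diag subrr.
rewrite subr0 mulrA -[RHS]mul1r; congr (_ * _).
have -> : (0 +i* (a%:R - b%:R)) = (- 0 +i* (a.+1%:R - b%:R - 1)) :> C.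
  by apply/eqP; rewrite eq_complex /= -natr1; apply/andP; split; apply/eqP; ring.
rewrite mulfV// eq_complex /= negb_and; apply/orP; right.
rewrite -natr1 subr_eq0 subr_eq addrC; apply/eqP => h; apply: ab; apply/eqP.
by rewrite -(eqr_nat R); apply/eqP; move: h; lra.
Qed.

Lemma derY_intX_cst p : derY (intX (cst_in_y p)) = 0.
Proof.
apply/polyP => i; rewrite coef0 coef_map /= coef_scaleX coefMX.
case: i => [|i] /=; first by rewrite mulr0 deriv0.
by rewrite coef_map /= -polyCM derivC.
Qed.

(** The equation for phi is solvable because g x and T rho have the same mean on every circle.
    Inverting [rotD] costs a factor 2, and returning to real coordinates halves the radius from 1/2
    to 1/4. *)
Lemma potential (t : nat -> {poly R}) (T : R -> R) :
  cauchyN (pnorm N 1) t -> (forall n, pnorm N 1 (t n) <= 16^-1) ->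
  (forall x, N x <= 1 -> (fun n => (t n).[x]) @ \oo --> T x) ->
  exists (phi G : R * R -> R) (g : R -> R),
  [/\ phi (0, 0) = 0 /\ G (0, 0) = 0,
    forall v, N v.1 < 4^-1 -> N v.2 < 4^-1 -> analytic2_at phi v /\ analytic2_at G v,
    forall x, N x < 4^-1 -> N (g x) <= 16^-1 /\ analytic2_at (fun v => g v.1) (x, 0),
    forall x y, N x < 4^-1 -> N y < 4^-1 -> grad G (x, y) (1 + g x) 0 &
    forall x y, N x < 4^-1 -> N y < 4^-1 -> exists a b,
      grad phi (x, y) a b /\ - y * a + x * b = g x - T (x ^+ 2 + y ^+ 2)].
Proof.
move=> ct tb tT.
have cs : cauchyN (pnorm N 2^-1) (fun n => spread (t n)).
  by apply: (cauchyN_le s1 ler01 _ ct) => n m; rewrite mul1r -spreadB pnorm_spread.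
have [g [gl gx]] := plim_cst_in_y h0 cs.
have sN2 := seminorm_nrm sN h0.
have p1 : plim 2^-1 (fun n => 1%:P%:P + cst_in_y (spread (t n))) (fun v => 1 + g v.1).
  by apply: plimD => //; exact: plim_cst.
have cI : cauchyN (nrm N 2^-1) (fun n => intX (1%:P%:P + cst_in_y (spread (t n)))).
  apply: (cauchyN_le sN2 h0 _ p1.1) => n m.
  by rewrite /intX scaleXB -mulrBl nrm_intX.
have [G0 GP] : exists G0 : R * R -> R, plim 2^-1
    (fun n => intX (1%:P%:P + cst_in_y (spread (t n)))) G0 by eexists; exact: plim_exists.
pose k n := rx unrot (spreadC (t n)).
have h4 : (0 : R) <= 4^-1 by rewrite invr_ge0.
have h42 : (4^-1 : R) < 2^-1 by lra.
have h44 : (4^-1 + 4^-1 : R) = 2^-1 by field.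
have ck : cauchyN (nrm N 4^-1) (fun n => reP (k n)).
  apply: (cauchyN_le s1 (ler0n _ 2) _ ct) => n m.
  rewrite -rePB -rxB -spreadCB (le_trans (nrm_reP _ h4))// h44.
  apply: (le_trans (nrm_rx (c := 2) _ h0 _ _)) => //.
    by move=> i j; exact: cmod_homological.
  by rewrite ler_wpM2l// nrm_spreadC.
have [phi phiP] : exists f : R * R -> R, plim 4^-1 (fun n => reP (k n)) f.
  by eexists; exact: plim_exists.
exists phi, G0, g; split.
- have z4 : N (0 : R) <= 4^-1 by rewrite normr0.
  have z2 : N (0 : R) <= 2^-1 by rewrite normr0.
  split.
    apply: (cvgn_uniq (phiP.2 0 0 z4 z4)).
    rewrite (_ : (fun n => _) = (fun=> 0)); first exact: limC.
    apply/funext => n; rewrite /= ev_reP oppr0 cev00 coef_rx.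
    by rewrite /unrot /homological mul0r.
  apply: (cvgn_uniq (GP.2 0 0 z2 z2)).
  rewrite (_ : (fun n => _) = (fun=> 0)); first exact: limC.
  by apply/funext => n; rewrite ev00 coef0_intX coef0.
- move=> v v1 v2; split; first exact: plim_analytic2_in phiP v1 v2.
  exact: (plim_analytic2_in GP (lt_trans v1 h42) (lt_trans v2 h42)).
- move=> x x4; have xh := ltW (lt_trans x4 h42).
  split; last first.
    by apply: (plim_analytic2_in gl); rewrite /= ?normr0 ?invr_gt0// (lt_trans x4 h42).
  apply: (cvgn_norm_le (gx x xh)) => n; apply: le_trans (tb n).
  by apply: le_trans (pnorm_spread _); exact: horner_le_pnorm.
- move=> x y x4 y4; have x2 := lt_trans x4 h42; have y2 := lt_trans y4 h42.
  have [a [b [la lb gab]]] := plim_grad GP (x2 : N (x, y).1 < _) (y2 : N (x, y).2 < _).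
  apply: grad_eq gab _ _.
    apply: (cvgn_uniq la); have := p1.2 x y (ltW x2) (ltW y2).
    by under [X in _ -> X @ _ --> _]funext => n do rewrite deriv_intX.
  apply: (cvgn_uniq lb); rewrite (_ : (fun n => _) = (fun=> 0)); first exact: limC.
  apply/funext => n; have -> : 1%:P%:P + cst_in_y (spread (t n)) = cst_in_y (1 + spread (t n)).
    by rewrite /cst_in_y rmorphD /= !rmorph1.
  by rewrite derY_intX_cst /ev ev20.
- move=> x y x4 y4; have x2 := lt_trans x4 h42.
  have [a [b [_ _ gab]]] := plim_grad phiP (x4 : N (x, y).1 < _) (y4 : N (x, y).2 < _).
  exists a, b; split => //.
  apply: (rotation_limit (k := k) phiP x4 y4 gab).
  have r1 : N (x ^+ 2 + y ^+ 2) <= 1.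
    have q (w : R) : N w < 4^-1 -> w ^+ 2 <= 4^-1.
      move=> w2; rewrite -real_normK ?num_real// expr2.
      by have := ler_pM (normr_ge0 w) (normr_ge0 w) (ltW w2) (ltW w2); lra.
    rewrite ger0_norm ?addr_ge0 ?sqr_ge0//; have := q _ x4; have := q _ y4; lra.
  have E n : complex.Re (cev (x +i* y) (x +i* - y) (rotD (k n.+1))) =
      (spread (t n.+1)).[x] - (t n.+1).[x ^+ 2 + y ^+ 2].
    by rewrite /k rotD_unrot cevB cev_spreadC cev_embed.
  rewrite (funext E).
  exact: (limD (cvgn_shift (gx x (ltW x2))) (limN (cvgn_shift (tT _ r1)))).
Qed.

End Potential.

(** * Reciprocals, sine and cosine of analytic germs *)

Section AnalyticFunctions.
Variable R : realType.
Notation N := (@Num.norm _ R).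

Let sN := @seminorm_normr R.

Lemma grad_uniq_near (f g : R * R -> R) p a b c d (r : R) : 0 < r ->
  (forall v, N (v.1 - p.1) < r -> N (v.2 - p.2) < r -> f v = g v) ->
  grad f p a b -> grad g p c d -> a = c /\ b = d.
Proof.
move=> r0 fg gf gg.
have fgn : \near p, f p = g p.
  apply/nbhs_ballP; exists r => //= v [v1 v2]; apply: fg; rewrite distrC.
    exact: v1.
  exact: v2.
have E h k : a * h + b * k = c * h + d * k.
  by rewrite -(grad_derive h k gf) -(grad_derive h k gg); exact: near_eq_derive.
have := E 1 0; have := E 0 1; rewrite !(mulr0, mulr1, addr0, add0r) => -> ->.
by [].
Qed.

Lemma grad_fun_fst (g : R -> R) x y (d : R) : is_derive x (1 : R) g d ->
  grad (fun v => g v.1) (x, y) d 0.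
Proof.
move=> [dg gd]; have dg' := (derivable1_diffP _ _).1 dg.
have [df fE] := grad_fst (x, y).
have dg'' : differentiable g (fst (x, y)) by [].
split; first exact: differentiable_comp.
move=> h k; rewrite (diff_comp df dg'') /= fE mul1r mul0r !addr0.
rewrite -[in LHS](mulr1 h) -[h * 1]/(h *: (1 : R)) linearZ /= -deriveE// gd.
by rewrite /GRing.scale /= mulrC.
Qed.

Lemma power_series_analytic (q : nat -> {poly R}) (H : R -> R) :
  cauchyN (pnorm N 1) q -> (forall x, N x <= 1 -> (fun n => (q n).[x]) @ \oo --> H x) ->
  forall v, N v.1 < 1 -> N v.2 < 1 -> analytic2_at (fun v => H v.1) v.
Proof.
move=> cq qH v v1 v2.
apply: (@plim_analytic2_in _ 1 (fun n => cst_in_y (q n))) => //; split.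
  apply: (cauchyN_le (seminorm_pnorm sN ler01) ler01 _ cq) => n m.
  by rewrite mul1r -cst_in_yB nrm_cst_in_y.
move=> x y x1 y1; rewrite (funext (fun n => ev_cst_in_y x y (q n))).
exact: qH.
Qed.

Lemma cvgn_cauchy (u : R^nat) (l : R) : u @ \oo --> l -> cauchyN N u.
Proof.
move=> ul e e0; have e2 : 0 < e / 2 by rewrite divr_gt0.
have [n0 n0P] := (cvgnP _ _).1 ul _ e2; exists n0 => n m nn mm.
have := n0P n nn; have := n0P m mm; rewrite distrC => h1 h2.
by have := ler_distD l (u n) (u m); lra.
Qed.

(** The norm of radius 1 is dominated by the exponential series at 1. *)
Lemma entire_analytic (c : nat -> R) (f : R -> R) :
  (forall k, N (c k) <= (k`!%:R)^-1) ->
  (forall x, (fun n => \sum_(k < n) c k * x ^+ k) @ \oo --> f x) ->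
  analytic2_at (fun v => f v.1) (0, 0).
Proof.
move=> cb cf; pose q n := \poly_(k < n) c k.
pose e n := \sum_(k < n) (k`!%:R : R)^-1.
have ce : cauchyN N e.
  have /(cvgn_cauchy (l := _)) := is_cvg_series_exp_coeff (1 : R).
  congr (cauchyN _ _); apply/funext => n; rewrite /series /= big_mkord.
  by apply: eq_bigr => k _; rewrite /exp_coeff /= expr1n mul1r.
have key n m : (n <= m)%N -> pnorm N 1 (q m - q n) <= e m - e n.
  move=> nm; have sz : (size (q m - q n)%R <= m)%N.
    rewrite (leq_trans (size_polyD _ _))// size_polyN geq_max (size_poly _ _) /=.
    exact: leq_trans (size_poly _ _) nm.
  rewrite (pnorm_widen sN 1 sz) /e (big_ord_widen _ (fun k => (k`!%:R : R)^-1) nm).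
  rewrite (big_mkcond (fun i : 'I_m => (i < n)%N)) /= -sumrB; apply: ler_sum => k _.
  rewrite expr1n mulr1 coefB !coef_poly ltn_ord.
  by case: ifP => _; rewrite ?subrr ?normr0// !subr0.
have cq : cauchyN (pnorm N 1) q.
  move=> z z0; have [n0 n0P] := ce z z0; exists n0 => n m nn mm.
  have [nm|/ltnW mn] := leqP n m; last first.
    by rewrite (le_trans (key _ _ mn))// (le_trans (ler_norm _))// n0P.
  rewrite -opprB (seminormN (seminorm_pnorm sN ler01)) (le_trans (key _ _ nm))//.
  by rewrite (le_trans (ler_norm _))// n0P.
apply: (power_series_analytic cq) => /=; rewrite ?normr0//.
move=> x _; rewrite (funext (fun n => horner_poly n c x)).
exact: cf.
Qed.

Lemma inv_fact_sign (b : bool) (j k : nat) :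
  N (b%:R * (-1) ^+ j * (k`!%:R : R)^-1) <= (k`!%:R)^-1.
Proof.
rewrite !normrM normrX normrN1 expr1n mulr1 [N _^-1]ger0_norm ?invr_ge0//.
by case: b; rewrite ?normr1 ?normr0 ?mul1r// mul0r invr_ge0.
Qed.

Lemma analytic2_cos : analytic2_at (fun v => cos v.1) (0 : R, 0).
Proof.
apply: (@entire_analytic (fun k => (~~ odd k)%:R * (-1) ^+ k./2 * (k`!%:R)^-1)).
  by move=> k; exact: inv_fact_sign.
move=> x; rewrite cos.unlock (_ : (fun n => _) = series (cos_coeff x)).
  exact: is_cvg_series_cos_coeff.
apply/funext => n; rewrite /series /= big_mkord.
by apply: eq_bigr => k _; rewrite /cos_coeff /= -exprnP; ring.
Qed.

Lemma analytic2_sin : analytic2_at (fun v => sin v.1) (0 : R, 0).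
Proof.
apply: (@entire_analytic (fun k => (odd k)%:R * (-1) ^+ k.-1./2 * (k`!%:R)^-1)).
  by move=> k; exact: inv_fact_sign.
move=> x; rewrite sin.unlock (_ : (fun n => _) = series (sin_coeff x)).
  exact: is_cvg_series_sin_coeff.
apply/funext => n; rewrite /series /= big_mkord.
by apply: eq_bigr => k _; rewrite /sin_coeff /=; ring.
Qed.

Lemma analytic2_translate (F : R * R -> R) p :
  analytic2_at (fun v => F (p + v)) (0, 0) -> analytic2_at F p.
Proof.
move=> [c [r [r0 H]]]; exists c, r; split=> // v v1 v2.
by have [h1 h2] := H v v1 v2; split=> //; rewrite add0r in h2.
Qed.

(** The inverse function theorem is applied to (x, y) |-> (x, (a + x) (1/a + y) - 1). On the line
    where the second component of the image is 0, the inverse gives y = 1 / (a + x) - 1/a. *)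
Lemma analytic2_inv (f : R * R -> R) p : analytic2_at f p -> f p != 0 ->
  analytic2_at (fun v => (f v)^-1) p.
Proof.
move=> fp fn0; apply: (@analytic2_comp _ (fun v => v.1^-1) f (fun=> 0)) => //; last first.
  exact: analytic2_cst.
move: (f p) fn0 => a a0 {f fp p}; apply: analytic2_translate.
pose F2 (v : R * R) : R := (a + v.1) * (a^-1 + v.2) - 1.
have F2an : analytic2_at F2 (0, 0).
  apply: analytic2B; last exact: analytic2_cst.
  apply: analytic2M; apply: analytic2D; try exact: analytic2_cst.
    exact: analytic2_fst.
  exact: analytic2_snd.
have F20 : F2 (0, 0) = 0 by rewrite /F2 /= !addr0 mulfV// subrr.
have g2 : grad F2 (0, 0) a^-1 a.
  have h := gradD (gradM (gradD (grad_cst a (0, 0)) (grad_fst (0, 0)))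
    (gradD (grad_cst a^-1 (0, 0)) (grad_snd (0, 0)))) (grad_cst (- 1) (0, 0)).
  by apply: grad_eq h _ _; rewrite /=; ring.
have det : 1 * a - 0 * a^-1 != 0 by rewrite mul1r mul0r subr0.
have [U [W [l1 [l2 [_ [oW W0] _ WP]]]]] :=
  inverse_function (analytic2_fst (0, 0)) F2an (erefl : fst (0, 0) = 0 :> R) F20
    (grad_fst (0, 0)) g2 det ltr01.
have [_ _ _ _ l2an] := WP _ W0.
have [r r0 rW] := open_box oW W0.
have m0 : 0 < Num.min r (N a) by rewrite lt_min r0 normr_gt0.
apply: (@analytic2_eq _ (fun v => a^-1 + l2 (v.1, 0)) _ _ _ m0).
  apply: analytic2D; first exact: analytic2_cst.
  apply: (@analytic2_comp _ l2 fst (fun=> 0)) => //; first exact: analytic2_fst.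
  exact: analytic2_cst.
move=> v; rewrite !lt_min => /andP[v1 va] /andP[v2 _]; rewrite add0r /=.
have Wv : W (v.1, 0) by apply: rW; rewrite /= subr0 ?normr0.
have [_ /= e1 e2 _ _] := WP _ Wv; rewrite /F2 /= e1 in e2.
have av : a + v.1 != 0.
  apply: contraTneq va => av; rewrite (_ : v.1 = - a) ?normrN ?ltxx//.
  by apply/eqP; rewrite -addr_eq0 addrC av.
by apply: (mulfI av); rewrite mulfV//; apply/eqP; rewrite -subr_eq0 e2.
Qed.

Lemma grad_polar (psi : R * R -> R) x y p q : grad psi (x, y) p q ->
  grad (fun v => cos (psi v)) (x, y) (- sin (psi (x, y)) * p) (- sin (psi (x, y)) * q) /\
  grad (fun v => sin (psi v)) (x, y) (cos (psi (x, y)) * p) (cos (psi (x, y)) * q).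
Proof.
move=> g; have g0 := grad_cst (0 : R) (x, y).
have h1 := grad_fun_fst 0 (is_derive_cos (psi (x, y))).
have h2 := grad_fun_fst 0 (is_derive_sin (psi (x, y))).
split; [apply: grad_eq (grad_comp h1 g g0) _ _|apply: grad_eq (grad_comp h2 g g0) _ _];
  by rewrite mul0r addr0.
Qed.

End AnalyticFunctions.

Section PotentialForm.
Variable R : realType.
Notation N := (@Num.norm _ R).

Let sN := @seminorm_normr R.

(* K is precomposed with the rotation by the angle psi = phi / (1 + T rho);
   as rho is constant along the circles, the angular derivative of psi is
   (g x - T rho) / (1 + T rho), which turns the factor 1 + T rho into 1 + g x. *)
Lemma potential_form (Omega : set (R * R)) (X : R * R -> R * R) (a b c d : R) :
  analytic2_on Omega X -> Omega (0, 0) -> is_center Omega X (0, 0) ->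
  grad (fun q => (X q).1) (0, 0) a b -> grad (fun q => (X q).2) (0, 0) c d ->
  a * d - b * c != 0 ->
  exists (K1 K2 G : R * R -> R) (gam : R -> R),
  [/\ [/\ K1 (0, 0) = 0, K2 (0, 0) = 0 & G (0, 0) = 0],
    analytic2_at K1 (0, 0) /\ analytic2_at K2 (0, 0),
    exists a b c d, [/\ grad K1 (0, 0) a b, grad K2 (0, 0) c d & a * d - b * c != 0],
    forall v, N v.1 < 8^-1 -> N v.2 < 8^-1 ->
      [/\ analytic2_at G v, grad G v (gam v.1) 0, 0 < gam v.1 &
        analytic2_at (fun w => gam w.1) (v.1, 0)] &
    forall x y, N x < 8^-1 -> N y < 8^-1 -> exists a b c d,
      [/\ grad K1 (x, y) a b, grad K2 (x, y) c d,
        - y * a + x * b = gam x * (X (K1 (x, y), K2 (x, y))).1 &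
        - y * c + x * d = gam x * (X (K1 (x, y), K2 (x, y))).2]].
Proof.
move=> Xan O0 cX g1 g2 det.
have [K1 [K2 [beta [t [T [[b0 [K10 K20]] [Kan Kg] [ct tb tT] id]]]]]] :=
  rotation_form Xan O0 cX g1 g2 det.
have [a1 [b1 [c1 [d1 [k1 k2 kdet]]]]] := Kg.
have [phi [G [g [[phi0 G0] anP gb gG gphi]]]] := potential ct tb tT.
have bne : beta != 0 by rewrite gt_eqF.
have h84 : (8^-1 : R) < 4^-1 by lra.
pose rho (v : R * R) := v.1 * v.1 + v.2 * v.2.
have rho1 v : N v.1 < 4^-1 -> N v.2 < 4^-1 -> N (rho v) < 1.
  have q (w : R) : N w < 4^-1 -> N (w * w) <= 4^-1.
    by move=> w2; rewrite normrM; have := ler_pM (normr_ge0 w) (normr_ge0 w) (ltW w2) (ltW w2); lra.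
  move=> v1 v2; apply: (le_lt_trans (ler_normD _ _)).
  by have := q _ v1; have := q _ v2; lra.
have rhoan v : analytic2_at rho v.
  by apply: analytic2D; apply: analytic2M; try exact: analytic2_fst; exact: analytic2_snd.
pose S (v : R * R) := 1 + T (rho v).
have San v : N v.1 < 4^-1 -> N v.2 < 4^-1 -> analytic2_at S v.
  move=> v1 v2; apply: analytic2D; first exact: analytic2_cst.
  apply: (@analytic2_comp _ (fun v => T v.1) rho (fun=> 0)) => //; last exact: analytic2_cst.
  by apply: (power_series_analytic ct tT); rewrite /= ?normr0//; exact: rho1.
have S0 v : N v.1 < 4^-1 -> N v.2 < 4^-1 -> S v != 0.
  move=> v1 v2; have r1 := ltW (rho1 v v1 v2).
  have : N (T (rho v)) <= 16^-1.
    apply: (cvgn_norm_le (tT _ r1)) => n; apply: le_trans (tb n).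
    exact: horner_le_pnorm.
  by rewrite ler_norml => /andP[h _]; rewrite gt_eqF// /S; lra.
pose J v := (S v)^-1; pose psi v := phi v * J v.
have psian v : N v.1 < 4^-1 -> N v.2 < 4^-1 -> analytic2_at psi v.
  move=> v1 v2; apply: analytic2M; first by have [] := anP v v1 v2.
  by apply: analytic2_inv; [exact: San|exact: S0].
pose Z1 v := v.1 * cos (psi v) - v.2 * sin (psi v).
pose Z2 v := v.1 * sin (psi v) + v.2 * cos (psi v).
pose L1 v := K1 (Z1 v, Z2 v); pose L2 v := K2 (Z1 v, Z2 v).
have psi0 : psi (0, 0) = 0 by rewrite /psi phi0 mul0r.
have Z10 : Z1 (0, 0) = 0 by rewrite /Z1 /= !mul0r subrr.
have Z20 : Z2 (0, 0) = 0 by rewrite /Z2 /= !mul0r addr0.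
have z4 : N (0 : R) < 4^-1 by rewrite normr0 invr_gt0.
have z2 : N (0 : R) < 2^-1 by rewrite normr0 invr_gt0.
have can : analytic2_at (fun v => cos (psi v)) (0, 0).
  apply: (@analytic2_comp _ (fun v => cos v.1) psi (fun=> 0)); last exact: analytic2_cst.
    by rewrite psi0; exact: analytic2_cos.
  exact: psian.
have san : analytic2_at (fun v => sin (psi v)) (0, 0).
  apply: (@analytic2_comp _ (fun v => sin v.1) psi (fun=> 0)); last exact: analytic2_cst.
    by rewrite psi0; exact: analytic2_sin.
  exact: psian.
have Z1an : analytic2_at Z1 (0, 0).
  apply: analytic2B; apply: analytic2M => //; [exact: analytic2_fst|exact: analytic2_snd].
have Z2an : analytic2_at Z2 (0, 0).
  apply: analytic2D; apply: analytic2M => //; [exact: analytic2_fst|exact: analytic2_snd].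
have [K1an K2an] := Kan (0, 0) z2 z2.
have Zg x y p q : grad psi (x, y) p q ->
    grad Z1 (x, y) (cos (psi (x, y)) - Z2 (x, y) * p) (- sin (psi (x, y)) - Z2 (x, y) * q) /\
    grad Z2 (x, y) (sin (psi (x, y)) + Z1 (x, y) * p) (cos (psi (x, y)) + Z1 (x, y) * q).
  move=> pg; have [cg sg] := grad_polar pg.
  have gx := grad_fst (x, y); have gy := grad_snd (x, y).
  have m1 := gradD (gradM gx cg) (gradM (grad_cst (- 1) (x, y)) (gradM gy sg)).
  have m2 := gradD (gradM gx sg) (gradM gy cg).
  have -> : Z1 = (fun v => v.1 * cos (psi v) + - 1 * (v.2 * sin (psi v))).
    by apply/funext => v; rewrite mulN1r.
  by split; [apply: grad_eq m1 _ _|apply: grad_eq m2 _ _]; rewrite /Z1 /Z2 /=; ring.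
exists L1, L2, (fun v => beta^-1 * G v), (fun x => (1 + g x) / beta); split.
- by rewrite /L1 /L2 Z10 Z20 K10 K20 G0 mulr0.
- by split; apply: analytic2_comp => //; rewrite Z10 Z20.
- have [p [q pg]] := analytic2_grad (psian (0, 0) z4 z4).
  have [z1 z2'] := Zg 0 0 p q pg.
  rewrite Z10 Z20 psi0 cos0 sin0 !mul0r !subr0 !addr0 in z1 z2'.
  have k1' : grad K1 (Z1 (0, 0), Z2 (0, 0)) a1 b1 by rewrite Z10 Z20.
  have k2' : grad K2 (Z1 (0, 0), Z2 (0, 0)) c1 d1 by rewrite Z10 Z20.
  exists a1, b1, c1, d1; split; last exact: kdet.
    by apply: grad_eq (grad_comp k1' z1 z2') _ _; rewrite !(mulr1, mulr0, oppr0, addr0, add0r).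
  by apply: grad_eq (grad_comp k2' z1 z2') _ _; rewrite !(mulr1, mulr0, oppr0, addr0, add0r).
- move=> v v1 v2; have v14 := lt_trans v1 h84; have v24 := lt_trans v2 h84.
  split.
  + by apply: analytic2_scale; have [] := anP v v14 v24.
  + case: v v1 v2 v14 v24 => x y /= _ _ x4 y4.
    apply: grad_eq (gradM (grad_cst beta^-1 (x, y)) (gG x y x4 y4)) _ _.
      by rewrite mul0r addr0 mulrC.
    by rewrite mulr0 mul0r addr0.
  + rewrite divr_gt0//; have [] := gb _ v14; rewrite ler_norml => /andP[h _] _; lra.
  + have [_ gan] := gb _ v14; apply: analytic2M; last exact: analytic2_cst.
    by apply: analytic2D => //; exact: analytic2_cst.
move=> x y x8 y8; have x4 := lt_trans x8 h84; have y4 := lt_trans y8 h84.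
have [pa [pb [gp gpE]]] := gphi x y x4 y4.
have [sa [sb gs]] := analytic2_grad (San (x, y) x4 y4).
have [ja [jb gj]] := analytic2_grad (analytic2_inv (San (x, y) x4 y4) (S0 (x, y) x4 y4)).
have sE : - y * sa + x * sb = 0.
  have r1 := rho1 (x, y) x4 y4; have r0 : N (0 : R) < 1 by rewrite normr0.
  have [ta [tb' gt]] := analytic2_grad (power_series_analytic ct tT
    (r1 : N (rho (x, y), 0).1 < 1) (r0 : N (rho (x, y), 0 : R).2 < 1)).
  have gr := gradD (gradM (grad_fst (x, y)) (grad_fst (x, y)))
    (gradM (grad_snd (x, y)) (grad_snd (x, y))).
  have h := gradD (grad_cst 1 (x, y)) (grad_comp gt gr (grad_cst 0 (x, y))).
  by have [-> ->] := grad_uniq gs h; rewrite /=; ring.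
have Sne := S0 (x, y) x4 y4.
(* Differentiating S J = 1 along the circle: S is constant there, hence so is J. *)
have jE : - y * ja + x * jb = 0.
  have r0 : 0 < 4^-1 - Num.max (N x) (N y) by rewrite subr_gt0 gt_max x4.
  have loc v : N (v.1 - (x, y).1) < 4^-1 - Num.max (N x) (N y) ->
      N (v.2 - (x, y).2) < 4^-1 - Num.max (N x) (N y) -> S v * J v = 1.
    have q (w z : R) : N z <= Num.max (N x) (N y) ->
        N (w - z) < 4^-1 - Num.max (N x) (N y) -> N w < 4^-1.
      by move=> zm wz; have := ler_normD (w - z) z; rewrite subrK; lra.
    move=> /q h1 /q h2; apply/mulfV/S0; [apply: h1|apply: h2]; rewrite le_max lexx ?orbT//.
  have [e1 e2] := grad_uniq_near r0 loc (gradM gs gj) (grad_cst 1 (x, y)).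
  apply: (mulfI Sne); rewrite mulr0.
  transitivity (- y * (S (x, y) * ja + sa * J (x, y)) + x * (S (x, y) * jb + sb * J (x, y))
    - (- y * sa + x * sb) * J (x, y)); first by ring.
  by rewrite e1 e2 sE; ring.
have gpsi := gradM gp gj.
have [z1 z2'] := Zg _ _ _ _ gpsi.
set p := (X in grad psi _ X _) in gpsi z1 z2'; set q := (X in grad psi _ _ X) in gpsi z1 z2'.
have Dpsi : 1 + (- y * p + x * q) = (1 + g x) * J (x, y).
  have -> : - y * p + x * q = phi (x, y) * (- y * ja + x * jb) + (- y * pa + x * pb) * J (x, y).
    by rewrite /p /q /J; ring.
  have JS : J (x, y) * S (x, y) = 1 by exact: mulVf.
  rewrite jE gpE mulr0 add0r; apply: (mulIf Sne).
  by rewrite mulrDl mul1r -!mulrA JS !mulr1 /S /rho /= -!expr2; ring.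
(* A coordinate of the rotated point is at most |x| + |y|; this is why the domain shrinks from 1/4
   to 1/8. *)
have Zb : N (Z1 (x, y)) < 4^-1 /\ N (Z2 (x, y)) < 4^-1.
  have cb := cos_max (psi (x, y)); have sb' := sin_max (psi (x, y)).
  have pr (w z : R) : N w < 8^-1 -> N z <= 1 -> N (w * z) < 8^-1.
    move=> w8 z1'; rewrite normrM; apply: le_lt_trans w8.
    by rewrite -[leRHS]mulr1 ler_wpM2l.
  have e : (4^-1 : R) = 8^-1 + 8^-1 by field.
  rewrite e; split.
    by apply: (le_lt_trans (ler_normB _ _)); apply: ltrD; exact: pr.
  by apply: (le_lt_trans (ler_normD _ _)); apply: ltrD; exact: pr.
have [ka [kb [kc [kd [gk1 gk2 i1 i2]]]]] := id _ _ Zb.1 Zb.2.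
have rE : Z1 (x, y) ^+ 2 + Z2 (x, y) ^+ 2 = rho (x, y).
  transitivity (rho (x, y) * (cos (psi (x, y)) ^+ 2 + sin (psi (x, y)) ^+ 2)).
    by rewrite /Z1 /Z2 /rho /=; ring.
  by rewrite cos2Dsin2 mulr1.
rewrite rE in i1 i2.
(* Along the circle, the rotated point moves with 1 plus the angular derivative of psi times its own
   rotation, so this factor multiplies the equation for K at the rotated point. *)
have fin (u v w : R) : - Z2 (x, y) * u + Z1 (x, y) * v = (1 + T (rho (x, y))) / beta * w ->
    - y * (u * (cos (psi (x, y)) - Z2 (x, y) * p) + v * (sin (psi (x, y)) + Z1 (x, y) * p)) +
    x * (u * (- sin (psi (x, y)) - Z2 (x, y) * q) + v * (cos (psi (x, y)) + Z1 (x, y) * q)) =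
    (1 + g x) / beta * w.
  move=> uv.
  transitivity ((1 + (- y * p + x * q)) * (- Z2 (x, y) * u + Z1 (x, y) * v)).
    by rewrite /Z1 /Z2 /=; ring.
  rewrite Dpsi uv -[1 + T _]/(S (x, y)) /J.
  by move: (S _) Sne => s sne; field; rewrite bne sne.
do 4 eexists; split; first exact: grad_comp gk1 z1 z2'.
- exact: grad_comp gk2 z1 z2'.
- exact: fin i1.
- exact: fin i2.
Qed.

End PotentialForm.

(** * The potential and the conjugacy *)

Section Assembly.
Variable R : realType.
Notation N := (@Num.norm _ R).

Lemma analytic1_restrict (F : R * R -> R) (a : R) :
  analytic2_at F (a, 0) -> analytic1_at (fun x => F (x, 0)) a.
Proof.
move=> [c [r [r0 H]]]; exists (fun i => c i 0%N), r; split=> // x xr.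
have n0 : N (0 : R) < r by rewrite normr0.
have [_] := H (x - a, 0) xr n0.
have -> : (a, 0) + (x - a, 0) = (x, 0) :> R * R.
  by rewrite -[LHS]/(a + (x - a), 0 + 0 : R) addr0 addrC subrK.
rewrite (_ : dseries _ = pseries (fun i => c i 0%N) (x - a))//.
apply/funext => n; rewrite /dseries /pseries /series /= big_mkord.
apply: eq_bigr => i _; case: n i => [|n] i; first by case: i.
rewrite big_ord_recl /= /monomial_term /= expr0 mulr1 big1 ?addr0// => j _.
by rewrite expr0n /= mulr0.
Qed.

Lemma diff_grad_pair (f g : R * R -> R) p (a b c d : R) v :
  grad f p a b -> grad g p c d ->
  'd (fun q => (f q, g q)) p v = (a * v.1 + b * v.2, c * v.1 + d * v.2).
Proof.
move=> [df fE] [dg gE]; rewrite diff_pair//= [v]surjective_pairing.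
by rewrite fE gE.
Qed.

Lemma det_jacobian_grad (X : R * R -> R * R) p (a b c d : R) :
  grad (fun q => (X q).1) p a b -> grad (fun q => (X q).2) p c d ->
  det_jacobian X p = a * d - b * c.
Proof.
move=> g1 g2; rewrite /det_jacobian !(grad_derive _ _ g1) !(grad_derive _ _ g2).
by rewrite !(mulr0, mulr1, addr0, add0r).
Qed.

(* V = g^2 / 2, where g is the inverse of the primitive G of gam; hence
   V' (G x) = x / gam x. *)
Lemma potential_from_primitive (G : R * R -> R) (gam : R -> R) (r : R) : 0 < r ->
  G (0, 0) = 0 ->
  (forall x, N x < r -> [/\ analytic2_at G (x, 0), grad G (x, 0) (gam x) 0, 0 < gam x &
     analytic2_at (fun w => gam w.1) (x, 0)]) ->
  exists (J : set R) (V : R -> R) (s : R),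
    [/\ open J /\ J 0, analytic1_on J V, V 0 = 0 /\ V^`() 0 = 0, 0 < V^`(2) 0 &
      0 < s /\ forall x, N x < s -> J (G (x, 0)) /\ V^`()%classic (G (x, 0)) = x / gam x].
Proof.
move=> r0 G0 GP; have z : N (0 : R) < r by rewrite normr0.
pose f1 (v : R * R) := G (v.1, 0).
have f1an x y : N x < r -> analytic2_at f1 (x, y).
  move=> xr; have [h _ _ _] := GP x xr.
  apply: (@analytic2_comp _ G fst (fun=> 0)) => //; first exact: analytic2_fst.
  exact: analytic2_cst.
have f1g x y : N x < r -> grad f1 (x, y) (gam x) 0.
  move=> xr; have [_ h _ _] := GP x xr.
  apply: grad_eq (grad_comp (h : grad G (fst (x, y), 0) _ _) (grad_fst _) (grad_cst 0 _)) _ _.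
    by rewrite mulr1 mulr0 addr0.
  by rewrite !mulr0 addr0.
have [_ _ gam0 gaman] := GP 0 z.
have det : gam 0 * 1 - 0 * 0 != 0 by rewrite mulr1 mul0r subr0 gt_eqF.
(* Keeping y as second component reduces the inversion of the one-variable function G (x, 0) to the
   planar theorem. *)
have [U [W [m1 [m2 [[oU U0 Ub] [oW W0] UP WP]]]]] :=
  inverse_function (f1an 0 0 z) (analytic2_snd (0, 0)) (G0 : f1 (0, 0) = 0)
    (erefl : snd (0, 0) = 0 :> R) (f1g 0 0 z) (grad_snd (0, 0)) det r0.
pose g u := m1 (u, 0); pose J := [set u : R | W (u, 0)].
have Jbox u : J u -> exists2 e : R, 0 < e & forall t, N (t - u) < e -> J t.
  move=> Ju; have [e e0 eW] := open_box oW Ju; exists e => // t te.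
  by apply: eW => //=; rewrite subrr normr0.
have oJ : open J.
  rewrite openE => u /Jbox[e e0 eJ]; apply/nbhs_ballP; exists e => //= t te.
  by apply: eJ; rewrite distrC.
have gP u : J u -> N (g u) < r /\ G (g u, 0) = u.
  move=> Ju; have [Ug e1 e2 _ _] := WP _ Ju; rewrite /= in e1 e2.
  by have [h _] := Ub _ Ug; split.
have dg u : J u -> is_derive u (1 : R) g (gam (g u))^-1.
  move=> Ju; have [_ _ _ an _] := WP _ Ju; have [A [B gm]] := analytic2_grad an.
  have [gr _] := gP u Ju.
  have d1 : is_derive u (1 : R) g A.
    have := grad_curve gm (is_derive_id u 1) (is_derive_cst (0 : R) u 1).
    by rewrite mulr1 mulr0 addr0.
  have [_ gg ggt _] := GP _ gr.
  have d2 := grad_curve gg d1 (is_derive_cst (0 : R) u 1).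
  rewrite mul0r addr0 in d2.
  have d3 : is_derive u (1 : R) (fun t => G (g t, 0)) 1.
    apply: near_eq_is_derive (is_derive_id u 1).
    have [e e0 eJ] := Jbox u Ju; apply/nbhs_ballP; exists e => //= t te.
    by have [|_ ->] := gP t; first by apply: eJ; rewrite distrC.
  have [_ E2] := d2; have [_ E3] := d3; rewrite E3 in E2.
  apply: is_derive_eq d1 _; have gn : gam (g u) != 0 by rewrite gt_eqF.
  by apply: (mulfI gn); rewrite -E2 mulfV.
pose V u := 2^-1 * (g u * g u).
have dV u : J u -> is_derive u (1 : R) V (g u * (gam (g u))^-1).
  move=> Ju; have p := (g u, 0 : R).
  have hq := gradM (grad_cst 2^-1 (g u, 0)) (gradM (grad_fst (g u, 0)) (grad_fst (g u, 0))).
  have := grad_curve hq (dg u Ju) (is_derive_cst (0 : R) u 1).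
  move=> h; apply: is_derive_eq h _; rewrite /=.
  by set w := (gam (g u))^-1; field.
have V1 u : J u -> V^`()%classic u = g u / gam (g u).
  by move=> Ju; rewrite derive1E; have [_ ->] := dV u Ju.
have g0 : g 0 = 0 by have [_ h _ _ _] := UP _ U0; rewrite /f1 /= G0 in h.
have [u u0 uU] := open_box oU U0.
exists J, V, u; split.
- by split.
- move=> a Ja; have [_ _ _ an _] := WP _ Ja.
  apply: (@analytic1_restrict (fun v => 2^-1 * (m1 v * m1 v))).
  by apply: analytic2_scale; exact: analytic2M.
- by rewrite V1// /V g0 !mul0r mulr0.
(* V' is F along g. As g 0 = 0, the derivative of 1 / gam contributes nothing at 0, and V'' 0 = 1 /
   gam(0)^2. *)
- pose F (v : R * R) := v.1 * (gam v.1)^-1.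
  have [A [B gAB]] := analytic2_grad (analytic2_inv gaman (lt0r_neq0 gam0)).
  have gF := gradM (grad_fst (0, 0)) gAB.
  have gF' : grad F (g 0, 0) (gam 0)^-1 0.
    by rewrite g0; apply: grad_eq gF _ _; rewrite /= !mul0r add0r ?mul1r.
  have := grad_curve gF' (dg 0 W0) (is_derive_cst (0 : R) (0 : R) (1 : R)).
  rewrite mul0r addr0 g0 => dF.
  have dF' : is_derive (0 : R) (1 : R) (V^`()%classic) ((gam 0)^-1 / gam 0).
    apply: near_eq_is_derive dF.
    have [e e0 eJ] := Jbox 0 W0; apply/nbhs_ballP; exists e => //= t te.
    by rewrite V1//; apply: eJ; rewrite distrC.
  rewrite derive1nS derive1n1 derive1E; have [_ ->] := dF'.
  by rewrite divr_gt0// invr_gt0.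
split=> // x xu.
have Ux : U (x, 0) by apply: uU; rewrite /= subr0 ?normr0.
have [Wx e1 _ _ _] := UP _ Ux; rewrite /f1 /= in Wx e1.
by split=> //; rewrite V1// /g e1.
Qed.

Lemma inverse_jacobian (a b c d p q r s : R) :
  p * a + q * c = 1 -> p * b + q * d = 0 -> r * a + s * c = 0 -> r * b + s * d = 1 ->
  p * s - q * r != 0.
Proof.
move=> e1 e2 e3 e4; apply/eqP => e0.
have : (p * s - q * r) * (a * d - b * c) = 1.
  transitivity ((p * a + q * c) * (r * b + s * d) - (p * b + q * d) * (r * a + s * c)).
    by ring.
  by rewrite e1 e2 e4 mulr1 mul0r subr0.
by rewrite e0 mul0r => /eqP; rewrite eq_sym oner_eq0.
Qed.

(* The coordinates (x, y) of [potential_form] transform X into (- y, x) / gam x,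
   and the map h = (G x, - y) transforms the latter into (h2, - x / gam x). *)
Lemma center_conjugate (Omega : set (R * R)) (X : R * R -> R * R)
    (K1 K2 G : R * R -> R) (gam : R -> R) (J : set R) (D : R -> R) (s a0 b0 c0 d0 : R) :
  open Omega -> Omega (0, 0) ->
  K1 (0, 0) = 0 -> K2 (0, 0) = 0 -> G (0, 0) = 0 ->
  analytic2_at K1 (0, 0) -> analytic2_at K2 (0, 0) ->
  grad K1 (0, 0) a0 b0 -> grad K2 (0, 0) c0 d0 -> a0 * d0 - b0 * c0 != 0 ->
  (forall v, N v.1 < 8^-1 -> N v.2 < 8^-1 ->
    [/\ analytic2_at G v, grad G v (gam v.1) 0 & 0 < gam v.1]) ->
  (forall x y, N x < 8^-1 -> N y < 8^-1 -> exists a b c d,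
      [/\ grad K1 (x, y) a b, grad K2 (x, y) c d,
        - y * a + x * b = gam x * (X (K1 (x, y), K2 (x, y))).1 &
        - y * c + x * d = gam x * (X (K1 (x, y), K2 (x, y))).2]) ->
  0 < s -> (forall x, N x < s -> J (G (x, 0)) /\ D (G (x, 0)) = x / gam x) ->
  analytically_conjugate Omega X [set z : R * R | J z.1] (fun z => (z.2, - D z.1)).
Proof.
move=> oO O0 K10 K20 G0 K1an K2an gK1 gK2 detK GP KX s0 JD.
have r8 : 0 < Num.min 8^-1 s :> R by rewrite lt_min s0 invr_gt0 ltr0n.
have [U [W [l1 [l2 [[oU U0 Ub] [oW W0] UP WP]]]]] :=
  inverse_function K1an K2an K10 K20 gK1 gK2 detK r8.
have Ub8 u : U u -> [/\ N u.1 < 8^-1, N u.2 < 8^-1 & N u.1 < s].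
  by move=> /Ub; rewrite !lt_min => -[/andP[? ?] /andP[? ?]].
have z8 : N (0 : R) < 8^-1 by rewrite normr0 invr_gt0.
have [l10 l20] : l1 (0, 0) = 0 /\ l2 (0, 0) = 0.
  by have [_ h1 h2 _ _] := UP _ U0; rewrite K10 K20 in h1 h2.
pose h1 q := G (l1 q, 0); pose h2 q := - l2 q.
have h1an q : W q -> analytic2_at h1 q.
  move=> Wq; have [Uq _ _ an1 _] := WP q Wq; have [x8 _ _] := Ub8 _ Uq.
  apply: (@analytic2_comp _ G l1 (fun=> 0)) => //; last exact: analytic2_cst.
  by have [] := GP (l1 q, 0) x8 z8.
have h2an q : W q -> analytic2_at h2 q.
  by move=> Wq; have [_ _ _ _ an2] := WP q Wq; exact: analytic2N.
have h10 : h1 (0, 0) = 0 by rewrite /h1 l10.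
have h20 : h2 (0, 0) = 0 by rewrite /h2 l20 oppr0.
have hK1 u : U u -> h1 (K1 u, K2 u) = G (u.1, 0).
  by move=> Uu; have [_ e1 _ _ _] := UP u Uu; rewrite /h1 e1.
have hK2 u : U u -> h2 (K1 u, K2 u) = - u.2.
  by move=> Uu; have [_ _ e2 _ _] := UP u Uu; rewrite /h2 e2.
have gU x y : U (x, y) -> grad (fun v => G (v.1, 0)) (x, y) (gam x) 0.
  move=> Uu; have [x8 _ _] := Ub8 _ Uu; have [_ gG _] := GP (x, 0) x8 z8.
  apply: grad_eq (grad_comp (gG : grad G (fst (x, y), 0) _ _) (grad_fst _) (grad_cst 0 _)) _ _.
    by rewrite mulr1 mulr0 addr0.
  by rewrite !mulr0 addr0.
have gN x y : grad (fun v : R * R => - v.2) (x, y) 0 (- 1).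
  have -> : (fun v : R * R => - v.2) = (fun v => - 1 * v.2).
    by apply/funext => v; rewrite mulN1r.
  by apply: grad_eq (gradM (grad_cst (- 1) (x, y)) (grad_snd (x, y))) _ _; rewrite /=; ring.
(* In the coordinates (x, y) the map h is (G x, - y), so the product of the Jacobian matrices of h
   and K is diagonal with entries gam x and -1. *)
have chain x y a b c d A B A' B' : U (x, y) -> grad K1 (x, y) a b -> grad K2 (x, y) c d ->
    grad h1 (K1 (x, y), K2 (x, y)) A B -> grad h2 (K1 (x, y), K2 (x, y)) A' B' ->
    [/\ A * a + B * c = gam x, A * b + B * d = 0, A' * a + B' * c = 0 &
      A' * b + B' * d = - 1].
  move=> Uu ga gc gh1 gh2; have [e e0 eU] := open_box oU Uu.
  have [e1 e2] := grad_uniq_near e0 (fun v v1 v2 => hK1 v (eU v v1 v2))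
    (grad_comp gh1 ga gc) (gU x y Uu).
  have [e3 e4] := grad_uniq_near e0 (fun v v1 v2 => hK2 v (eU v v1 v2))
    (grad_comp gh2 ga gc) (gN x y).
  by split.
have [A [B gh1]] := analytic2_grad (h1an _ W0).
have [A' [B' gh2]] := analytic2_grad (h2an _ W0).
have gh1' : grad h1 (K1 (0, 0), K2 (0, 0)) A B by rewrite K10 K20.
have gh2' : grad h2 (K1 (0, 0), K2 (0, 0)) A' B' by rewrite K10 K20.
have [q1 q2 q3 q4] := chain 0 0 _ _ _ _ _ _ _ _ U0 gK1 gK2 gh1' gh2'.
have [_ _ gam0] := GP (0, 0) z8 z8.
have gn0 : gam 0 != 0 by rewrite gt_eqF.
(* Dividing the first row by gam 0 and changing the sign of the second makes the matrix a left
   inverse of DK(0). *)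
have det : A * B' - B * A' != 0.
  have := @inverse_jacobian a0 b0 c0 d0 (A / gam 0) (B / gam 0) (- A') (- B').
  have f1 : A / gam 0 * a0 + B / gam 0 * c0 = 1.
    by rewrite mulrAC [B / _ * _]mulrAC -mulrDl q1 mulfV.
  have f2 : A / gam 0 * b0 + B / gam 0 * d0 = 0.
    by rewrite mulrAC [B / _ * _]mulrAC -mulrDl q2 mul0r.
  have f3 : - A' * a0 + - B' * c0 = 0 by rewrite !mulNr -opprD q3 oppr0.
  have f4 : - A' * b0 + - B' * d0 = 1 by rewrite !mulNr -opprD q4 opprK.
  move=> /(_ f1 f2 f3 f4); apply: contraNneq => e; apply/eqP.
  transitivity (- (A * B' - B * A') / gam 0); first by ring.
  by rewrite e oppr0 mul0r.
have oOW : open (Omega `&` W) by exact: openI.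
have [e e0 eOW] := open_box oOW (conj O0 W0 : (Omega `&` W) (0, 0)).
have [U' [W' [n1 [n2 [[oU' U'0 U'b] [oW' W'0] U'P W'P]]]]] :=
  inverse_function (h1an _ W0) (h2an _ W0) h10 h20 gh1 gh2 det e0.
have inOW q : U' q -> Omega q /\ W q.
  by move=> /U'b[b1 b2]; apply: eOW; rewrite subr0.
exists U', W', (fun q => (h1 q, h2 q)); split.
- by split=> // q /inOW[].
- split=> // w /W'P[/inOW[_ Wn] e1 _ _ _] /=; rewrite -e1.
  have [Un _ _ _ _] := WP _ Wn; have [_ _ ls] := Ub8 _ Un.
  by have [] := JD _ ls.
- split.
  + split.
    * by move=> q /U'P[].
    * move=> p q /set_mem Up /set_mem Uq [e1 e2].
      have [_ p1 p2 _ _] := U'P _ Up; have [_ r1 r2 _ _] := U'P _ Uq.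
      by rewrite [p]surjective_pairing [q]surjective_pairing -p1 -p2 -r1 -r2 e1 e2.
    * move=> w /W'P[Un e1 e2 _ _]; exists (n1 w, n2 w) => //.
      by rewrite e1 e2 -surjective_pairing.
  + by move=> q /U'P[].
  + exists (fun w => (n1 w, n2 w)); split.
      by move=> q /U'P[_ e1 e2 _ _]; rewrite e1 e2 -surjective_pairing.
    by move=> w /W'P[].
- by rewrite h10 h20.
move=> q U'q; have [_ Wq] := inOW q U'q; have [Ul k1 k2 _ _] := WP q Wq.
have [x8 y8 xs] := Ub8 _ Ul; rewrite /= in x8 y8 xs.
set x := l1 q in Ul k1 k2 x8 y8 xs; set y := l2 q in Ul k1 k2 y8.
have qE : q = (K1 (x, y), K2 (x, y)) by rewrite k1 k2 -surjective_pairing.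
have [C [E gC]] := analytic2_grad (h1an _ Wq).
have [C' [E' gC']] := analytic2_grad (h2an _ Wq).
have [a [b [c [d [ga gc i1 i2]]]]] := KX x y x8 y8.
rewrite (diff_grad_pair _ gC gC').
rewrite [in grad h1 _]qE in gC; rewrite [in grad h2 _]qE in gC'.
have [w1 w2 w3 w4] := chain _ _ _ _ _ _ _ _ _ _ Ul ga gc gC gC'.
rewrite -qE in i1 i2.
have [_ _ gx] := GP (x, y) x8 y8; rewrite /= in gx.
have gxn : gam x != 0 by rewrite gt_eqF.
have [_ Dx] := JD x xs.
(* Both sides are computed in the coordinates (x, y): on the left gam x X(q) is the rotation
   derivative of K, to which the diagonal product of [chain] applies. *)
transitivity (- y, - (x / gam x)); last by rewrite -Dx.
congr pair; apply: (mulfI gxn).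
  transitivity (C * (gam x * (X q).1) + E * (gam x * (X q).2)); first by ring.
  rewrite -i1 -i2; transitivity (- y * (C * a + E * c) + x * (C * b + E * d)); first by ring.
  by rewrite w1 w2; ring.
transitivity (C' * (gam x * (X q).1) + E' * (gam x * (X q).2)); first by ring.
rewrite -i1 -i2; transitivity (- y * (C' * a + E' * c) + x * (C' * b + E' * d)); first by ring.
by rewrite w3 w4; field.
Qed.

End Assembly.

Unset Implicit Arguments.

Theorem theorem1p1 (R : realType) (Omega : set (R * R)) (X : R * R -> R * R)
    (open_Omega : open Omega) (Omega0 : Omega (0, 0))
    (X_analytic : analytic2_on Omega X)
    (X_center : is_center Omega X (0, 0))
    (X_nondegenerate : nondegenerate_at X (0, 0)) :
  exists (J : set R) (V : R -> R),
    [/\ open J /\ J 0,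
        analytic1_on J V,
        V 0 = 0 /\ V^`() 0 = 0,
        0 < V^`(2) 0 &
        analytically_conjugate Omega X
          [set z : R * R | J z.1] (fun z => (z.2, - (V^`())%classic z.1))].
Proof.
have [X1an X2an] := X_analytic _ Omega0.
have [a [b g1]] := analytic2_grad X1an; have [c [d g2]] := analytic2_grad X2an.
have det : a * d - b * c != 0 by rewrite -(det_jacobian_grad g1 g2).
have [K1 [K2 [G [gam [[K10 K20 G0] [K1an K2an] [a0 [b0 [c0 [d0 [gK1 gK2 dK]]]]] GP KX]]]]] :=
  potential_form X_analytic Omega0 X_center g1 g2 det.
have r8 : (0 : R) < 8^-1 by rewrite invr_gt0.
have z8 : `|(0 : R)| < 8^-1 by rewrite normr0.
have GP' x : `|x| < 8^-1 -> [/\ analytic2_at G (x, 0), grad G (x, 0) (gam x) 0,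
    0 < gam x & analytic2_at (fun w => gam w.1) (x, 0)].
  by move=> x8; exact: GP (x, 0) x8 z8.
have [J [V [s [J0 Van V0 V2 [s0 sJ]]]]] := potential_from_primitive r8 G0 GP'.
exists J, V; split=> //.
apply: (center_conjugate open_Omega Omega0 K10 K20 G0 K1an K2an gK1 gK2 dK _ KX s0 sJ).
by move=> v v1 v2; have [] := GP v v1 v2.
Qed.
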